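(* Let $\overline{M}$ be a compact, connected, smooth Riemannian manifold of dimension $n$ with nonempty boundary and interior $M$, and let $e(x,y;\lambda)$ be the spectral function of the Dirichlet Laplacian $\Delta_D$. For each $\alpha\in\mathbb{N}^{2n}$ there is a positive constant $C_\alpha$ such that, for all $\lambda>0$ and uniformly in $x,y\in\overline{M}$, $$|D^\alpha_{x,y}e(x,y;\lambda)|\leq C_\alpha\,\lambda^{\frac{n+|\alpha|}{2}}.$$
   Context: Let $g$ be the Riemannian metric; $L^2(M)$ is taken with respect to the Riemannian volume measure. $H^k(M)$ is the space of $u\in L^2(M)$ with $Pu\in L^2(M)$ for all differential operators $P$ of order at most $k$ with coefficients in $C^\infty(\overline{M})$, and $H^1_0(M)$ is the closure of $C_c^\infty(M)$ in $H^1(M)$. The Dirichlet Laplacian $\Delta_D$ is the positive selfadjoint operator with domain $H^1_0(M)\cap H^2(M)$ given in local coordinates by $\Delta u=-\frac{1}{\sqrt{\det g}}\partial_j\left(\sqrt{\det g}\,g^{jk}\partial_k u\right)$. It has discrete spectrum; let $(u_j)$ be an orthonormal basis of $L^2(M)$ consisting of eigenfunctions of $\Delta_D$ (these lie in $C^\infty(\overline{M})$), with eigenvalues $0<\lambda_1\leq\lambda_2\leq\dots$ repeated according to multiplicity. The spectral function is $$e(x,y;\lambda)=\sum_{j:\lambda_j\leq\lambda}\overline{u_j(x)}\,u_j(y),$$ so that $e(x,y;\lambda)$ times the Riemannian density in $y$ is the integral kernel of the spectral projection $E_\lambda$ of $\Delta_D$ onto $(-\infty,\lambda]$. The derivatives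 $D^\alpha_{x,y}$ are taken in the local coordinates of a fixed finite atlas of $\overline{M}$ (with coordinates restricted to compact subsets of the charts that together cover $\overline{M}$); the constant $C_\alpha$ does not depend on $x,y,\lambda$. *)

(* Defs.v *)
From HB Require Import structures.
From mathcomp Require Export all_boot all_order all_algebra.
From mathcomp Require Export complex.
From mathcomp Require Export all_classical all_reals all_analysis.

Set Implicit Arguments.
Unset Strict Implicit.
Unset Printing Implicit Defensive.

Import Order.TTheory GRing.Theory Num.Theory numFieldNormedType.Exports.

Local Open Scope classical_set_scope.
Local Open Scope ring_scope.
Local Open Scope complex_scope.

Section Euclidean.
Context {R : realType} {n : nat}.
Local Notation V := 'rV[R]_n.

Definition basis_vec (k : 'I_n) : V := delta_mx 0 k.

(* The first coordinate is the one of index 0; for n = 0 this is the point. *)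
Definition half_space : set V :=
  [set x | forall k : 'I_n, k = 0%N :> nat -> 0 <= x ord0 k].

Definition half_space_boundary : set V :=
  [set x | half_space x /\ exists k : 'I_n, k = 0%N :> nat /\ x ord0 k = 0].

Definition partials (s : seq 'I_n) (F : V -> R) : V -> R :=
  foldr (fun k G x => 'D_(basis_vec k) G x) F s.

Definition smooth_on_open (W : set V) (F : V -> R) : Prop :=
  forall (s : seq 'I_n) (x : V), W x ->
    {for x, continuous (partials s F)} /\
    forall k, derivable (partials s F) x (basis_vec k).

(* Smoothness on an arbitrary subset D: existence of local smooth extensions. *)
Definition smooth_on (D : set V) (f : V -> R) : Prop :=
  forall x, D x -> exists (W : set V) (F : V -> R),
    [/\ open W, W x, smooth_on_open W F & forall y, W y -> D y -> F y = f y].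

(* Partial derivative relative to the half space: the difference quotient only
   uses points of the half space, so that it is one-sided in the normal
   direction at boundary points and the usual one elsewhere.  For a function
   which is smooth on a relatively open subset of the half space it is the
   derivative of any local smooth extension. *)
Definition rpartial (k : 'I_n) (f : V -> R) (x : V) : R :=
  lim ((fun h : R => h^-1 * (f (x + h *: basis_vec k) - f x))
       @ within [set h : R | half_space (x + h *: basis_vec k)] 0^').

Definition csmooth_on (D : set V) (f : V -> R[i]) : Prop :=
  smooth_on D (fun x => complex.Re (f x)) /\
  smooth_on D (fun x => complex.Im (f x)).

Definition cpartial (k : 'I_n) (f : V -> R[i]) (x : V) : R[i] :=
  rpartial k (fun y => complex.Re (f y)) x
  +i* rpartial k (fun y => complex.Im (f y)) x.

Definition cpartials (a : 'I_n -> nat) (f : V -> R[i]) : V -> R[i] :=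
  foldr (fun k h => iter (a k) (cpartial k) h) f (enum 'I_n).

End Euclidean.

(* Integral of a nonnegative Borel function with respect to n-dimensional
   Lebesgue measure, as an iterated integral (Tonelli). *)
Fixpoint lebesgue_integral_rV {R : realType} (n : nat) :
    ('rV[R]_n -> \bar R) -> \bar R :=
  match n with
  | 0%N => fun f => f 0
  | m.+1 => fun f =>
      (\int[@lebesgue_measure R]_t
         lebesgue_integral_rV (fun v : 'rV[R]_m =>
           f (row_mx (t%:M : 'rV[R]_1) v)))%E
  end.

(* A finite smooth atlas with values in the half space.  [chart_inv i] is the
   inverse of the chart [chart_map i] : [chart_dom i] -> half space; the values of
   [chart_map i] outside [chart_dom i] and of [chart_inv i] outside the image of the chart
   are irrelevant. *)
Record atlas (R : realType) (n : nat) (M : ptopologicalType) (I : finType) :=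
  Atlas {
    chart_dom : I -> set M;
    chart_map : I -> M -> 'rV[R]_n;
    chart_inv : I -> 'rV[R]_n -> M;
    chart_dom_open : forall i, open (chart_dom i);
    chart_dom_cover : forall p, exists i, chart_dom i p;
    chart_mapK : forall i p, chart_dom i p -> chart_inv i (chart_map i p) = p;
    chart_map_half : forall i, chart_map i @` chart_dom i `<=` half_space;
    chart_map_image_open : forall i, exists O : set 'rV[R]_n,
      open O /\ chart_map i @` chart_dom i = O `&` half_space;
    chart_map_continuous : forall i, {within chart_dom i, continuous (chart_map i)};
    chart_inv_continuous : forall i,
      {within chart_map i @` chart_dom i, continuous (chart_inv i)};
    transition_smooth : forall i j k,
      smooth_on (chart_map i @` (chart_dom i `&` chart_dom j))
                (fun x => chart_map j (chart_inv i x) ord0 k)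
  }.

Section Manifold.
Context {R : realType} {n : nat} {M : ptopologicalType} {I : finType}.
Variable A : atlas R n M I.

Definition chart_image (i : I) : set 'rV[R]_n := chart_map A i @` chart_dom A i.

Definition mboundary : set M :=
  [set p | exists2 i, chart_dom A i p & half_space_boundary (chart_map A i p)].

Definition minterior : set M := ~` mboundary.

Definition msmooth (u : M -> R[i]) : Prop :=
  forall i, csmooth_on (chart_image i) (u \o chart_inv A i).

Definition test_function (u : M -> R[i]) : Prop :=
  msmooth u /\ exists K : set M,
    [/\ compact K, K `<=` minterior & forall p, ~ K p -> u p = 0].

(* Entry (k, a) is the k-th partial derivative of the a-th component of the
   transition map from chart i to chart j. *)
Definition jacobian (i j : I) (x : 'rV[R]_n) : 'M[R]_n :=
  \matrix_(k, a) rpartial k (fun y => chart_map A j (chart_inv A i y) ord0 a) x.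

(* [G i x] is the matrix (g_jk) in the coordinates of chart i. *)
Record riemannian_metric (G : I -> 'rV[R]_n -> 'M[R]_n) : Prop :=
  RiemannianMetric {
    metric_smooth : forall i j k,
      smooth_on (chart_image i) (fun x => G i x j k);
    metric_sym : forall i x, chart_image i x -> (G i x)^T = G i x;
    metric_pos : forall i x, chart_image i x -> forall v : 'rV[R]_n,
      v != 0 -> 0 < (v *m G i x *m v^T) ord0 ord0;
    metric_change : forall i j p, chart_dom A i p -> chart_dom A j p ->
      G i (chart_map A i p) =
        jacobian i j (chart_map A i p) *m G j (chart_map A j p)
        *m (jacobian i j (chart_map A i p))^T
  }.

(* Linear differential operators of order at most k with coefficients in
   C^oo of the manifold with boundary; only their action on smooth functions
   is constrained. *)
Definition diff_operator (k : nat) (P : (M -> R[i]) -> (M -> R[i])) : Prop :=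
  forall i, exists c : {ffun 'I_n -> 'I_k.+1} -> 'rV[R]_n -> R[i],
    (forall a, csmooth_on (chart_image i) (c a)) /\
    forall u, msmooth u -> forall x, chart_image i x ->
      P u (chart_inv A i x) =
      \sum_(a : {ffun 'I_n -> 'I_k.+1} | (\sum_(l < n) a l <= k)%N)
        c a x * cpartials (fun l => a l : nat) (u \o chart_inv A i) x.

Section Riemannian.
Variable G : I -> 'rV[R]_n -> 'M[R]_n.

Definition sqrt_det (i : I) (x : 'rV[R]_n) : R := Num.sqrt (\det (G i x)).

Definition laplacian_chart (i : I) (f : 'rV[R]_n -> R[i]) (x : 'rV[R]_n)
    : R[i] :=
  - (((sqrt_det i x)^-1)%:C *
     \sum_(j < n) cpartial j (fun y =>
       \sum_(k < n) (sqrt_det i y * invmx (G i y) j k)%:C * cpartial k f y) x).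

(* The expression does not depend on the chart; one around p is chosen. *)
Definition laplacian (u : M -> R[i]) (p : M) : R[i] :=
  let i := projT1 (cid (chart_dom_cover A p)) in
  laplacian_chart i (u \o chart_inv A i) (chart_map A i p).

End Riemannian.
End Manifold.

Notation borel M := (g_sigma_algebraType (@open M)).

Section Dirichlet.
Context {R : realType} {n : nat} {M : ptopologicalType} {I : finType}.
Variables (A : atlas R n M I) (G : I -> 'rV[R]_n -> 'M[R]_n).
Variable vol : {measure set (borel M) -> \bar R}.

(* This determines [vol] uniquely, the charts being a finite open cover. *)
Definition riemannian_volume : Prop :=
  forall (i : I) (B : set (borel M)), measurable B -> B `<=` chart_dom A i ->
    vol B = lebesgue_integral_rV (fun x : 'rV[R]_n =>
      (\1_(chart_map A i @` B) x * sqrt_det G i x)%:E).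

Definition cintegral (f : M -> R[i]) : R[i] :=
  Rintegral vol setT (fun p : borel M => complex.Re (f p))
  +i* Rintegral vol setT (fun p : borel M => complex.Im (f p)).

Definition cinner (f h : M -> R[i]) : R[i] :=
  cintegral (fun p => f p * (h p)^*).

Definition L2normsq (f : M -> R[i]) : \bar R :=
  (\int[vol]_(p in [set: borel M]) ((Normc.normc (f p)) ^+ 2)%:E)%E.

Definition L2 (f : M -> R[i]) : Prop :=
  [/\ measurable_fun [set: borel M] (fun p : borel M => complex.Re (f p)),
      measurable_fun [set: borel M] (fun p : borel M => complex.Im (f p)) &
      (L2normsq f < +oo)%E].

Definition formal_transpose (k : nat) (P Q : (M -> R[i]) -> (M -> R[i])) :=
  diff_operator A k Q /\
  forall phi psi, test_function A phi -> test_function A psi ->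
    cintegral (fun p => P phi p * psi p) = cintegral (fun p => phi p * Q psi p).

(* [P u = f] in the sense of distributions on the interior, with f in L^2. *)
Definition weak_apply (k : nat) (P : (M -> R[i]) -> (M -> R[i]))
    (u f : M -> R[i]) : Prop :=
  L2 f /\ exists Q, formal_transpose k P Q /\
    forall phi, test_function A phi ->
      cintegral (fun p => f p * phi p) = cintegral (fun p => u p * Q phi p).

Definition Hk (k : nat) (u : M -> R[i]) : Prop :=
  L2 u /\ forall P, diff_operator A k P -> exists f, weak_apply k P u f.

(* Closure of the test functions in H^1, whose topology is the one given by
   the seminorms u |-> || P u ||_{L^2}, P of order at most 1. *)
Definition H10 (u : M -> R[i]) : Prop :=
  Hk 1 u /\ exists phi : nat -> M -> R[i],
    (forall m, test_function A (phi m)) /\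
    forall P f, diff_operator A 1 P -> weak_apply 1 P u f ->
      (fun m => L2normsq (fun p => P (phi m) p - f p)) @ \oo --> 0%E.

(* Graph of the Dirichlet Laplacian: u is in the domain and f = Delta u. *)
Definition dirichlet_laplacian (u f : M -> R[i]) : Prop :=
  [/\ H10 u, Hk 2 u & weak_apply 2 (laplacian A G) u f].

(* Elements of L^2 are represented by functions; as eigenfunctions are smooth
   up to the boundary, u_j is taken to be the smooth representative.  The
   eigenvalues are indexed from 0. *)
Record dirichlet_eigenbasis (u : nat -> M -> R[i]) (lam : nat -> R) : Prop :=
  DirichletEigenbasis {
    eigen_smooth : forall j, msmooth A (u j);
    eigen_eq : forall j,
      dirichlet_laplacian (u j) (fun p => (lam j)%:C * u j p);
    eigen_orthonormal : forall i j, cinner (u i) (u j) = (i == j)%:R;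
    eigen_complete : forall f, L2 f ->
      (fun N : nat => L2normsq (fun p =>
         f p - \sum_(j < N) cinner f (u j) * u j p)) @ \oo --> 0%E;
    eigen_pos : 0 < lam 0%N;
    eigen_mono : forall i j, (i <= j)%N -> lam i <= lam j;
    eigen_discrete : forall L : R, finite_set [set j | lam j <= L]
  }.

End Dirichlet.

Definition spectral_function {R : realType} {M : Type}
    (u : nat -> M -> R[i]) (lam : nat -> R) (x y : M) (L : R) : R[i] :=
  \sum_(j \in [set j | lam j <= L]) (u j x)^* * u j y.

(* [a] lists the n orders in x, then the n orders in y; x and y are the
   coordinates in the charts i and j. *)
Definition kernel_derivative {R : realType} {n : nat} {M : ptopologicalType}
    {I : finType} (A : atlas R n M I) (e : M -> M -> R[i])
    (a : 'I_(n + n) -> nat) (i j : I) (x y : 'rV[R]_n) : R[i] :=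
  cpartials (fun k => a (lshift n k)) (fun x' =>
    cpartials (fun k => a (rshift n k)) (fun y' =>
      e (chart_inv A i x') (chart_inv A j y')) y) x.

(* Main.v *)
(* By Cauchy-Schwarz it suffices to bound, for |s| = a and x in the compact set
   K_i of chart i, the sum of |d^s u_j(x)|^2 over lambda_j <= L by C L^(n/2 + a).
   With c_j = d^s u_j(x) (conjugated), this sum is the value at x of d^s of the
   combination f = sum_j c_j u_j, and |f|_2^2 is again that sum; so the bound
   amounts to |d^s f(x)| <= C L^(n/4 + a/2) |f|_2. Put U_k = sum_j c_j lambda_j^k u_j,
   so that U_(k+1) = Delta U_k, U_k = 0 on the boundary and |U_k|_2 <= L^k |f|_2.
   At the length scale r ~ L^(-1/2) all derivatives of f are then controlled in
   L^2 on boxes around x: Caccioppoli's inequality gains one derivative, tangential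
   derivatives preserve the Dirichlet condition, and the equation expresses the
   second normal derivative through the others. A Sobolev inequality on boxes
   turns this into the pointwise bound.

   The eigenbasis is given weakly, so the equation and the boundary condition are
   derived first: the equation by testing against bump functions supported in one
   chart (the Laplacian does not depend on the chart because the energy form does
   not), and u_j = 0 on the boundary by a Poincare inequality on thin strips. *)

From HB Require Import structures.
Require Import Defs.
From mathcomp Require Import all_boot all_order all_algebra.
From mathcomp Require Import complex.
From mathcomp Require Import all_classical all_reals all_analysis.
From mathcomp Require Import measurable_realfun.
From mathcomp Require Import ring lra.

Set Implicit Arguments.
Unset Strict Implicit.
Unset Printing Implicit Defensive.

Import Order.TTheory GRing.Theory Num.Theory numFieldNormedType.Exports.

Local Open Scope classical_set_scope.
Local Open Scope ring_scope.
Local Open Scope complex_scope.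

(** * Smooth functions on Euclidean space and on the half-space *)

Section Calculus.
Context {R : realType}.

Lemma is_deriveP (V : normedModType R) (f : V -> R) (x v : V) (d : R) :
  is_derive x v f d <->
  forall e : R, 0 < e -> exists2 r : R, 0 < r &
    forall h : R, `|h| < r -> `|f (x + h *: v) - f x - h * d| <= e * `|h|.
Proof.
split=> [[df dv] e e0|H].
- have : (fun h : R => h^-1 *: ((f \o shift x) (h *: v) - f x)) @ 0^' --> d.
    by rewrite -dv; exact: df.
  move/cvgrPdist_le => /(_ e e0); rewrite near_withinE.
  move/nbhs_ballP => [r /= r0 Hr]; exists r => // h hr.
  have [->|h0] := eqVneq h 0.
    by rewrite scale0r addr0 subrr mul0r subrr normr0 mulr0.
  have /= := Hr h; rewrite /ball /= sub0r normrN => /(_ hr h0).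
  rewrite (addrC _ x) distrC => Hh.
  rewrite (_ : _ - _ - _ = h * (h^-1 *: (f (x + h *: v) - f x) - d)).
    by rewrite normrM mulrC ler_wpM2r.
  by rewrite mulrBr /GRing.scale /= mulrA divff // mul1r.
- have C : (fun h : R => h^-1 *: ((f \o shift x) (h *: v) - f x)) @ 0^' --> d.
    apply/cvgrPdist_le => e e0; rewrite near_withinE; apply/nbhs_ballP.
    have [r r0 Hr] := H e e0; exists r => //= h.
    rewrite /ball /= sub0r normrN => /Hr Hh h0.
    rewrite (addrC _ x) distrC.
    rewrite -(@ler_pM2l _ `|h|) ?normr_gt0// -normrM mulrBr.
    by rewrite /GRing.scale /= mulrA divff // mul1r [leRHS]mulrC.
  split; first by apply/cvg_ex; exists d.
  exact: cvg_lim C.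
Qed.

Lemma is_derive_line (V : normedModType R) (f : V -> R) (x v : V) (t d : R) :
  is_derive (x + t *: v) v f d ->
  is_derive t (1 : R) (fun s : R => f (x + s *: v)) d.
Proof.
move/is_deriveP => H; apply/is_deriveP => e /H [r r0 Hr]; exists r => // h /Hr.
by rewrite [h%:A]mulr1 scalerDl addrA.
Qed.

Lemma continuous_atP (V W : normedModType R) (f : V -> W) (x : V) :
  {for x, continuous f} <-> forall e : R, 0 < e -> exists2 r : R, 0 < r &
    forall y, `|y - x| < r -> `|f y - f x| < e.
Proof.
split=> [H e e0|H].
- move/cvgrPdist_lt : H => /(_ e e0) /nbhs_ballP [r /= r0 Hr].
  exists r => // y yr; rewrite distrC; apply: Hr.
  by rewrite -ball_normE /= distrC.
- apply/cvgrPdist_lt => e /H [r r0 Hr]; apply/nbhs_ballP; exists r => //= y.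
  by rewrite -ball_normE /= distrC => /Hr; rewrite distrC.
Qed.

Lemma mean_value_le (f f' : R -> R) (a b e : R) :
  a <= b -> (forall t, a <= t <= b -> is_derive t (1 : R) f (f' t)) ->
  (forall t, a <= t <= b -> `|f' t| <= e) -> `|f b - f a| <= e * (b - a).
Proof.
move=> ab df fe.
have cf : {within `[a, b], continuous f}.
  apply: derivable_within_continuous => t; rewrite in_itv /= => /df [dt _].
  exact: dt.
have [|c] := @MVT_segment R f f' a b ab _ cf.
  move=> x; rewrite in_itv /= => /andP[ax xb]; apply: df.
  by rewrite (ltW ax) (ltW xb).
rewrite in_itv /= => /fe fc ->.
by rewrite normrM (ger0_norm (x := b - a)) ?subr_ge0// ler_wpM2r ?subr_ge0.
Qed.

Lemma mean_value_line (V : normedModType R) (f : V -> R) (x v : V) (s e : R) :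
  (forall t, `|t| <= `|s| -> derivable f (x + t *: v) v /\
    `|'D_v f (x + t *: v)| <= e) ->
  `|f (x + s *: v) - f x| <= e * `|s|.
Proof.
move=> H.
pose g t := f (x + t *: v); pose g' t := 'D_v f (x + t *: v).
have dg t : `|t| <= `|s| -> is_derive t (1 : R) g (g' t).
  move=> /H [dt _]; apply: is_derive_line; exact: derivableP.
have -> : f x = g 0 by rewrite /g scale0r addr0.
have [s0|s0] := leP 0 s.
- have := @mean_value_le g g' 0 s e s0.
  rewrite subr0 (ger0_norm s0); apply => t /andP[t0 ts].
    by apply: dg; rewrite !ger0_norm.
  by apply: (H t _).2; rewrite !ger0_norm.
- have := @mean_value_le g g' s 0 e (ltW s0).
  rewrite sub0r (ltr0_norm s0) distrC; apply => t /andP[t0 ts].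
    by apply: dg; rewrite (ler0_norm ts) (ltr0_norm s0) lerN2.
  by apply: (H t _).2; rewrite (ler0_norm ts) (ltr0_norm s0) lerN2.
Qed.

Lemma mx_norm_leP n (x : 'rV[R]_n) (e : R) : 0 <= e ->
  `|x| <= e <-> forall k, `|x ord0 k| <= e.
Proof.
move=> e0; rewrite [`|x|]/Num.norm /= mx_normrE; split=> [H k|H].
  by apply: le_trans H; apply: (le_bigmax _ (fun ij => `|x ij.1 ij.2|) (ord0, k)).
by apply/bigmax_leP; split=> // -[i k] _ /=; rewrite (ord1 i).
Qed.

Lemma mx_norm_ltP n (x : 'rV[R]_n) (e : R) : 0 < e ->
  `|x| < e <-> forall k, `|x ord0 k| < e.
Proof.
move=> e0; rewrite [`|x|]/Num.norm /= mx_normrE; split=> [H k|H].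
  apply: le_lt_trans H; apply: (le_bigmax _ (fun ij => `|x ij.1 ij.2|) (ord0, k)).
by apply/bigmax_ltP; split=> // -[i k] _ /=; rewrite (ord1 i).
Qed.

Lemma coord_le_norm n (x : 'rV[R]_n) k : `|x ord0 k| <= `|x|.
Proof. by move: k; apply/mx_norm_leP. Qed.

Lemma basis_vecE n (k l : 'I_n) : @basis_vec R n k ord0 l = (l == k)%:R.
Proof. by rewrite /basis_vec mxE eqxx. Qed.

Lemma basis_vec_norm n (k : 'I_n) : `|@basis_vec R n k| <= 1.
Proof.
by apply/mx_norm_leP => // l; rewrite basis_vecE; case: eqP; rewrite ?normr1 ?normr0.
Qed.

(* The path from [x] to [y] is made of segments parallel to the axes. *)
Lemma partial_bound n (G : 'rV[R]_n -> R) (x y : 'rV[R]_n) (r e : R) :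
  `|y - x| < r ->
  (forall z, `|z - x| < r -> forall k, derivable G z (basis_vec k) /\
     `|'D_(basis_vec k) G z| <= e) ->
  `|G y - G x| <= n%:R * e * `|y - x|.
Proof.
move=> yr H.
pose p (m : nat) : 'rV[R]_n := \row_k (if (k < m)%N then y ord0 k else x ord0 k).
have p0 : p 0%N = x by apply/rowP => k; rewrite mxE.
have pn : p n = y by apply/rowP => k; rewrite mxE ltn_ord.
have r0 : 0 < r by apply: le_lt_trans yr.
have inr (z : 'rV[R]_n) : (forall k, `|z ord0 k - x ord0 k| <= `|y ord0 k - x ord0 k|) -> `|z - x| < r.
  move=> Hz; apply: le_lt_trans yr; apply/mx_norm_leP => // k; rewrite !mxE.
  apply: le_trans (Hz k) _; have := coord_le_norm (y - x) k; by rewrite !mxE.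
have step m : (m <= n)%N -> `|G (p m) - G x| <= m%:R * e * `|y - x|.
  elim: m => [_|m IH mn]; first by rewrite p0 subrr normr0 !mul0r.
  pose k := Ordinal mn.
  have pS : p m.+1 = p m + (y ord0 k - x ord0 k) *: basis_vec k.
    apply/rowP => l; rewrite !mxE eqxx /= ltnS leq_eqVlt -(inj_eq val_inj l k) /=.
    have [lm|lm] := eqVneq (l : nat) m; last by rewrite /= mulr0 addr0.
    have -> : l = k by apply: val_inj.
    by rewrite /= ltnn mulr1 addrC subrK.
  rewrite -natr1 !mulrDl mul1r.
  rewrite -(subrK (G (p m)) (G (p m.+1))) -addrA addrC.
  apply: le_trans (ler_normD _ _) _; apply: lerD; first exact/IH/ltnW.
  rewrite pS; apply: (@le_trans _ _ (e * `|y ord0 k - x ord0 k|)).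
    apply: mean_value_line => t tk.
    apply: H; apply: inr => l; rewrite !mxE eqxx /= -(inj_eq val_inj l k) /=.
    have [lm|lm] := eqVneq (l : nat) m.
      have -> : l = k by apply: val_inj.
      by rewrite /= ltnn mulr1 addrAC subrr add0r.
    by rewrite mulr0 addr0; case: ifP => // _; rewrite subrr normr0.
  rewrite ler_wpM2l //.
    have [|_] := H x _ k; first by rewrite subrr normr0.
    exact: le_trans.
  by have := coord_le_norm (y - x) k; rewrite !mxE.
by rewrite -{1}pn; apply: step.
Qed.

Lemma is_derive_coord n (y v : 'rV[R]_n) k :
  is_derive y v (fun z : 'rV[R]_n => z ord0 k) (v ord0 k).
Proof.
apply/is_deriveP => e e0; exists 1 => // h _.
by rewrite !mxE [_ + h * _]addrC addrK subrr normr0 mulr_ge0 // ltW.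
Qed.

Lemma C1_estimate n (F : 'rV[R]_n -> R) (W : set 'rV[R]_n) (x : 'rV[R]_n) :
  open W -> W x ->
  (forall z k, W z -> derivable F z (basis_vec k)) ->
  (forall k, {for x, continuous ('D_(basis_vec k) F)}) ->
  forall e : R, 0 < e -> exists2 r : R, 0 < r & forall y, `|y - x| < r ->
    `|F y - F x - \sum_k 'D_(basis_vec k) F x * (y - x) ord0 k| <= e * `|y - x|.
Proof.
move=> oW Wx dF cF e e0.
have [rW /= rW0 HW] : exists2 r : R, 0 < r & forall y, `|y - x| < r -> W y.
  have /nbhs_ballP [r r0 Hr] := open_nbhs_nbhs (conj oW Wx).
  by exists r => // y yr; apply: Hr; rewrite -ball_normE /= distrC.
pose e' := e / n.+1%:R.
have e'0 : 0 < e' by rewrite divr_gt0.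
have [rc /= rc0 Hc] : exists2 r : R, 0 < r & forall k y, `|y - x| < r ->
    `|'D_(basis_vec k) F y - 'D_(basis_vec k) F x| <= e'.
  have /choice [f Hf] : forall k, exists r : R, 0 < r /\ forall y, `|y - x| < r ->
    `|'D_(basis_vec k) F y - 'D_(basis_vec k) F x| <= e'.
    move=> k; have /continuous_atP /(_ e' e'0) [r r0 Hr] := cF k.
    by exists r; split=> // y /Hr/ltW.
  exists (\big[Num.min/1]_k f k).
    by apply/bigmin_gtP; split=> // k _; case: (Hf k).
  move=> k y /bigmin_gtP [_ /(_ k isT)] yk; exact: (Hf k).2.
exists (Num.min rW rc); first by rewrite lt_min rW0.
move=> y yr.
pose G z := F z - \sum_k 'D_(basis_vec k) F x * z ord0 k.
have dG z k : W z -> is_derive z (basis_vec k) G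
    ('D_(basis_vec k) F z - 'D_(basis_vec k) F x).
  move=> Wz.
  have dl : is_derive z (basis_vec k)
     (\sum_l (fun u : 'rV[R]_n => 'D_(basis_vec l) F x * u ord0 l))
     (\sum_l 'D_(basis_vec l) F x * basis_vec k ord0 l).
    apply: is_derive_sum => l.
    by have := is_deriveZ ('D_(basis_vec l) F x) (is_derive_coord z (basis_vec k) l).
  have -> : 'D_(basis_vec k) F x = \sum_l 'D_(basis_vec l) F x * basis_vec k ord0 l.
    rewrite (bigD1 k) //= basis_vecE eqxx mulr1 big1 ?addr0// => l lk.
    by rewrite basis_vecE (negbTE lk) mulr0.
  have := is_deriveB (derivableP (dF z k Wz)) dl.
  rewrite (_ : F - _ = G) //; apply/funext => u.
  by rewrite /G fctE fct_sumE.
have := @partial_bound n G x y (Num.min rW rc) e' yr _.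
rewrite (_ : G y - G x = F y - F x - \sum_k 'D_(basis_vec k) F x * (y - x) ord0 k).
  move=> HH; apply: le_trans (HH _) _; last first.
    rewrite ler_wpM2r // /e' mulrC -mulrA ler_piMr ?(ltW e0)// mulrC.
    by rewrite ler_pdivrMr // mul1r ler_nat.
  move=> z; rewrite lt_min => /andP[/HW Wz /Hc zc] k.
  have [d1 d2] := dG z k Wz; split => //.
  by rewrite d2.
have -> : \sum_k 'D_(basis_vec k) F x * (y - x) ord0 k =
    \sum_k 'D_(basis_vec k) F x * y ord0 k - \sum_k 'D_(basis_vec k) F x * x ord0 k.
  by rewrite -sumrB; apply: eq_bigr => k _; rewrite !mxE mulrBr.
by rewrite /G; ring.
Qed.

Lemma is_derive_chain (V : normedModType R) n (F : 'rV[R]_n -> R)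
    (W : set 'rV[R]_n) (g : V -> 'rV[R]_n) (x v : V) (d : 'I_n -> R) :
  open W -> W (g x) ->
  (forall z k, W z -> derivable F z (basis_vec k)) ->
  (forall k, {for g x, continuous ('D_(basis_vec k) F)}) ->
  (forall k, is_derive x v (fun y => g y ord0 k) (d k)) ->
  is_derive x v (F \o g) (\sum_k 'D_(basis_vec k) F (g x) * d k).
Proof.
move=> oW Wg dF cF dg; apply/is_deriveP => e e0.
pose B := \sum_k `|'D_(basis_vec k) F (g x)|.
pose D := \sum_k `|d k|.
have B0 : 0 <= B by rewrite sumr_ge0.
have D0 : 0 <= D by rewrite sumr_ge0.
pose e1 := Num.min 1 (e / 2 / (B + 1)).
have e10 : 0 < e1 by rewrite lt_min ltr01 !divr_gt0 // ltr_wpDl.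
pose e2 := e / 2 / (D + 1).
have e20 : 0 < e2 by rewrite !divr_gt0 // ltr_wpDl.
have [r1 r10 H1] := C1_estimate oW Wg dF cF e20.
have [r2 /= r20 H2] : exists2 r : R, 0 < r & forall k h, `|h| < r ->
   `|g (x + h *: v) ord0 k - g x ord0 k - h * d k| <= e1 * `|h|.
  have /choice [f Hf] : forall k, exists r : R, 0 < r /\ forall h, `|h| < r ->
   `|g (x + h *: v) ord0 k - g x ord0 k - h * d k| <= e1 * `|h|.
    by move=> k; have /is_deriveP /(_ e1 e10) [r r0 Hr] := dg k; exists r.
  exists (\big[Num.min/1]_k f k).
    by apply/bigmin_gtP; split=> // k _; case: (Hf k).
  move=> k y /bigmin_gtP [_ /(_ k isT)] yk; exact: (Hf k).2.
exists (Num.min r2 (r1 / (D + 1))); first by rewrite lt_min r20 divr_gt0 // ltr_wpDl.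
move=> h; rewrite lt_min => /andP[hr2 hr1].
have Hk k := H2 k h hr2.
pose y := g (x + h *: v).
have yx : `|y - g x| <= (D + 1) * `|h|.
  apply/mx_norm_leP; first by rewrite mulr_ge0 // addr_ge0.
  move=> k; rewrite !mxE -(subrK (h * d k) (_ - _)).
  apply: le_trans (ler_normD _ _) _.
  rewrite mulrDl mul1r addrC lerD //.
    rewrite normrM mulrC ler_wpM2r // /D (bigD1 k) //= lerDl sumr_ge0 //.
  by apply: le_trans (Hk k) _; rewrite ler_piMl // ge_min lexx.
have yr1 : `|y - g x| < r1.
  apply: le_lt_trans yx _; rewrite mulrC -ltr_pdivlMr // ltr_wpDl //.
have := H1 _ yr1.
pose S := \sum_k 'D_(basis_vec k) F (g x) * (y - g x) ord0 k.
pose S' := \sum_k 'D_(basis_vec k) F (g x) * d k.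
move=> HF.
have HS : `|S - h * S'| <= B * (e1 * `|h|).
  rewrite /S /S' mulr_sumr -sumrB /B mulr_suml.
  apply: le_trans (ler_norm_sum _ _ _) _; apply: ler_sum => k _.
  by rewrite mulrCA -mulrBr normrM !mxE ler_wpM2l.
rewrite /= -/y -/S'.
rewrite (_ : _ - h * S' = (F y - F (g x) - S) + (S - h * S')); last first.
  by rewrite addrA subrK.
apply: le_trans (ler_normD _ _) _.
apply: le_trans (lerD HF HS) _.
rewrite [leRHS](_ : _ = e / 2 * `|h| + e / 2 * `|h|); last by field.
apply: lerD.
  apply: (@le_trans _ _ (e2 * ((D + 1) * `|h|))); first by rewrite ler_wpM2l // ltW.
  by rewrite mulrA /e2 divfK // gt_eqF // ltr_wpDl.
rewrite mulrA ler_wpM2r //.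
apply: (@le_trans _ _ (B * (e / 2 / (B + 1)))).
  by rewrite ler_wpM2l // ge_min lexx orbT.
rewrite mulrA ler_pdivrMr ?ltr_wpDl// mulrC ler_wpM2l ?divr_ge0 ?(ltW e0)//.
by rewrite lerDl.
Qed.

End Calculus.

Section Smooth.
Context {R : realType} {n : nat}.
Local Notation V := 'rV[R]_n.

Lemma partials_rcons (s : seq 'I_n) k (F : V -> R) :
  partials (rcons s k) F = partials s ('D_(basis_vec k) F).
Proof. by rewrite /partials foldr_rcons. Qed.

Lemma mean_value_line_affine (f : V -> R) (x v : V) (s d e : R) :
  (forall t, `|t| <= `|s| -> derivable f (x + t *: v) v /\
    `|'D_v f (x + t *: v) - d| <= e) ->
  `|f (x + s *: v) - f x - s * d| <= e * `|s|.
Proof.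
move=> H; pose g (t : R) := f (x + t *: v) - t * d.
have dg t : `|t| <= `|s| -> is_derive t (1 : R) g ('D_v f (x + t *: v) - d).
  move=> /H [dt _].
  have d1 := is_derive_line (derivableP dt).
  apply/is_deriveP => e0 e00; have /is_deriveP /(_ e0 e00) [r r0 Hr] := d1.
  exists r => // h /Hr; rewrite [h%:A]mulr1 /g; congr (_ <= _); congr `| _ |; ring.
have := @mean_value_line R R^o g (0 : R) (1 : R) s e.
rewrite !add0r [s%:A]mulr1 /g scale0r addr0 mul0r subr0 addrAC; apply => t ts.
rewrite add0r [t%:A]mulr1; have [d1 ->] := dg t ts; split => //.
exact: (H t ts).2.
Qed.

Lemma schwarz (W : set V) (F : V -> R) (x : V) (j k : 'I_n) :
  open W -> W x ->
  (forall z l, W z -> derivable F z (basis_vec l)) ->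
  (forall z l m, W z -> derivable ('D_(basis_vec l) F) z (basis_vec m)) ->
  (forall l m, {for x, continuous ('D_(basis_vec m) ('D_(basis_vec l) F))}) ->
  'D_(basis_vec j) ('D_(basis_vec k) F) x = 'D_(basis_vec k) ('D_(basis_vec j) F) x.
Proof.
move=> oW Wx d1 d2 c2.
have [rW /= rW0 HW] : exists2 r : R, 0 < r & forall y, `|y - x| < r -> W y.
  have /nbhs_ballP [r r0 Hr] := open_nbhs_nbhs (conj oW Wx).
  by exists r => // y yr; apply: Hr; rewrite -ball_normE /= distrC.
pose e_ (l : 'I_n) : V := basis_vec l.
have key a b e : 0 < e -> exists2 r : R, 0 < r & forall h, 0 < h < r ->
   `|F (x + h *: e_ a + h *: e_ b) - F (x + h *: e_ a) - (F (x + h *: e_ b) - F x)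
     - h * (h * 'D_(e_ b) ('D_(e_ a) F) x)| <= e * (h * h).
  move=> e0; have /continuous_atP /(_ e e0) [r r0 Hr] := c2 a b.
  exists (Num.min r rW / 2); first by rewrite divr_gt0 // lt_min r0.
  move=> h /andP[h0 hr].
  have near (s t : R) : `|s| <= h -> `|t| <= h ->
      `|x + s *: e_ a + t *: e_ b - x| < Num.min r rW.
    move=> sh th; rewrite -(addrA x) [x + _]addrC addrK.
    apply: le_lt_trans (ler_normD _ _) _; rewrite !normrZ.
    apply: (@le_lt_trans _ _ (h + h)).
      apply: lerD; rewrite -[leRHS]mulr1 ler_pM // ?basis_vec_norm //.
    by rewrite -mulr2n -mulr_natr -ltr_pdivlMr.
  pose g z := F (z + h *: e_ b) - F z.
  have wN (s t : R) : `|s| <= h -> `|t| <= h -> W (x + s *: e_ a + t *: e_ b).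
    by move=> sh th; apply: HW; apply: lt_le_trans (near s t sh th) _; rewrite ge_min lexx orbT.
  have h0' := ltW h0.
  have -> : F (x + h *: e_ a + h *: e_ b) - F (x + h *: e_ a) - (F (x + h *: e_ b) - F x)
     = g (x + h *: e_ a) - g x by [].
  apply: (@le_trans _ _ ((e * h) * `|h|)); last by rewrite gtr0_norm // mulrA.
  apply: (@mean_value_line_affine g x (e_ a) h (h * 'D_(e_ b) ('D_(e_ a) F) x)
    (e * h)) => s; rewrite (gtr0_norm h0) => sh.
  have W1 := wN s h sh; rewrite gtr0_norm // in W1.
  have W0 := wN s 0 sh; rewrite normr0 scale0r addr0 in W0.
  have D1 : is_derive (x + s *: e_ a) (e_ a) (fun z => F (z + h *: e_ b))
     ('D_(e_ a) F (x + s *: e_ a + h *: e_ b)).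
    have /derivableP /is_deriveP Q := d1 _ a (W1 (lexx _)).
    apply/is_deriveP => e1 /Q [r1 r10 Hr1].
    by exists r1 => // u /Hr1; rewrite (addrAC (x + s *: e_ a) (u *: e_ a)).
  have D0 : is_derive (x + s *: e_ a) (e_ a) F ('D_(e_ a) F (x + s *: e_ a)).
    exact/derivableP/d1/W0/ltW.
  have [Dg1 Dg2] := is_deriveB D1 D0.
  split; first exact: Dg1.
  rewrite [X in `|X - _|]Dg2.
  apply: (@le_trans _ _ (e * `|h|)); last by rewrite gtr0_norm.
  apply: (@mean_value_line_affine ('D_(e_ a) F) (x + s *: e_ a) (e_ b) h
    ('D_(e_ b) ('D_(e_ a) F) x) e) => t; rewrite (gtr0_norm h0) => th.
  split; first exact/d2/wN.
  apply/ltW/Hr; apply: lt_le_trans (near s t sh th) _; by rewrite ge_min lexx.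
apply/eqP; rewrite -subr_eq0 -normr_le0; apply/ler_addgt0Pr => e e0; rewrite add0r.
have e20 : 0 < e / 2 by rewrite divr_gt0.
have [r1 r10 H1] := key j k _ e20.
have [r2 r20 H2] := key k j _ e20.
pose h := Num.min r1 r2 / 2.
have m0 : 0 < Num.min r1 r2 by rewrite lt_min r10.
have h0 : 0 < h by rewrite divr_gt0.
have hm : h < Num.min r1 r2 by rewrite ltr_pdivrMr // ltr_pMr // ltr1n.
have := hm; rewrite lt_min => /andP[hr1 hr2].
have := H1 h; rewrite h0 hr1 => /(_ isT) {}H1.
have := H2 h; rewrite h0 hr2 => /(_ isT) {}H2.
rewrite -(@ler_pM2r _ (h * h)) ?mulr_gt0//.
set A := 'D_(basis_vec j) _ x; set B := 'D_(basis_vec k) _ x.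
rewrite (addrAC x (h *: e_ k)) in H2.
rewrite -[X in _ * X](gtr0_norm (x := h * h)) ?mulr_gt0// -normrM.
move: H1 H2; rewrite -/(e_ _) -/A -/B.
set F11 := F (_ + _ + _); set F10 := F (_ + h *: e_ j); set F01 := F (_ + h *: e_ k).
move=> H1 H2.
rewrite (_ : (A - B) * (h * h) = (F11 - F10 - (F01 - F x) - h * (h * B))
   - (F11 - F01 - (F10 - F x) - h * (h * A))); last by ring.
apply: le_trans (ler_normB _ _) _; apply: le_trans (lerD H1 H2) _.
by rewrite -mulrDl -splitr.
Qed.

Fixpoint Ck (m : nat) (W : set V) (F : V -> R) : Prop :=
  (forall x, W x -> {for x, continuous F}) /\
  match m with
  | 0%N => True
  | m'.+1 => forall k, (forall x, W x -> derivable F x (basis_vec k)) /\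
       Ck m' W ('D_(basis_vec k) F)
  end.

Lemma Ck_cont m W F x : Ck m W F -> W x -> {for x, continuous F}.
Proof. by case: m => [|m] [H _] /H. Qed.

Lemma CkS m W F : Ck m.+1 W F -> Ck m W F.
Proof.
elim: m F => [|m IH] F [c H]; first by split.
by split=> // k; have [d /IH ?] := H k.
Qed.

Lemma smooth_on_openP W F : smooth_on_open W F <-> forall m, Ck m W F.
Proof.
have SS F' : smooth_on_open W F' <-> (forall x, W x -> {for x, continuous F'}) /\
   forall k, (forall x, W x -> derivable F' x (basis_vec k)) /\
       smooth_on_open W ('D_(basis_vec k) F').
  split=> [H|[c H] s].
    split=> [x Wx|k]; first exact: (H [::] x Wx).1.
    split=> [x Wx|s x Wx]; first exact: (H [::] x Wx).2.
    by rewrite -partials_rcons; apply: H.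
  case/lastP: s => [|s k] x Wx; first by split; [exact: c|move=> k; exact: (H k).1].
  by rewrite partials_rcons; apply: (H k).2.
split=> [H m|H].
  elim: m F H => [|m IH] F /SS [c H]; first by split.
  by split=> // k; have [d /IH ?] := H k.
move=> s; elim/last_ind: s F H => [|s k IH] F H x Wx.
  split; first exact: (H 0%N).1 .
  by move=> k; have [_ /(_ k) [d _]] := H 1%N; apply: d.
rewrite partials_rcons; apply: IH => // m.
by have [_ /(_ k) [_ ?]] := H m.+1.
Qed.

Lemma eq_near_open (W : set V) (F G : V -> R) x : open W -> W x ->
  (forall y, W y -> F y = G y) -> {near x, F =1 G}.
Proof.
move=> oW Wx FG.
have Wn := open_nbhs_nbhs (conj oW Wx).
by near=> y; apply: FG; near: y.
Unshelve. all: by end_near. Qed.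

Lemma eq_continuous_at (W : set V) (F G : V -> R) x : open W -> W x ->
  (forall y, W y -> F y = G y) -> {for x, continuous F} -> {for x, continuous G}.
Proof.
move=> oW Wx FG cF; have E := eq_near_open oW Wx FG.
rewrite /prop_for /continuous_at -(FG x Wx).
by apply: cvg_trans cF; exact: near_eq_cvg E.
Qed.

Lemma Ck_eq m W F G : open W -> (forall x, W x -> F x = G x) -> Ck m W F -> Ck m W G.
Proof.
move=> oW; elim: m F G => [|m IH] F G FG [c H].
  by split=> // x Wx; apply: (eq_continuous_at oW Wx FG); apply: c.
split=> [x Wx|k]; first by apply: (eq_continuous_at oW Wx FG); apply: c.
have [d Hd] := H k; split=> [x Wx|].
  by apply: (near_eq_derivable (eq_near_open oW Wx FG)); apply: d.
apply: IH Hd => x Wx.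
by apply: near_eq_derive; exact: (eq_near_open oW Wx FG).
Qed.

Lemma Ck_sub m (W W' : set V) F : W' `<=` W -> Ck m W F -> Ck m W' F.
Proof.
move=> s; elim: m F => [|m IH] F [c H]; first by split=> // x /s /c.
split=> [x /s /c//|k]; have [d /IH ?] := H k; split=> // x /s; exact: d.
Qed.

Lemma Ck_cst m W (c : R) : Ck m W (fun=> c).
Proof.
elim: m c => [|m IH] c; split=> //; try by move=> x _; exact: cst_continuous.
move=> k; split=> [x _|]; first exact: derivable_cst.
rewrite (_ : 'D_(basis_vec k) _ = fun=> 0); first exact: IH.
by apply/funext => x; exact: derive_cst.
Qed.

Lemma Ck_coord m W (l : 'I_n) : Ck m W (fun x : V => x ord0 l).
Proof.
have cc (x : V) : W x -> {for x, continuous (fun x : V => x ord0 l)}.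
  by move=> _; exact: coord_continuous.
case: m => [|m]; split=> //; move=> k; split=> [x _|].
  by have [] := is_derive_coord x (basis_vec k) l.
rewrite (_ : 'D_(basis_vec k) _ = fun=> basis_vec k ord0 l); first exact: Ck_cst.
by apply/funext => x; have [_ ->] := is_derive_coord x (basis_vec k) l.
Qed.

Lemma Ck_D m W F G : open W -> Ck m W F -> Ck m W G -> Ck m W (fun x => F x + G x).
Proof.
move=> oW; elim: m F G => [|m IH] F G [cF HF] [cG HG].
  by split=> // x Wx; apply: (@continuousD _ _ _ F G); [exact: cF|exact: cG].
split=> [x Wx|k]; first by apply: (@continuousD _ _ _ F G); [exact: cF|exact: cG].
have [dF HF'] := HF k; have [dG HG'] := HG k; split=> [x Wx|].
  by apply: (@derivableD _ _ _ F G); [exact: dF|exact: dG].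
apply: (Ck_eq oW _ (IH _ _ HF' HG')) => x Wx.
by rewrite -(@deriveD _ _ _ F G) //; [exact: dF|exact: dG].
Qed.

Lemma Ck_M m W F G : open W -> Ck m W F -> Ck m W G -> Ck m W (fun x => F x * G x).
Proof.
move=> oW; elim: m F G => [|m IH] F G HF HG.
  have [cF _] := HF; have [cG _] := HG.
  by split=> // x Wx; apply: (@continuousM _ _ F G); [exact: cF|exact: cG].
have [cF dF] := HF; have [cG dG] := HG.
split=> [x Wx|k]; first by apply: (@continuousM _ _ F G); [exact: cF|exact: cG].
have [dFk HF'] := dF k; have [dGk HG'] := dG k; split=> [x Wx|].
  by apply: (@derivableM _ _ F G); [exact: dFk|exact: dGk].
have := Ck_D oW (IH _ _ (CkS HF) HG') (IH _ _ HF' (CkS HG)).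
apply: Ck_eq => // x Wx.
by rewrite (@deriveM _ _ F G) /GRing.scale /= ?[G x * _]mulrC //; [exact: dFk|exact: dGk].
Qed.

(* [h'] is the derivative of [h] along the values of [F]: with [h' \o F] of the
   same form this closes [Ck] under [1 / F] and [sqrt F]. *)
Lemma Ck_comp1 m W F (h h' : R -> R) : open W ->
  (forall x, W x -> is_derive (F x) (1 : R) h (h' (F x))) ->
  Ck m W (h' \o F) -> Ck m.+1 W F -> Ck m.+1 W (h \o F).
Proof.
move=> oW dh Hh HF; have [cF dF] := HF.
have dhF x k : W x -> is_derive x (basis_vec k) (h \o F)
    (h' (F x) * 'D_(basis_vec k) F x).
  move=> Wx; apply/is_deriveP => e e0.
  have /derivableP /is_deriveP dFx := (dF k).1 x Wx.
  have /is_deriveP dhx := dh x Wx.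
  set a := 'D_(basis_vec k) F x in dFx *; set b := h' (F x) in dhx *.
  pose e1 := Num.min 1 (e / 2 / (`|b| + 1)).
  have e10 : 0 < e1 by rewrite lt_min ltr01 !divr_gt0 // ltr_wpDl.
  pose e2 := e / 2 / (`|a| + 1).
  have e20 : 0 < e2 by rewrite !divr_gt0 // ltr_wpDl.
  have [r1 r10 H1] := dFx _ e10; have [r2 r20 H2] := dhx _ e20.
  exists (Num.min r1 (r2 / (`|a| + 1))); first by rewrite lt_min r10 divr_gt0 // ltr_wpDl.
  move=> t; rewrite lt_min => /andP[t1 t2].
  have {}H1 := H1 t t1.
  pose d := F (x + t *: basis_vec k) - F x.
  have dt : `|d| <= (`|a| + 1) * `|t|.
    rewrite -(subrK (t * a) d); apply: le_trans (ler_normD _ _) _.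
    rewrite mulrDl mul1r addrC lerD //; first by rewrite normrM mulrC.
    by apply: le_trans H1 _; rewrite ler_piMl // ge_min lexx.
  have {}H2 : `|h (F (x + t *: basis_vec k)) - h (F x) - d * b| <= e2 * `|d|.
    have := H2 d; rewrite [d%:A]mulr1 (_ : F x + d = F (x + t *: basis_vec k)); last first.
      by rewrite /d addrC subrK.
    apply.
    by apply: le_lt_trans dt _; rewrite mulrC -ltr_pdivlMr // ltr_wpDl.
  rewrite /= (_ : _ - t * _ = (h (F (x + t *: basis_vec k)) - h (F x) - d * b)
      + (d - t * a) * b); last by ring.
  apply: le_trans (ler_normD _ _) _; rewrite [leRHS](_ : _ = e / 2 * `|t| + e / 2 * `|t|); last by field.
  apply: lerD.
    apply: le_trans H2 _; apply: (@le_trans _ _ (e2 * ((`|a| + 1) * `|t|))).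
      by rewrite ler_wpM2l // ltW.
    by rewrite mulrA /e2 divfK // gt_eqF // ltr_wpDl.
  rewrite normrM mulrC; apply: (@le_trans _ _ (`|b| * (e1 * `|t|))).
    by rewrite ler_wpM2l.
  rewrite mulrA ler_wpM2r //.
  apply: (@le_trans _ _ (`|b| * (e / 2 / (`|b| + 1)))).
    by rewrite ler_wpM2l // ge_min lexx orbT.
  rewrite mulrA ler_pdivrMr ?ltr_wpDl// mulrC ler_wpM2l ?divr_ge0 ?(ltW e0)//.
  by rewrite lerDl.
split=> [x Wx|k].
  have [dhx _] := dh x Wx.
  apply: continuous_comp; first exact: cF.
  by apply: differentiable_continuous; apply/derivable1_diffP.
split=> [x Wx|]; first by have [] := dhF x k Wx.
apply: (Ck_eq oW _ (Ck_M oW Hh (dF k).2)) => x Wx.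
by have [_ ->] := dhF x k Wx.
Qed.

Lemma Ck_V m W F : open W -> (forall x, W x -> F x != 0) -> Ck m W F ->
  Ck m W (fun x => (F x)^-1).
Proof.
move=> oW F0; elim: m => [|m IH] HF.
  by split=> // x Wx; apply: continuousV; [exact: F0|exact: (Ck_cont HF)].
apply: (@Ck_comp1 m W F (fun y => y^-1) (fun y => - (y^-1 * y^-1)) oW) => //.
  move=> x Wx; have di : derivable (fun y : R => y) (F x) (1 : R) by exact: derivable_id.
  split; first by apply: (derivableV _ di); exact: F0.
  rewrite (deriveV _ di) ?F0// derive_id.
  by rewrite /GRing.scale /= mulr1 -exprVn expr2.
apply: (@Ck_eq _ _ (fun x => (-1) * ((F x)^-1 * (F x)^-1))) => //.
  by move=> x _ /=; rewrite mulN1r.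
apply: Ck_M => //; first exact: Ck_cst.
by apply: Ck_M => //; apply: IH; exact: CkS.
Qed.

Lemma Ck_sqrt m W F : open W -> (forall x, W x -> 0 < F x) -> Ck m W F ->
  Ck m W (fun x => Num.sqrt (F x)).
Proof.
move=> oW F0; elim: m => [|m IH] HF.
  split=> // x Wx; apply: continuous_comp; first exact: (Ck_cont HF).
  exact: sqrt_continuous.
apply: (@Ck_comp1 m W F Num.sqrt (fun y => (2 * Num.sqrt y)^-1) oW) => //.
  by move=> x Wx; apply: is_derive1_sqrt; exact: F0.
apply: Ck_V => //=; first by move=> x Wx; rewrite mulf_neq0 // gt_eqF // sqrtr_gt0 F0.
by apply: Ck_M => //; [exact: Ck_cst|apply: IH; exact: CkS].
Qed.

End Smooth.

Section SmoothComp.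
Context {R : realType}.

Lemma Ck_sum n m (W : set 'rV[R]_n) (J : finType) (F : J -> 'rV[R]_n -> R) :
  open W -> (forall j, Ck m W (F j)) -> Ck m W (fun x => \sum_j F j x).
Proof.
move=> oW HF.
elim: (index_enum J) => [|j s IH].
  apply: (@Ck_eq _ _ _ _ (fun=> 0)) => //; last exact: Ck_cst.
  by move=> x _; rewrite big_nil.
apply: (@Ck_eq _ _ _ _ (fun x => F j x + \sum_(j <- s) F j x)) => //; last exact: Ck_D.
by move=> x _; rewrite big_cons.
Qed.

Lemma continuous_at_coord (V : normedModType R) p (g : V -> 'rV[R]_p) (x : V) :
  (forall a, {for x, continuous (fun y => g y ord0 a)}) -> {for x, continuous g}.
Proof.
move=> H; apply/continuous_atP => e e0.
have /choice [f Hf] : forall a, exists r : R, 0 < r /\ forall y, `|y - x| < r ->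
   `|g y ord0 a - g x ord0 a| < e.
  by move=> a; have /continuous_atP /(_ e e0) [r r0 Hr] := H a; exists r.
exists (\big[Num.min/1]_a f a).
  by apply/bigmin_gtP; split=> // k _; case: (Hf k).
move=> y /bigmin_gtP [_ yk]; apply/mx_norm_ltP => // a.
by rewrite !mxE; apply: (Hf a).2; apply: yk.
Qed.

Lemma Ck_comp n p m (W : set 'rV[R]_n) (W' : set 'rV[R]_p) (F : 'rV[R]_p -> R)
    (g : 'rV[R]_n -> 'rV[R]_p) : open W -> open W' ->
  (forall x, W x -> W' (g x)) -> Ck m W' F ->
  (forall a, Ck m W (fun x => g x ord0 a)) -> Ck m W (F \o g).
Proof.
move=> oW oW' gW; elim: m F => [|m IH] F HF Hg.
  split=> // x Wx; apply: continuous_comp; last exact/(Ck_cont HF)/gW.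
  by apply: continuous_at_coord => a; exact: (Ck_cont (Hg a)).
have D x k : W x -> is_derive x (basis_vec k) (F \o g)
   (\sum_a 'D_(basis_vec a) F (g x) * 'D_(basis_vec k) (fun y => g y ord0 a) x).
  move=> Wx; apply: (is_derive_chain oW') => //.
  - exact: gW.
  - by move=> z a; have [_ /(_ a) [d _]] := HF; exact: d.
  - by move=> a; have [_ /(_ a) [_ d]] := HF; exact/(Ck_cont d)/gW.
  - by move=> a; apply: derivableP; have [_ /(_ k) [d _]] := Hg a; exact: d.
split=> [x Wx|k].
  apply: continuous_comp; last exact/(Ck_cont HF)/gW.
  by apply: continuous_at_coord => a; exact: (Ck_cont (Hg a)).
split=> [x /(D x k) []//|].
apply: (@Ck_eq _ _ _ _ (fun x => \sum_a ('D_(basis_vec a) F \o g) x *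
   'D_(basis_vec k) (fun y => g y ord0 a) x)) => //.
  by move=> x /(D x k) [].
apply: Ck_sum => // a; apply: Ck_M => //; last by have [_ /(_ k) []] := Hg a.
apply: IH; last by move=> b; exact/CkS/Hg.
by have [_ /(_ a) []] := HF.
Qed.

Lemma smooth_on_comp n p (D : set 'rV[R]_n) (D' : set 'rV[R]_p) (f : 'rV[R]_p -> R)
    (g : 'rV[R]_n -> 'rV[R]_p) :
  smooth_on D' f -> (forall a, smooth_on D (fun x => g x ord0 a)) ->
  (forall x, D x -> D' (g x)) -> smooth_on D (f \o g).
Proof.
move=> sf sg gD x Dx.
have [W' [F [oW' W'x /smooth_on_openP CF Ff]]] := sf _ (gD _ Dx).
have /choice [W HW] a := sg a x Dx.
have /choice [G HG] := HW.
pose g' y : 'rV[R]_p := \row_a G a y.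
have g'x : g' x = g x.
  by apply/rowP => a; rewrite mxE; have [_ Wx _ ->] := HG a.
pose W0 := interior [set y | (forall a, W a y) /\ W' (g' y)].
have W0W y : W0 y -> (forall a, W a y) /\ W' (g' y) by exact: interior_subset.
exists W0, (F \o g').
have oW0 : open W0 by exact: open_interior.
split=> //.
- apply: filterI.
    apply: (@filter_forall _ _ W (nbhs x)) => a; have [oWa Wx _ _] := HG a; exact: open_nbhs_nbhs.
  suff : {for x, continuous g'} by apply; rewrite g'x; exact: open_nbhs_nbhs.
  apply: continuous_at_coord => a.
  rewrite (_ : (fun y => _) = G a); last by apply/funext => z; rewrite mxE.
  by have [_ Wx /(_ [::] x Wx) [c _] _] := HG a.
- apply/smooth_on_openP => m; apply: (@Ck_comp _ _ _ _ W') => //.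
    by move=> y /W0W [].
  move=> a; rewrite (_ : (fun y => _) = G a); last by apply/funext => z; rewrite mxE.
  have [_ _ /smooth_on_openP /(_ m) c _] := HG a.
  by apply: Ck_sub c => y /W0W [Wy _]; exact: Wy.
- move=> y /W0W [Wy W'y] Dy.
  have E : g' y = g y.
    by apply/rowP => a; rewrite mxE; have [_ _ _ ->] := HG a.
  by rewrite /= E Ff -?E//; rewrite E; exact: gD.
Qed.

End SmoothComp.

Section SmoothOn.
Context {R : realType} {n : nat}.
Local Notation V := 'rV[R]_n.
Implicit Types (D : set V) (f g : V -> R).

Lemma eq_smooth_on D f g : (forall x, D x -> f x = g x) -> smooth_on D f -> smooth_on D g.
Proof.
move=> fg sf x /sf [W [F [? ? ? E]]]; exists W, F; split=> // y Wy Dy.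
by rewrite E // fg.
Qed.

Lemma smooth_onW D D' f : D' `<=` D -> smooth_on D f -> smooth_on D' f.
Proof.
move=> s sf x /s /sf [W [F [? ? ? E]]]; exists W, F; split=> // y Wy /s Dy.
exact: E.
Qed.

Lemma smooth_on_cst D (c : R) : smooth_on D (fun=> c).
Proof.
move=> x _; exists setT, (fun=> c); split=> //; first exact: openT.
by apply/smooth_on_openP => m; exact: Ck_cst.
Qed.

Lemma smooth_on_coord D l : smooth_on D (fun x => x ord0 l).
Proof.
move=> x _; exists setT, (fun x => x ord0 l); split=> //; first exact: openT.
by apply/smooth_on_openP => m; exact: Ck_coord.
Qed.

Lemma smooth_on_op2 D f g (op : R -> R -> R) :
  (forall W F G m, open W -> Ck m W F -> Ck m W G -> Ck m W (fun x : V => op (F x) (G x))) ->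
  smooth_on D f -> smooth_on D g -> smooth_on D (fun x => op (f x) (g x)).
Proof.
move=> Hop sf sg x Dx.
have [W [F [oW Wx /smooth_on_openP sF EF]]] := sf x Dx.
have [W' [G [oW' Wx' /smooth_on_openP sG EG]]] := sg x Dx.
exists (W `&` W'), (fun x => op (F x) (G x)); split=> //.
- exact: openI.
- apply/smooth_on_openP => m; apply: Hop; first exact: openI.
    by apply: Ck_sub (sF m) => y [].
  by apply: Ck_sub (sG m) => y [].
- by move=> y [Wy W'y] Dy; rewrite EF // EG.
Qed.

Lemma smooth_onD D f g : smooth_on D f -> smooth_on D g -> smooth_on D (fun x => f x + g x).
Proof. by apply: smooth_on_op2 => W F G m; exact: Ck_D. Qed.

Lemma smooth_onM D f g : smooth_on D f -> smooth_on D g -> smooth_on D (fun x => f x * g x).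
Proof. by apply: smooth_on_op2 => W F G m; exact: Ck_M. Qed.

Lemma smooth_onZ D (c : R) f : smooth_on D f -> smooth_on D (fun x => c * f x).
Proof. by apply: smooth_onM; exact: smooth_on_cst. Qed.

Lemma smooth_onN D f : smooth_on D f -> smooth_on D (fun x => - f x).
Proof.
move=> /(smooth_onZ (-1)); apply: eq_smooth_on => x _; exact: mulN1r.
Qed.

Lemma smooth_onB D f g : smooth_on D f -> smooth_on D g -> smooth_on D (fun x => f x - g x).
Proof. by move=> sf /smooth_onN; exact: smooth_onD. Qed.

Lemma smooth_on_bigsum (J : Type) (s : seq J) (P : pred J) D (F : J -> V -> R) :
  (forall j, P j -> smooth_on D (F j)) ->
  smooth_on D (fun x => \sum_(j <- s | P j) F j x).
Proof.
move=> HF; elim: s => [|j s IH].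
  apply: (@eq_smooth_on _ (fun=> 0)); last exact: smooth_on_cst.
  by move=> x _; rewrite big_nil.
case Pj: (P j); last first.
  by apply: eq_smooth_on IH => x _; rewrite big_cons Pj.
apply: (@eq_smooth_on _ (fun x => F j x + \sum_(j <- s | P j) F j x)).
  by move=> x _; rewrite big_cons Pj.
by apply: smooth_onD => //; exact: HF.
Qed.

Lemma smooth_on_bigprod (J : Type) (s : seq J) (P : pred J) D (F : J -> V -> R) :
  (forall j, P j -> smooth_on D (F j)) ->
  smooth_on D (fun x => \prod_(j <- s | P j) F j x).
Proof.
move=> HF; elim: s => [|j s IH].
  apply: (@eq_smooth_on _ (fun=> 1)); last exact: smooth_on_cst.
  by move=> x _; rewrite big_nil.
case Pj: (P j); last first.
  by apply: eq_smooth_on IH => x _; rewrite big_cons Pj.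
apply: (@eq_smooth_on _ (fun x => F j x * \prod_(j <- s | P j) F j x)).
  by move=> x _; rewrite big_cons Pj.
by apply: smooth_onM => //; exact: HF.
Qed.

Lemma smooth_on_op1 D f (op : R -> R) (U : set R) : open U ->
  (forall W F m, open W -> (forall x, W x -> U (F x)) -> Ck m W F ->
     Ck m W (fun x : V => op (F x))) ->
  (forall x, D x -> U (f x)) ->
  smooth_on D f -> smooth_on D (fun x => op (f x)).
Proof.
move=> oU Hop fU sf x Dx.
have [W [F [oW Wx /smooth_on_openP sF EF]]] := sf x Dx.
have oWU : open (W `&` F @^-1` U).
  rewrite openE => y [Wy W'y]; apply: filterI.
    exact: open_nbhs_nbhs.
  have := Ck_cont (sF 0%N) Wy; apply; exact: open_nbhs_nbhs.
exists (W `&` F @^-1` U), (fun x => op (F x)); split=> //.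
- by split=> //=; rewrite EF //; exact: fU.
- apply/smooth_on_openP => m; apply: Hop => //; first by move=> y [].
  by apply: Ck_sub (sF m) => y [].
- by move=> y [Wy W'y] Dy; rewrite EF.
Qed.

Lemma smooth_onV D f : (forall x, D x -> f x != 0) -> smooth_on D f ->
  smooth_on D (fun x => (f x)^-1).
Proof.
move=> f0; apply: (@smooth_on_op1 _ _ _ [set y | y != 0]) => //.
by move=> W F m oW HF; apply: Ck_V.
Qed.

Lemma smooth_on_sqrt D f : (forall x, D x -> 0 < f x) -> smooth_on D f ->
  smooth_on D (fun x => Num.sqrt (f x)).
Proof.
move=> f0; apply: (@smooth_on_op1 _ _ _ [set y | 0 < y]) => //.
by move=> W F m oW HF; apply: Ck_sqrt.
Qed.

Lemma smooth_on_continuous D f : smooth_on D f -> {within D, continuous f}.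
Proof.
move=> sf; apply/subspace_continuousP => x Dx.
have [W [F [oW Wx /smooth_on_openP sF EF]]] := sf x Dx.
have cF : F @ x --> F x := Ck_cont (sF 0%N) Wx.
change (f @ within D (nbhs x) --> f x); rewrite -(EF x Wx Dx).
apply: (@cvg_trans _ (F @ within D (nbhs x))); last exact: cvg_within_filter.
apply: near_eq_cvg; rewrite near_withinE.
have Wn := open_nbhs_nbhs (conj oW Wx).
by near=> y; move=> Dy; apply: EF => //; near: y.
Unshelve. all: by end_near. Qed.

Definition relopen D := exists Q : set V, open Q /\ D = Q `&` half_space.

Lemma relopen_openI D W : open W -> relopen D -> relopen (W `&` D).
Proof.
move=> oW [Q [oQ ->]]; exists (W `&` Q); split; first exact: openI.
by rewrite setIA.
Qed.

Lemma half_space_right (x : V) k (h : R) : half_space x -> 0 <= h ->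
  half_space (x + h *: basis_vec k).
Proof.
move=> Hx h0 l l0; rewrite !mxE eqxx /= addr_ge0 ?Hx//.
by rewrite mulr_ge0 ?ler0n.
Qed.

Lemma rpartial_proper (x : V) k : half_space x ->
  ProperFilter (within [set h : R | half_space (x + h *: basis_vec k)] 0^').
Proof.
move=> Hx; apply: Build_ProperFilter_ex => B.
rewrite /within /= /dnbhs /within /= => /nbhs_ballP [r /= r0 HB]; exists (r / 2).
have r20 : 0 < r / 2 by rewrite divr_gt0.
apply: HB; last exact/half_space_right/ltW; last by rewrite gt_eqF.
by rewrite -ball_normE /= sub0r normrN gtr0_norm // ltr_pdivrMr // ltr_pMr // ltr1n.
Qed.

(* One-sided derivatives agree with those of any local extension. *)
Lemma rpartialE D W (F : V -> R) f x k : relopen D -> open W -> W x -> D x ->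
  (forall y, W y -> D y -> F y = f y) -> derivable F x (basis_vec k) ->
  rpartial k f x = 'D_(basis_vec k) F x.
Proof.
move=> [Q [oQ DE]] oW Wx Dx E dF.
have [Qx Hx] : Q x /\ half_space x by move: Dx; rewrite DE.
have := rpartial_proper k Hx; rewrite /rpartial; set G := within _ _ => PG.
apply: (@cvg_lim _ _ _ G) => //.
have C : (fun h : R => h^-1 *: ((F \o shift x) (h *: basis_vec k) - F x)) @ 0^'
   --> 'D_(basis_vec k) F x by exact: dF.
apply: cvg_trans (cvg_within_filter _ C).
apply: near_eq_cvg; rewrite near_withinE.
have [r /= r0 Hr] : exists2 r : R, 0 < r & forall y, `|y - x| < r -> W y /\ Q y.
  have /nbhs_ballP [r r0 Hr] := open_nbhs_nbhs (conj (openI oW oQ) (conj Wx Qx)).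
  by exists r => // y yr; apply: Hr; rewrite -ball_normE /= distrC.
rewrite near_withinE; apply/nbhs_ballP; exists r => // h /=.
rewrite /ball /= sub0r normrN => hr _ Hh.
rewrite (addrC _ x) E ?E//; first last.
- by rewrite DE; split=> //; apply: (Hr (x + h *: basis_vec k) _).2; rewrite addrC addKr normrZ;
    apply: le_lt_trans hr; rewrite ler_piMr // basis_vec_norm.
- by apply: (Hr (x + h *: basis_vec k) _).1; rewrite addrC addKr normrZ;
    apply: le_lt_trans hr; rewrite ler_piMr // basis_vec_norm.
Qed.

Lemma smooth_on_ext D f x : smooth_on D f -> D x -> exists W F,
  [/\ open W, W x, smooth_on_open W F, forall y, W y -> D y -> F y = f y
    & forall y k, W y -> derivable F y (basis_vec k)].
Proof.
move=> sf Dx; have [W [F [oW Wx sF EF]]] := sf x Dx.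
by exists W, F; split=> // y k Wy; exact: (sF [::] y Wy).2.
Qed.

Lemma smooth_on_rpartial D f k : relopen D -> smooth_on D f -> smooth_on D (rpartial k f).
Proof.
move=> rD sf x Dx; have [W [F [oW Wx sF EF dF]]] := smooth_on_ext sf Dx.
have sF' : smooth_on_open W ('D_(basis_vec k) F).
  by move=> s y Wy; rewrite -partials_rcons; exact: sF.
have E y : W y -> D y -> 'D_(basis_vec k) F y = rpartial k f y.
  by move=> Wy Dy; apply/esym/(rpartialE rD oW Wy Dy EF)/dF.
by exists W, ('D_(basis_vec k) F).
Qed.

Lemma rpartial_eq D f g k x : relopen D -> (forall y, D y -> f y = g y) ->
  D x -> smooth_on D f -> rpartial k f x = rpartial k g x.
Proof.
move=> rD fg Dx sf; have [W [F [oW Wx sF EF /(_ _ k Wx) dF]]] := smooth_on_ext sf Dx.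
have EG y : W y -> D y -> F y = g y by move=> Wy Dy; rewrite EF // fg.
by rewrite (rpartialE rD oW Wx Dx EF dF) (rpartialE rD oW Wx Dx EG dF).
Qed.

Lemma rpartial_cst D (c : R) k x : relopen D -> D x -> rpartial k (fun=> c) x = 0.
Proof.
move=> rD Dx; rewrite (@rpartialE D setT (fun=> c)) //; first exact: derive_cst.
exact: openT.
Qed.

Lemma rpartial_local D f k x : relopen D -> D x ->
  (forall y, D y -> f y = 0) -> rpartial k f x = 0.
Proof.
move=> rD Dx f0; rewrite -(rpartial_cst 0 k rD Dx); apply/esym.
by apply: (rpartial_eq k rD _ Dx) => [y /f0//|]; exact: smooth_on_cst.
Qed.

Lemma rpartial_coord D k l x : relopen D -> D x ->
  rpartial k (fun y : V => y ord0 l) x = (l == k)%:R.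
Proof.
have [d1 d2] := is_derive_coord x (basis_vec k) l.
move=> rD Dx; rewrite (@rpartialE D setT (fun y : V => y ord0 l)) //.
  by rewrite d2 basis_vecE.
exact: openT.
Qed.

Lemma rpartialD D f g k x : relopen D -> D x -> smooth_on D f -> smooth_on D g ->
  rpartial k (fun y => f y + g y) x = rpartial k f x + rpartial k g x.
Proof.
move=> rD Dx sf sg; have [W [F [oW Wx sF EF /(_ _ k Wx) dF]]] := smooth_on_ext sf Dx.
have [W' [G [oW' Wx' sG EG /(_ _ k Wx') dG]]] := smooth_on_ext sg Dx.
rewrite (rpartialE rD oW Wx Dx EF dF) (rpartialE rD oW' Wx' Dx EG dG).
rewrite -(deriveD dF dG).
have E y : (W `&` W') y -> D y -> (F + G) y = f y + g y.
  by move=> [Wy W'y] Dy; rewrite -EF -?EG.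
exact: (rpartialE rD (openI oW oW') (conj Wx Wx') Dx E (derivableD dF dG)).
Qed.

Lemma rpartialM D f g k x : relopen D -> D x -> smooth_on D f -> smooth_on D g ->
  rpartial k (fun y => f y * g y) x = rpartial k f x * g x + f x * rpartial k g x.
Proof.
move=> rD Dx sf sg; have [W [F [oW Wx sF EF /(_ _ k Wx) dF]]] := smooth_on_ext sf Dx.
have [W' [G [oW' Wx' sG EG /(_ _ k Wx') dG]]] := smooth_on_ext sg Dx.
rewrite (rpartialE rD oW Wx Dx EF dF) (rpartialE rD oW' Wx' Dx EG dG).
rewrite -EF // -EG // addrC [_ * G x]mulrC -(deriveM dF dG).
have E y : (W `&` W') y -> D y -> (F * G) y = f y * g y.
  by move=> [Wy W'y] Dy; rewrite -EF -?EG.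
exact: (rpartialE rD (openI oW oW') (conj Wx Wx') Dx E (derivableM dF dG)).
Qed.

Lemma rpartialZ D (c : R) f k x : relopen D -> D x -> smooth_on D f ->
  rpartial k (fun y => c * f y) x = c * rpartial k f x.
Proof.
move=> rD Dx sf; rewrite (rpartialM k rD Dx) //; last exact: smooth_on_cst.
by rewrite (rpartial_cst c k rD Dx) mul0r add0r.
Qed.

Lemma rpartialN D f k x : relopen D -> D x -> smooth_on D f ->
  rpartial k (fun y => - f y) x = - rpartial k f x.
Proof.
move=> rD Dx sf; rewrite -mulN1r -(rpartialZ (-1) k rD Dx sf).
by congr (rpartial k _ x); apply/funext => y; rewrite mulN1r.
Qed.

Lemma rpartial_sum (J : Type) (s : seq J) (P : pred J) D (F : J -> V -> R) k x :
  relopen D -> D x -> (forall j, P j -> smooth_on D (F j)) ->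
  rpartial k (fun y => \sum_(j <- s | P j) F j y) x =
  \sum_(j <- s | P j) rpartial k (F j) x.
Proof.
move=> rD Dx HF; elim: s => [|j s IH].
  rewrite big_nil (_ : (fun y => _) = fun=> 0); first exact: (rpartial_cst 0 k rD Dx).
  by apply/funext => y; rewrite big_nil.
rewrite big_cons; case Pj: (P j); last first.
  by rewrite -IH; congr (rpartial k _ x); apply/funext => y; rewrite big_cons Pj.
rewrite -IH -(rpartialD k rD Dx (HF _ Pj)); last exact: smooth_on_bigsum.
by congr (rpartial k _ x); apply/funext => y; rewrite big_cons Pj.
Qed.

Lemma rpartialC D f j k x : relopen D -> D x -> smooth_on D f ->
  rpartial j (rpartial k f) x = rpartial k (rpartial j f) x.
Proof.
move=> rD Dx sf; have [W [F [oW Wx sF EF dF]]] := smooth_on_ext sf Dx.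
have E l y : W y -> D y -> 'D_(basis_vec l) F y = rpartial l f y.
  by move=> Wy Dy; apply/esym/(rpartialE rD oW Wy Dy EF)/dF.
rewrite (rpartialE rD oW Wx Dx (E k)); last exact: (sF [:: k] x Wx).2.
rewrite (rpartialE rD oW Wx Dx (E j)); last exact: (sF [:: j] x Wx).2.
apply: (@schwarz R n W F x j k oW Wx).
- by move=> z l Wz; exact: dF.
- by move=> z l m Wz; exact: (sF [:: l] z Wz).2.
- by move=> l m; exact: (sF [:: m; l] x Wx).1.
Qed.

Definition tangent_interior (k : 'I_n) (x : V) := k != 0%N :> nat \/ 0 < x ord0 k.

Lemma is_derive_rpartial D f k x : relopen D -> D x -> smooth_on D f ->
  tangent_interior k x -> is_derive x (basis_vec k) f (rpartial k f x).
Proof.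
move=> rD Dx sf tk; have [W [F [oW Wx sF EF /(_ _ k Wx) dF]]] := smooth_on_ext sf Dx.
rewrite (rpartialE rD oW Wx Dx EF dF); have [Q [oQ DE]] := rD.
have [Qx Hx] : Q x /\ half_space x by move: Dx; rewrite DE.
have [r /= r0 Hr] : exists2 r : R, 0 < r & forall y, `|y - x| < r -> W y /\ Q y.
  have /nbhs_ballP [r r0 Hr] := open_nbhs_nbhs (conj (openI oW oQ) (conj Wx Qx)).
  by exists r => // y yr; apply: Hr; rewrite -ball_normE /= distrC.
have [r' r'0 Hr'] : exists2 r' : R, 0 < r' & forall h, `|h| < r' ->
    half_space (x + h *: basis_vec k).
  case: tk => [k0|xk].
    exists 1 => // h _ l l0; rewrite !mxE eqxx /= (_ : (l == k) = false).
      by rewrite mulr0 addr0 Hx.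
    by apply/negP => /eqP lk; rewrite -lk l0 in k0.
  exists (x ord0 k) => // h; rewrite ltr_norml => /andP[h1 _] l l0.
  rewrite !mxE eqxx /=; have [->|_] := eqVneq l k; last by rewrite mulr0 addr0 Hx.
  by rewrite mulr1 -lerBlDl sub0r ltW.
have /derivableP /is_deriveP H := dF.
apply/is_deriveP => e e0; have [r2 r20 Hr2] := H e e0.
exists (Num.min r2 (Num.min r r')); first by rewrite !lt_min r20 r0 r'0.
move=> h; rewrite !lt_min => /and3P[h1 h2 h3].
have [] := Hr (x + h *: basis_vec k).
  by rewrite addrC addKr normrZ; apply: le_lt_trans h2; rewrite ler_piMr // basis_vec_norm.
move=> Wh Qh; rewrite -EF // -?EF //; first exact: Hr2.
by rewrite DE; split=> //; exact: Hr'.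
Qed.

Lemma rpartial_tangent0 D f (k : 'I_n) x : relopen D -> D x -> smooth_on D f ->
  k != 0%N :> nat ->
  (forall y, D y -> half_space_boundary y -> f y = 0) ->
  half_space_boundary x -> rpartial k f x = 0.
Proof.
move=> rD Dx sf k0 f0 [Hx [l [l0 xl]]].
have /is_deriveP H := is_derive_rpartial rD Dx sf (or_introl k0).
have [Q [oQ DE]] := rD.
have [Qx _] : Q x /\ half_space x by move: Dx; rewrite DE.
have [r /= r0 Hr] : exists2 r : R, 0 < r & forall y, `|y - x| < r -> Q y.
  have /nbhs_ballP [r r0 Hr] := open_nbhs_nbhs (conj oQ Qx).
  by exists r => // y yr; apply: Hr; rewrite -ball_normE /= distrC.
apply/eqP; rewrite -normr_le0; apply/ler_addgt0Pr => e e0; rewrite add0r.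
have [r2 r20 Hr2] := H e e0.
pose h := Num.min r r2 / 2.
have h0 : 0 < h by rewrite divr_gt0 // lt_min r0.
have : h < Num.min r r2 by rewrite ltr_pdivrMr ?ltr_pMr ?ltr1n ?lt_min ?r0.
rewrite lt_min => /andP[hr hr2].
have B (m : 'I_n) : (m : nat) = 0%N -> (x + h *: basis_vec k) ord0 m = x ord0 m.
  move=> m0; rewrite !mxE eqxx /= (_ : (m == k) = false) ?mulr0 ?addr0//.
  by apply/negP => /eqP mk; rewrite -mk m0 in k0.
have Hh : half_space (x + h *: basis_vec k) by move=> m m0; rewrite B // Hx.
have := Hr2 h; rewrite gtr0_norm // => /(_ hr2).
rewrite f0; first last.
- by split=> //; exists l; split=> //; rewrite B.
- rewrite DE; split=> //; apply: Hr; rewrite addrC addKr normrZ gtr0_norm //.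
  by apply: le_lt_trans hr; rewrite ler_piMr ?basis_vec_norm// ltW.
rewrite f0 //; last by split=> //; exists l.
by rewrite subr0 sub0r normrN normrM gtr0_norm // mulrC ler_pM2r.
Qed.

Definition rpartials (s : seq 'I_n) (f : V -> R) : V -> R := foldr rpartial f s.

Lemma rpartials_rcons s k f : rpartials (rcons s k) f = rpartials s (rpartial k f).
Proof. by rewrite /rpartials foldr_rcons. Qed.

Lemma rpartials_cat s t f : rpartials (s ++ t) f = rpartials s (rpartials t f).
Proof. by rewrite /rpartials foldr_cat. Qed.

Lemma smooth_on_rpartials D s f : relopen D -> smooth_on D f -> smooth_on D (rpartials s f).
Proof. by move=> rD sf; elim: s => [//|k s IH] /=; exact: smooth_on_rpartial. Qed.

Lemma rpartials_eq D s f g : relopen D -> smooth_on D f -> (forall y, D y -> f y = g y) ->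
  forall y, D y -> rpartials s f y = rpartials s g y.
Proof.
move=> rD sf fg; elim: s => [//|k s IH] y Dy /=.
by apply: (rpartial_eq k rD IH Dy); exact: smooth_on_rpartials.
Qed.

Lemma rpartial_rpartials D k s f : relopen D -> smooth_on D f ->
  forall y, D y -> rpartial k (rpartials s f) y = rpartials s (rpartial k f) y.
Proof.
move=> rD sf; elim: s => [//|l s IH] y Dy /=.
rewrite (rpartialC k l rD Dy); last exact: smooth_on_rpartials.
by apply: (rpartial_eq l rD IH Dy); apply: smooth_on_rpartial; rewrite //; exact: smooth_on_rpartials.
Qed.

Lemma rpartialsC D s t f : relopen D -> smooth_on D f ->
  forall y, D y -> rpartials s (rpartials t f) y = rpartials t (rpartials s f) y.
Proof.
move=> rD sf; elim: s => [//|l s IH] y Dy /=.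
rewrite (rpartial_eq l rD IH Dy); last by do 2 apply: smooth_on_rpartials => //.
apply: (rpartial_rpartials _ _ rD _ Dy); exact: smooth_on_rpartials.
Qed.

Lemma rpartials_perm D s t f : relopen D -> smooth_on D f -> perm_eq s t ->
  forall y, D y -> rpartials s f y = rpartials t f y.
Proof.
move=> rD sf st.
apply: (@catCA_perm_ind _ (fun u => forall y, D y -> rpartials s f y = rpartials u f y)
  _ _ _ st) => // s1 s2 s3 E y Dy.
rewrite E // !rpartials_cat.
exact: (rpartialsC _ _ rD (smooth_on_rpartials s3 rD sf) Dy).
Qed.

End SmoothOn.

Section RpartialChain.
Context {R : realType} {n p : nat}.

Lemma rpartial_comp (D : set 'rV[R]_n) (D' : set 'rV[R]_p) (f : 'rV[R]_p -> R)
    (g : 'rV[R]_n -> 'rV[R]_p) k x : relopen D -> relopen D' -> D x ->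
  smooth_on D' f -> (forall a, smooth_on D (fun x => g x ord0 a)) ->
  (forall x, D x -> D' (g x)) ->
  rpartial k (f \o g) x =
  \sum_a rpartial a f (g x) * rpartial k (fun y => g y ord0 a) x.
Proof.
move=> rD rD' Dx sf sg gD.
have [W' [F [oW' W'x sF Ff]]] := sf _ (gD _ Dx).
have /choice [W HW] a := sg a x Dx.
have /choice [G HG] := HW.
pose g' y : 'rV[R]_p := \row_a G a y.
have g'x : g' x = g x.
  by apply/rowP => a; rewrite mxE; have [_ Wx _ ->] := HG a.
have GE a : (fun y => g' y ord0 a) = G a by apply/funext => z; rewrite mxE.
have dG a : derivable (G a) x (basis_vec k).
  by have [_ Wx /(_ [::] x Wx) [_ /(_ k)] ? _] := HG a.
have dF a : derivable F (g x) (basis_vec a) by exact: (sF [::] _ W'x).2.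
have C : is_derive x (basis_vec k) (F \o g')
   (\sum_a 'D_(basis_vec a) F (g' x) * 'D_(basis_vec k) (G a) x).
  apply: (is_derive_chain oW'); rewrite ?g'x.
  - exact: W'x.
  - by move=> z a W'z; exact: (sF [::] _ W'z).2.
  - by move=> a; exact: (sF [:: a] _ W'x).1.
  - by move=> a; rewrite GE; exact: derivableP.
have cg' : {for x, continuous g'}.
  apply: continuous_at_coord => a; rewrite GE.
  by have [_ Wx /(_ [::] x Wx) [c _] _] := HG a.
have Wn : nbhs x [set y | (forall a, W a y) /\ W' (g' y)].
  apply: filterI.
    apply: (@filter_forall _ _ W (nbhs x)) => a; have [oWa Wx _ _] := HG a; exact: open_nbhs_nbhs.
  by apply: cg'; rewrite g'x; exact: open_nbhs_nbhs.
pose W0 := interior [set y | (forall a, W a y) /\ W' (g' y)].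
have E a : rpartial a f (g x) = 'D_(basis_vec a) F (g x).
  by apply: (rpartialE rD' oW' W'x _ Ff) => //; exact: gD.
have E' a : rpartial k (fun y => g y ord0 a) x = 'D_(basis_vec k) (G a) x.
  by have [oWa Wx _ Ea] := HG a; apply: (rpartialE rD oWa Wx Dx Ea).
under eq_bigr do rewrite E E'.
rewrite -g'x; have [C1 <-] := C.
have EE y : W0 y -> D y -> (F \o g') y = (f \o g) y.
  move=> /interior_subset [Wy W'y] Dy.
  have Ey : g' y = g y.
    by apply/rowP => a; rewrite mxE; have [_ _ _ ->] := HG a.
  by rewrite /= Ey Ff -?Ey//; rewrite Ey; exact: gD.
exact: (rpartialE rD (open_interior _) Wn Dx EE C1).
Qed.

End RpartialChain.

(** * Lebesgue measure and integration on boxes *)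

Section Pushforward.
Context {R : realType} d1 d2 (X : measurableType d1) (Y : measurableType d2).
Variables (mu : {measure set X -> \bar R}) (phi : X -> Y) (psi : Y -> X).
Local Open Scope ereal_scope.

(* The proof arguments make the measure structure below inferable. *)
Definition push_measure (mphi : measurable_fun setT phi) (mpsi : measurable_fun setT psi)
    (phiK : cancel phi psi) (sfmu : sigma_finite setT mu) : set Y -> \bar R := fun B => mu (phi @^-1` B).

Variables (mphi : measurable_fun setT phi) (mpsi : measurable_fun setT psi)
    (phiK : cancel phi psi) (sfmu : sigma_finite setT mu).
Let nu := push_measure mphi mpsi phiK sfmu.

Let mpre (B : set Y) : measurable B -> measurable (phi @^-1` B).
Proof. by move=> mB; rewrite -[X in measurable X]setTI; exact: mphi. Qed.

Let nu0 : nu set0 = 0.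
Proof. by rewrite /nu /push_measure preimage_set0 measure0. Qed.

Let nu_ge0 B : 0 <= nu B.
Proof. exact: measure_ge0. Qed.

Let nu_sigma_additive : semi_sigma_additive nu.
Proof.
move=> F mF tF mUF; rewrite /nu /push_measure preimage_bigcup.
apply: measure_semi_sigma_additive.
- by move=> n; exact: mpre.
- apply/trivIsetP => /= i j _ _ ij; rewrite -preimage_setI.
  by move/trivIsetP : tF => /(_ _ _ _ _ ij) ->//; rewrite preimage_set0.
- by rewrite -preimage_bigcup; exact: mpre.
Qed.

HB.instance Definition _ := isMeasure.Build _ _ _ nu nu0 nu_ge0 nu_sigma_additive.

Let nu_sigma_finite : sigma_finite setT nu.
Proof.
have [F TF Foo] := sfmu.
exists (fun i => psi @^-1` F i).
  by rewrite -preimage_bigcup -TF preimage_setT.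
move=> i; have [mF Fi] := Foo i; split.
  by rewrite -[X in measurable X]setTI; apply: mpsi.
rewrite /nu /push_measure -comp_preimage.
by rewrite (_ : _ \o _ = id) //; apply/funext => p; exact: phiK.
Qed.

HB.instance Definition _ := Measure_isSigmaFinite.Build _ _ _ nu nu_sigma_finite.

End Pushforward.

Definition sigma_product (R : realType) d1 d2 (T1 : measurableType d1)
    (T2 : measurableType d2) (m1 : {sigma_finite_measure set T1 -> \bar R})
    (m2 : {sigma_finite_measure set T2 -> \bar R}) : {measure set (T1 * T2)%type -> \bar R} :=
  (m1 \x m2)%E.

Lemma sigma_productE (R : realType) d1 d2 (T1 : measurableType d1)
    (T2 : measurableType d2) (m1 : {sigma_finite_measure set T1 -> \bar R})
    (m2 : {sigma_finite_measure set T2 -> \bar R}) A B : measurable A -> measurable B ->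
  sigma_product m1 m2 (A `*` B) = (m1 A * m2 B)%E.
Proof. exact: product_measure1E. Qed.

Lemma sigma_product_finite (R : realType) d1 d2 (T1 : measurableType d1)
    (T2 : measurableType d2) (m1 : {sigma_finite_measure set T1 -> \bar R})
    (m2 : {sigma_finite_measure set T2 -> \bar R}) : sigma_finite setT (sigma_product m1 m2).
Proof.
have /sigma_finiteP[F [TF ndF Foo]] := sigma_finiteT m1.
have /sigma_finiteP[G [TG ndG Goo]] := sigma_finiteT m2.
exists (fun n => F n `*` G n).
  apply/seteqP; split=> // -[x y] _.
  have [i _ Fx] : (\bigcup_i F i) x by rewrite -TF.
  have [j _ Gy] : (\bigcup_i G i) y by rewrite -TG.
  exists (maxn i j) => //; split => /=.
    by move: x Fx; exact/subsetPset/ndF/leq_maxl.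
  by move: y Gy; exact/subsetPset/ndG/leq_maxr.
move=> k; have [mF Fk] := Foo k; have [mG Gk] := Goo k.
split; first exact: measurableX.
by rewrite sigma_productE// lte_mul_pinfty// ge0_fin_numE.
Qed.

Section BorelRV.
Context {R : realType}.

(* The name [borel] of Defs.v is a notation; rows are given their Borel sets. *)
Definition brow (n : nat) := borel 'rV[R]_n.

Lemma borel_open (X : ptopologicalType) (U : set X) : open U -> measurable (U : set (borel X)).
Proof. by move=> oU; apply: sub_sigma_algebra. Qed.

Lemma borel_closed (X : ptopologicalType) (U : set X) : closed U ->
  measurable (U : set (borel X)).
Proof.
move=> cU; rewrite -[U]setCK; apply: measurableC; apply: borel_open.
exact: closed_openC.
Qed.

Lemma borel_measurable_fun d (T : measurableType d) (Y : ptopologicalType) (D : set T)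
    (f : T -> borel Y) :
  (forall U : set Y, open U -> measurable (D `&` f @^-1` U)) -> measurable_fun D f.
Proof.
move=> H; apply: (@measurability _ _ _ _ D f (@open Y)) => //.
by move=> _ [U oU <-]; exact: H.
Qed.

Lemma borel_continuous (X Y : ptopologicalType) (f : X -> Y) : continuous f ->
  measurable_fun [set: borel X] (f : borel X -> borel Y).
Proof.
move=> cf; apply: borel_measurable_fun => U oU; rewrite setTI.
by apply: borel_open; apply: open_comp => // x _; exact: cf.
Qed.

Lemma borel_measurable_realfun (X : ptopologicalType) (D : set X) (f : X -> R) :
  closed D -> {within D, continuous f} -> measurable_fun (D : set (borel X)) (f : borel X -> R).
Proof.
move=> cD cf; apply: (measurability _ (RGenOInfty.measurableE R)).
move=> _ [_ [a ->] <-].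
have /open_subspaceP : open (f @^-1` (`]a, +oo[%classic : set R) : set (subspace D)).
  apply: open_comp; last exact: interval_open.
  by move=> x _; exact: cf.
move=> [V oV VE]; rewrite setIC (_ : _ `&` D = V `&` D) //.
by apply: measurableI; [exact: borel_open|exact: borel_closed].
Qed.

Lemma countable_ratrow n : countable [set: 'rV[rat]_n * nat].
Proof. exact: countableP. Qed.

Definition ratbox n (q : 'rV[rat]_n * nat) : set 'rV[R]_n :=
  [set x | forall k, `|x ord0 k - ratr (q.1 ord0 k)| < q.2.+1%:R^-1].

Lemma open_ratbox n (U : set 'rV[R]_n) : open U ->
  U = \bigcup_q (if pselect (ratbox q `<=` U) then ratbox q else set0).
Proof.
move=> oU; apply/seteqP; split=> [x Ux|x [q _]]; last by case: pselect => // h /h.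
have /nbhs_ballP [r /= r0 Hr] := open_nbhs_nbhs (conj oU Ux).
have [k Hk] : exists k, k.+1%:R^-1 < r / 2.
  have r20 : 0 < (r / 2)^-1 by rewrite invr_gt0 divr_gt0.
  exists (Num.truncn (r / 2)^-1).
  rewrite invf_plt ?posrE ?divr_gt0 //.
  by have /andP[] := truncn_itv (ltW r20).
have /choice [q Hq] : forall l, exists q : rat, `|x ord0 l - ratr q| < k.+1%:R^-1.
  move=> l; have k0 : 0 < k.+1%:R^-1 :> R by rewrite invr_gt0.
  have [|q] := @rat_in_itvoo R (x ord0 l - k.+1%:R^-1) (x ord0 l + k.+1%:R^-1).
    by rewrite ltrD2l gtrN.
  rewrite in_itv /= => /andP[q1 q2]; exists q.
  by rewrite distrC ltr_distl q1.
exists (\row_l q l, k) => //.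
have Hx : ratbox (\row_l q l, k) x by move=> l; rewrite mxE.
case: pselect => // -[] y Hy; apply: Hr; rewrite -ball_normE /=; apply/mx_norm_ltP => // l.
rewrite !mxE -(subrK (ratr (q l)) (x ord0 l)) -addrA.
apply: le_lt_trans (ler_normD _ _) _; rewrite (splitr r); apply: ltrD.
  exact: lt_trans (Hq l) Hk.
by rewrite distrC; have := Hy l; rewrite /= mxE => /lt_trans; apply.
Qed.

Definition rowcons m (p : R * 'rV[R]_m) : 'rV[R]_m.+1 :=
  row_mx (p.1%:M : 'rV[R]_1) p.2.
Definition rowuncons m (x : 'rV[R]_m.+1) : R * 'rV[R]_m :=
  (x ord0 ord0, \row_j x ord0 (lift ord0 j)).

Lemma rowcons0 m (p : R * 'rV[R]_m) : rowcons p ord0 ord0 = p.1.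
Proof.
rewrite /rowcons (_ : ord0 = lshift m ord0 :> 'I_(1 + m)); last exact: val_inj.
by rewrite (row_mxEl (p.1%:M)) mxE eqxx.
Qed.

Lemma rowconsS m (p : R * 'rV[R]_m) j : rowcons p ord0 (lift ord0 j) = p.2 ord0 j.
Proof.
rewrite /rowcons (_ : lift ord0 j = rshift 1 j :> 'I_(1 + m)); last exact: val_inj.
by rewrite (row_mxEr (p.1%:M)).
Qed.

Lemma rowconsK m : cancel (@rowcons m) (@rowuncons m).
Proof.
move=> [t v]; rewrite /rowuncons rowcons0; congr pair; apply/rowP => j.
by rewrite mxE rowconsS.
Qed.

Lemma ord_split m (P : 'I_m.+1 -> Prop) : P ord0 -> (forall j, P (lift ord0 j)) ->
  forall k, P k.
Proof.
by move=> P0 PS k; case: (unliftP ord0 k) => [j ->|->].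
Qed.

Lemma rowunconsK m : cancel (@rowuncons m) (@rowcons m).
Proof.
move=> x; apply/rowP; apply: ord_split; first by rewrite rowcons0.
by move=> j; rewrite rowconsS mxE.
Qed.

Lemma measurable_rowcons m :
  measurable_fun [set: measurableTypeR R * brow m] (@rowcons m : _ -> brow m.+1).
Proof.
apply: borel_measurable_fun => U oU; rewrite setTI (open_ratbox oU) preimage_bigcup.
apply: countable_bigcupT_measurable; first exact: countable_ratrow.
move=> q; case: pselect => h; last by rewrite preimage_set0; exact: measurable0.
rewrite (_ : _ @^-1` _ = [set t : R | `|t - ratr (q.1 ord0 ord0)| < q.2.+1%:R^-1] `*`
   ratbox (\row_j q.1 ord0 (lift ord0 j), q.2)); last first.
  apply/seteqP; split=> [[t v]/= H|[t v]/= [Ht Hv]].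
    split; first by have := H ord0; rewrite rowcons0.
    by move=> j; have := H (lift ord0 j); rewrite rowconsS /= mxE.
  apply: ord_split; first by rewrite rowcons0.
  by move=> j; have := Hv j; rewrite rowconsS /= mxE.
apply: measurableX.
  apply: open_measurable; rewrite (_ : mkset _ = ball (ratr (q.1 ord0 ord0) : R) q.2.+1%:R^-1).
    exact: ball_open.
  by apply/seteqP; split=> t; rewrite -ball_normE /= distrC.
apply: borel_open.
have -> : ratbox (\row_j q.1 ord0 (lift ord0 j), q.2) =
   ball (\row_j ratr (q.1 ord0 (lift ord0 j)) : 'rV[R]_m) q.2.+1%:R^-1.
  apply/seteqP; split=> x Hx.
    by rewrite -ball_normE /=; apply/mx_norm_ltP => // j; have := Hx j; rewrite /= !mxE distrC.
  move=> j; have k0 : 0 < q.2.+1%:R^-1 :> R by rewrite invr_gt0.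
  move: Hx; rewrite -ball_normE /= => /(mx_norm_ltP _ k0) /(_ j).
  by rewrite /= !mxE distrC.
exact: ball_open.
Qed.

Lemma measurable_rowuncons m :
  measurable_fun [set: brow m.+1] (@rowuncons m : _ -> measurableTypeR R * brow m).
Proof.
apply: measurable_fun_pair.
  apply: borel_measurable_realfun; first exact: closedT.
  by apply: continuous_subspaceT => x; exact: coord_continuous.
apply: borel_continuous => x; apply: continuous_at_coord => j.
rewrite (_ : (fun y => _) = fun y : 'rV[R]_m.+1 => y ord0 (lift ord0 j)).
  exact: coord_continuous.
by apply/funext => y; rewrite mxE.
Qed.

Definition row_measure_step m (mu : {sigma_finite_measure set (brow m) -> \bar R}) :
    {sigma_finite_measure set (brow m.+1) -> \bar R} :=
  push_measure (mu := sigma_product (@lebesgue_measure R) mu) (@measurable_rowcons m)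
    (@measurable_rowuncons m) (@rowconsK m) (sigma_product_finite _ _).

Fixpoint row_measure (n : nat) : {sigma_finite_measure set (brow n) -> \bar R} :=
  match n with
  | 0%N => @dirac _ (brow 0) (0 : 'rV[R]_0) R
  | m.+1 => row_measure_step (row_measure m)
  end.

Lemma row_measureS_integral m (f : brow m.+1 -> \bar R) :
  measurable_fun setT f -> (forall x, (0 <= f x)%E) ->
  (\int[row_measure m.+1]_x f x =
   \int[sigma_product (@lebesgue_measure R) (row_measure m)]_p f (rowcons p))%E.
Proof.
move=> mf f0; rewrite -[RHS](@ge0_integral_pushforward _ _ (measurableTypeR R * brow m)%type (brow m.+1) R
  (@rowcons m)
  (@measurable_rowcons m) _ setT) //.
Qed.

Lemma lebesgue_integral_rVE n (f : brow n -> \bar R) :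
  measurable_fun setT f -> (forall x, (0 <= f x)%E) ->
  (lebesgue_integral_rV f = \int[row_measure n]_x f x)%E.
Proof.
elim: n f => [|m IH] f mf f0.
  by rewrite /= integral_dirac // diracT mul1e.
have mf' : measurable_fun setT (f \o @rowcons m : measurableTypeR R * brow m -> \bar R).
  by apply: measurableT_comp => //; exact: measurable_rowcons.
rewrite row_measureS_integral // fubini_tonelli1 //= /fubini_F.
apply: eq_integral => t _; rewrite -IH //.
exact: (measurableT_comp mf' (pair1_measurable t)).
Qed.

Definition box n (a b : 'rV[R]_n) : set 'rV[R]_n :=
  [set x | forall k, a ord0 k <= x ord0 k <= b ord0 k].

Lemma box_compact n (a b : 'rV[R]_n) : compact (box a b).
Proof.
have := @rV_compact R n (fun k => `[a ord0 k, b ord0 k]%classic) (fun k => @segment_compact _ _ _).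
by congr compact; apply/seteqP; split=> x H k; have := H k; rewrite /= in_itv.
Qed.

Lemma box_closed n (a b : 'rV[R]_n) : closed (box a b).
Proof. by apply: compact_closed; [exact: norm_hausdorff|exact: box_compact]. Qed.

Lemma box_measurable n (a b : 'rV[R]_n) : measurable (box a b : set (brow n)).
Proof. by apply: borel_closed; exact: box_closed. Qed.

Lemma preimage_rowcons_box m (a b : 'rV[R]_m.+1) :
  @rowcons m @^-1` box a b =
  [set` `[a ord0 ord0, b ord0 ord0]] `*` box (rowuncons a).2 (rowuncons b).2.
Proof.
apply/seteqP; split=> [[t v] H|[t v] [H1 H2]].
  split; first by have := H ord0; rewrite rowcons0 /= in_itv.
  by move=> k; have := H (lift ord0 k); rewrite rowconsS !mxE.
apply: ord_split; first by move: H1; rewrite rowcons0 /= in_itv.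
by move=> k; have := H2 k; rewrite rowconsS !mxE.
Qed.

Lemma row_measure_box n (a b : 'rV[R]_n) : (forall k, a ord0 k <= b ord0 k) ->
  row_measure n (box a b) = (\prod_k (b ord0 k - a ord0 k))%:E.
Proof.
elim: n a b => [|m IH] a b ab.
  rewrite big_ord0 /= /dirac indicE mem_set //; by case.
rewrite [LHS]/= /push_measure preimage_rowcons_box sigma_productE //; last first.
  exact: box_measurable.
rewrite IH; last by move=> k; rewrite !mxE.
rewrite big_ord_recl EFinM; congr (_ * _)%E.
  transitivity (lebesgue_measure `[a ord0 ord0, b ord0 ord0]%classic); first by [].
  rewrite lebesgue_measure_itv /= lte_fin.
  case: ltP => // ba; have -> : a ord0 ord0 = b ord0 ord0.
    by apply/eqP; rewrite eq_le ab.
  by rewrite subrr.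
by congr EFin; apply: eq_bigr => k _; rewrite !mxE.
Qed.

Lemma row_measure_box_fin n (a b : 'rV[R]_n) : (row_measure n (box a b) < +oo)%E.
Proof.
have [H|H] := pselect (forall k, a ord0 k <= b ord0 k).
  by rewrite row_measure_box // ltry.
rewrite (_ : box a b = set0) ?measure0 // -subset0 => x Hx; apply: H => k.
by have /andP[] := Hx k; exact: le_trans.
Qed.

Lemma continuous_compact_bounded (T : ptopologicalType) (B : set T) (F : T -> R) :
  compact B -> {within B, continuous F} -> exists C, 0 < C /\ forall x, B x -> `|F x| <= C.
Proof.
move=> cB cF; have /compact_bounded [C [_ HC]] := continuous_compact cF cB.
exists (`|C| + 1); split; first by rewrite ltr_wpDl.
move=> x Bx; apply: (HC (`|C| + 1)); last by exists x.
by rewrite ltr_pwDr // ler_norm.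
Qed.

Lemma box_measurable_fun n (a b : 'rV[R]_n) (F : 'rV[R]_n -> R) : {within box a b, continuous F} ->
  measurable_fun (box a b : set (brow n)) (F : brow n -> R).
Proof. by move=> cF; apply: borel_measurable_realfun => //; exact: box_closed. Qed.

Lemma box_integrable n (a b : 'rV[R]_n) (F : 'rV[R]_n -> R) : {within box a b, continuous F} ->
  (row_measure n).-integrable (box a b) (EFin \o F).
Proof.
move=> cF; apply: measurable_bounded_integrable.
- exact: box_measurable.
- exact: row_measure_box_fin.
- exact: box_measurable_fun.
have [C [C0 HC]] := continuous_compact_bounded (@box_compact _ a b) cF.
exists C; split; first exact: num_real.
by move=> M CM x Bx; apply: le_trans (HC x Bx) (ltW CM).
Qed.

Lemma rowcons_restrict m (F : 'rV[R]_m.+1 -> R) (a b : 'rV[R]_m.+1) t v :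
  ((EFin \o F) \_ (box a b)) (rowcons (t, v)) =
  if (t \in `[a ord0 ord0, b ord0 ord0]%classic) && (v \in box (rowuncons a).2 (rowuncons b).2)
  then (F (rowcons (t, v)))%:E else 0%E.
Proof.
rewrite patchE (_ : (rowcons (t, v) \in box a b) = (t \in `[a ord0 ord0, b ord0 ord0]%classic) &&
  (v \in box (rowuncons a).2 (rowuncons b).2)) //.
have E : box a b (rowcons (t, v)) = (@rowcons m @^-1` box a b) (t, v) by [].
apply/idP/andP.
  by rewrite inE E preimage_rowcons_box => -[] /= H1 H2; rewrite !inE.
by rewrite !inE E preimage_rowcons_box => -[].
Qed.

Lemma measurable_rowcons_integral m (a b : 'rV[R]_m.+1) (F : 'rV[R]_m.+1 -> R) :
  {within box a b, continuous F} -> (forall x, 0 <= F x) ->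
  measurable_fun `[a ord0 ord0, b ord0 ord0]%classic (fun t : measurableTypeR R =>
    \int[row_measure m]_(v in box (rowuncons a).2 (rowuncons b).2) (F (rowcons (t, v)))%:E)%E.
Proof.
move=> cF F0; set I := (X in measurable_fun X).
pose f : brow m.+1 -> \bar R := (EFin \o F) \_ (box a b).
have mf : measurable_fun setT f.
  apply/(measurable_restrictT _ (box_measurable a b))/measurable_EFinP.
  exact: box_measurable_fun.
have mf' : measurable_fun setT (f \o @rowcons m : measurableTypeR R * brow m -> \bar R).
  by apply: measurableT_comp => //; exact: measurable_rowcons.
have f0 x : (0 <= f x)%E by rewrite /f patchE; case: ifP => // _; rewrite lee_fin.
have M := @measurable_fun_fubini_tonelli_F _ _ _ _ _ (row_measure m) _ mf' (fun=> f0 _).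
have : measurable_fun I (fubini_F (row_measure m) (f \o @rowcons m)).
  exact: measurable_funS M.
apply: eq_measurable_fun => t tI; rewrite /fubini_F [RHS]integral_mkcond.
by apply: eq_integral => v _; rewrite /= /f rowcons_restrict tI patchE.
Qed.

Lemma rowcons_fubini m (a b : 'rV[R]_m.+1) (F : 'rV[R]_m.+1 -> R) : {within box a b, continuous F} ->
  let I := `[a ord0 ord0, b ord0 ord0]%classic in
  let B := box (rowuncons a).2 (rowuncons b).2 in
  (\int[row_measure m.+1]_(x in box a b) (F x)%:E =
     \int[lebesgue_measure]_(t in I) \int[row_measure m]_(v in B) (F (rowcons (t, v)))%:E /\
   \int[row_measure m.+1]_(x in box a b) (F x)%:E =
     \int[row_measure m]_(v in B) \int[lebesgue_measure]_(t in I) (F (rowcons (t, v)))%:E)%E.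
Proof.
move=> cF I B.
pose f : brow m.+1 -> \bar R := (EFin \o F) \_ (box a b).
have mI := box_measurable a b.
have mf : measurable_fun setT f.
  apply/(measurable_restrictT _ mI)/measurable_EFinP; exact: box_measurable_fun.
have mf' : measurable_fun setT (f \o @rowcons m : measurableTypeR R * brow m -> \bar R).
  by apply: measurableT_comp => //; exact: measurable_rowcons.
have fi : (sigma_product (@lebesgue_measure R) (row_measure m)).-integrable setT (f \o @rowcons m).
  apply/integrableP; split => //.
  have := box_integrable cF => /(integrable_mkcond _ mI) /integrableP [_].
  rewrite -/f row_measureS_integral //.
  exact: measurableT_comp.
have E : (\int[row_measure m.+1]_(x in box a b) (F x)%:E =
   \int[sigma_product (@lebesgue_measure R) (row_measure m)]_p f (rowcons p))%E.
  rewrite integral_mkcond -/f.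
  rewrite -(@integral_pushforward _ _ (measurableTypeR R * brow m)%type (brow m.+1) R (@rowcons m) (@measurable_rowcons m)
    (sigma_product (@lebesgue_measure R) (row_measure m)) setT f) //.
have fE t v : f (rowcons (t, v)) = _ := rowcons_restrict F a b t v.
split; rewrite E.
- rewrite -(fubini1 fi) [RHS]integral_mkcond; apply: eq_integral => t _.
  rewrite /fubini_F patchE; case: ifP => tI.
    by rewrite [RHS]integral_mkcond; apply: eq_integral => v _; rewrite /= fE tI patchE.
  by apply: integral0_eq => v _; rewrite /= fE tI.
- rewrite -(fubini2 fi) [RHS]integral_mkcond; apply: eq_integral => v _.
  rewrite /fubini_G patchE; case: ifP => vB.
    by rewrite [RHS]integral_mkcond; apply: eq_integral => t _; rewrite /= fE vB andbT patchE.
  by apply: integral0_eq => t _; rewrite /= fE vB andbF.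
Qed.

End BorelRV.

Section BoxCalculus.
Context {R : realType}.

Lemma within_continuous_comp (X Y Z : topologicalType) (A : set Y) (B : set X)
    (f : Y -> Z) (g : X -> Y) :
  continuous g -> (forall x, B x -> A (g x)) -> {within A, continuous f} ->
  {within B, continuous (fun x => f (g x))}.
Proof.
move=> cg gB /subspace_continuousP cf; apply/subspace_continuousP => x Bx.
change (f (g y) @[y --> within B (nbhs x)] --> f (g x)) => U HU.
have := cg x _ (cf _ (gB x Bx) U HU); rewrite /fmap /within /=.
by apply: (@filterS _ (nbhs x)) => y Hy By; exact/Hy/gB.
Qed.

Lemma rowcons_continuous_l m (v : 'rV[R]_m) : continuous (fun t : R => rowcons (t, v)).
Proof.
move=> t; apply: continuous_at_coord; apply: ord_split => [|j].
  by rewrite (_ : (fun y => _) = id) //; apply/funext => s; rewrite rowcons0.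
rewrite (_ : (fun y => _) = cst (v ord0 j)); first exact: cst_continuous.
by apply/funext => s; rewrite rowconsS.
Qed.

Lemma rowcons_continuous_r m (t : R) : continuous (fun v : 'rV[R]_m => rowcons (t, v)).
Proof.
move=> v; apply: continuous_at_coord; apply: ord_split => [|j].
  rewrite (_ : (fun y => _) = cst t); first exact: cst_continuous.
  by apply/funext => s; rewrite rowcons0.
rewrite (_ : (fun y => _) = fun w : 'rV[R]_m => w ord0 j); first exact: coord_continuous.
by apply/funext => s; rewrite rowconsS.
Qed.

Lemma rowcons_box m (a b : 'rV[R]_m.+1) t v :
  box a b (rowcons (t, v)) <->
  a ord0 ord0 <= t <= b ord0 ord0 /\ box (rowuncons a).2 (rowuncons b).2 v.
Proof.
have -> : box a b (rowcons (t, v)) = (@rowcons R m @^-1` box a b) (t, v) by [].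
by rewrite preimage_rowcons_box /= in_itv.
Qed.

Lemma is_derive_rowcons_r m (F : 'rV[R]_m.+1 -> R) t (v : 'rV[R]_m) k d :
  is_derive (rowcons (t, v)) (basis_vec (lift ord0 k)) F d ->
  is_derive v (basis_vec k) (fun w => F (rowcons (t, w))) d.
Proof.
move=> /is_deriveP H; apply/is_deriveP => e /H [r r0 Hr]; exists r => // h /Hr.
rewrite (_ : rowcons (t, v) + _ = rowcons (t, v + h *: basis_vec k)) //.
apply/rowP; apply: ord_split => [|j].
  by rewrite mxE [X in _ + X]mxE basis_vecE !rowcons0 mulr0 addr0.
by rewrite mxE [X in _ + X]mxE basis_vecE !rowconsS /= !mxE eqxx (inj_eq lift_inj).
Qed.

Lemma is_derive_rowcons_l m (F : 'rV[R]_m.+1 -> R) t (v : 'rV[R]_m) d :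
  is_derive (rowcons (t, v)) (basis_vec ord0) F d ->
  is_derive t (1 : R) (fun s => F (rowcons (s, v))) d.
Proof.
move=> /is_deriveP H; apply/is_deriveP => e /H [r r0 Hr]; exists r => // h /Hr.
rewrite [h%:A]mulr1 (_ : rowcons (t, v) + _ = rowcons (t + h, v)) //.
apply/rowP; apply: ord_split => [|j].
  by rewrite mxE [X in _ + X]mxE basis_vecE !rowcons0 mulr1.
by rewrite mxE [X in _ + X]mxE basis_vecE !rowconsS /= mulr0 addr0.
Qed.

Lemma ftc_itv (f f' : R -> R) (a b : R) : a < b ->
  {within `[a, b], continuous f} -> {within `[a, b], continuous f'} ->
  (forall t, a < t < b -> is_derive t (1 : R) f (f' t)) ->
  (\int[lebesgue_measure]_(t in `[a, b]) (f' t)%:E = (f b - f a)%:E)%E.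
Proof.
move=> ab cf cf' df; rewrite (@continuous_FTC2 _ f' f) ?EFinB //.
  have /continuous_within_itvP [//|_ ca cb] := cf.
  by split=> // t; rewrite in_itv /= => /df [].
by move=> t; rewrite in_itv /= => /df [_ <-]; rewrite derive1E.
Qed.

Lemma box_ibp n (a b : 'rV[R]_n) (k : 'I_n) (F F' : 'rV[R]_n -> R) :
  a ord0 k < b ord0 k ->
  {within box a b, continuous F} -> {within box a b, continuous F'} ->
  (forall x, box a b x -> a ord0 k < x ord0 k < b ord0 k ->
     is_derive x (basis_vec k) F (F' x)) ->
  (forall x, box a b x -> x ord0 k = a ord0 k \/ x ord0 k = b ord0 k -> F x = 0) ->
  (\int[row_measure n]_(x in box a b) (F' x)%:E = 0)%E.
Proof.
elim: n a b k F F' => [|m IH] a b k F F'; first by case: k.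
move: k; apply: ord_split => [|k] ab cF cF' dF F0.
  have [_ ->] := rowcons_fubini cF'; apply: integral0_eq => v Bv.
  have vI t : a ord0 ord0 <= t <= b ord0 ord0 -> box a b (rowcons (t, v)).
    by move=> tI; apply/rowcons_box.
  transitivity ((F (rowcons (b ord0 ord0, v)) - F (rowcons (a ord0 ord0, v)))%:E).
    apply: (@ftc_itv (fun t => F (rowcons (t, v))) (fun t => F' (rowcons (t, v)))) => //.
  - apply: (@within_continuous_comp _ _ _ (box a b)) cF; first exact: rowcons_continuous_l.
    by move=> t; rewrite /= in_itv; exact: vI.
  - apply: (@within_continuous_comp _ _ _ (box a b)) cF'; first exact: rowcons_continuous_l.
    by move=> t; rewrite /= in_itv; exact: vI.
  - move=> t /andP[t1 t2]; apply: is_derive_rowcons_l; apply: dF.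
      by apply: vI; rewrite (ltW t1) ltW.
    by rewrite rowcons0 t1.
  rewrite !F0 ?subrr //.
    + by apply: vI; rewrite lexx ltW.
    + by rewrite rowcons0; left.
    + by apply: vI; rewrite lexx ltW.
    + by rewrite rowcons0; right.
have [-> _] := rowcons_fubini cF'; apply: integral0_eq => t; rewrite /= in_itv /= => tI.
have vI v : box (rowuncons a).2 (rowuncons b).2 v -> box a b (rowcons (t, v)).
  by move=> Bv; apply/rowcons_box.
apply: (IH _ _ k (fun v => F (rowcons (t, v)))).
- by rewrite !mxE.
- by apply: (@within_continuous_comp _ _ _ (box a b)) cF => //; exact: rowcons_continuous_r.
- by apply: (@within_continuous_comp _ _ _ (box a b)) cF' => //; exact: rowcons_continuous_r.
- move=> v Bv; rewrite !mxE => vk; apply: is_derive_rowcons_r; apply: dF; first exact: vI.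
  by rewrite rowconsS.
- by move=> v Bv; rewrite !mxE => vk; apply: F0; [exact: vI|rewrite rowconsS].
Qed.

Lemma within_continuousD (T : topologicalType) (A : set T) (f g : T -> R) :
  {within A, continuous f} -> {within A, continuous g} ->
  {within A, continuous (fun x => f x + g x)}.
Proof. move=> /subspace_continuousP cf /subspace_continuousP cg.
by apply/subspace_continuousP => x Ax; exact: cvgD (cf x Ax) (cg x Ax). Qed.

Lemma within_continuousM (T : topologicalType) (A : set T) (f g : T -> R) :
  {within A, continuous f} -> {within A, continuous g} ->
  {within A, continuous (fun x => f x * g x)}.
Proof. move=> /subspace_continuousP cf /subspace_continuousP cg.
by apply/subspace_continuousP => x Ax; exact: cvgM (cf x Ax) (cg x Ax). Qed.

Lemma within_continuous_cst (T : topologicalType) (A : set T) (c : R) :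
  {within A, continuous (fun=> c)}.
Proof. by move=> x; exact: cst_continuous. Qed.

Lemma within_continuous_norm (T : topologicalType) (A : set T) (f : T -> R) :
  {within A, continuous f} -> {within A, continuous (fun x => `|f x|)}.
Proof.
move=> /subspace_continuousP cf.
by apply/subspace_continuousP => x Ax; exact: cvg_norm (cf x Ax).
Qed.

Lemma within_continuous_sum (T : topologicalType) (A : set T) (J : Type) (s : seq J)
    (P : pred J) (f : J -> T -> R) :
  (forall j, P j -> {within A, continuous (f j)}) ->
  {within A, continuous (fun x => \sum_(j <- s | P j) f j x)}.
Proof.
move=> cf; elim: s => [|j s IH].
  rewrite (_ : (fun x => _) = fun=> 0); first exact: within_continuous_cst.
  by apply/funext => x; rewrite big_nil.
case Pj: (P j).
  rewrite (_ : (fun x => _) = fun x => f j x + \sum_(j <- s | P j) f j x).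
    by apply: within_continuousD => //; exact: cf.
  by apply/funext => x; rewrite big_cons Pj.
rewrite (_ : (fun x => _) = fun x => \sum_(j <- s | P j) f j x) //.
by apply/funext => x; rewrite big_cons Pj.
Qed.

Lemma itv_integrable (a b : R) (f : R -> R) : {within `[a, b], continuous f} ->
  lebesgue_measure.-integrable `[a, b]%classic (EFin \o f).
Proof.
by move=> cf; apply: continuous_compact_integrable => //; exact: segment_compact.
Qed.

(* Apply the fundamental theorem of calculus to [(1 - (t - a) / r) f t]. *)
Lemma interval_sup_le (f f' : R -> R) (a r : R) : 0 < r ->
  {within `[a, a + r], continuous f} -> {within `[a, a + r], continuous f'} ->
  (forall t, a < t < a + r -> is_derive t (1 : R) f (f' t)) ->
  (`|f a|%:E <= \int[lebesgue_measure]_(t in `[a, (a + r)%R]) (r^-1 * `|f t| + `|f' t|)%:E)%E.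
Proof.
move=> r0 cf cf' df.
pose p (t : R) := 1 + (- r^-1) * (t - a).
have dp t : is_derive t (1 : R) p (- r^-1).
  apply/is_deriveP => e e0; exists 1 => // h _.
  rewrite [h%:A]mulr1 /p (_ : _ - _ - _ = 0); first by rewrite normr0 mulr_ge0 // ltW.
  by ring.
have cp : {within `[a, a + r], continuous p}.
  apply: continuous_subspaceT => t; have [d _] := dp t.
  by apply: differentiable_continuous; exact/derivable1_diffP.
pose g t := p t * f t; pose g' t := p t * f' t + f t * (- r^-1).
have cg : {within `[a, a + r], continuous g} by exact: within_continuousM.
have cg' : {within `[a, a + r], continuous g'}.
  apply: within_continuousD; first exact: within_continuousM.
  by apply: within_continuousM => //; exact: within_continuous_cst.
have := @ftc_itv g g' a (a + r) _ cg cg' _; rewrite ltrDl => /(_ r0) H.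
have {}H : (\int[lebesgue_measure]_(t in `[a, (a + r)%R]) (g' t)%:E = (- f a)%:E)%E.
  transitivity ((g (a + r) - g a)%:E); first apply: H.
    move=> t tI; have := is_deriveM (dp t) (df t tI).
    by rewrite /GRing.scale /= -/(g' t).
  rewrite /g /p subrr mulr0 addr0 mul1r [a + r]addrC addrK mulNr mulVf ?gt_eqF//.
    by rewrite subrr mul0r sub0r.
rewrite (_ : `|f a|%:E = `|(- f a)%:E|%E); last by rewrite abse_EFin normrN.
rewrite -H.
apply: le_trans; first apply: le_abse_integral => //.
  by have /integrableP [] := itv_integrable cg'.
have c2 : {within `[a, a + r], continuous (fun t => r^-1 * `|f t| + `|f' t|)}.
  apply: within_continuousD; last exact: within_continuous_norm.
  by apply: within_continuousM; [exact: within_continuous_cst|exact: within_continuous_norm].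
apply: ge0_le_integral => //.
- have := itv_integrable (within_continuous_norm cg').
  by move/integrableP => [].
- by have /integrableP [] := itv_integrable c2.
move=> t; rewrite /= in_itv /= => /andP[t1 t2]; rewrite lee_fin /g'.
apply: le_trans (ler_normD _ _) _; rewrite addrC; apply: lerD.
  by rewrite normrM normrN [`|r^-1|]ger0_norm ?invr_ge0 ?(ltW r0)// mulrC.
rewrite normrM ler_piMl //.
have h : 0 <= r^-1 * (t - a) <= 1.
  by rewrite mulr_ge0 ?invr_ge0 ?(ltW r0) ?subr_ge0//= mulrC ler_pdivrMr // mul1r lerBlDl.
by rewrite /p mulNr ger0_norm ?subr_ge0 ?gerBl; case/andP: h.
Qed.

Fixpoint subset_list n : seq {set 'I_n} :=
  match n with
  | 0%N => [:: finset.set0]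
  | m.+1 => [seq imset (lift ord0) (mem J) | J : {set 'I_m} <- subset_list m] ++
            [seq ord0 |: imset (lift ord0) (mem J) | J : {set 'I_m} <- subset_list m]
  end.

Lemma box_sup_le n (a b : 'rV[R]_n) (r : R) (F : {set 'I_n} -> 'rV[R]_n -> R) : 0 < r ->
  (forall k, b ord0 k = a ord0 k + r) ->
  (forall J : {set 'I_n}, {within box a b, continuous (F J)}) ->
  (forall (J : {set 'I_n}) k x, k \notin J -> box a b x -> a ord0 k < x ord0 k < b ord0 k ->
     is_derive x (basis_vec k) (F J) (F (k |: J) x)) ->
  (`|F finset.set0 a|%:E <= \int[row_measure n]_(x in box a b)
     (\sum_(J <- subset_list n) r^-1 ^+ (n - #|J|) * `|F J x|)%:E)%E.
Proof.
move=> r0; elim: n a b F => [|m IH] a b F ab cF dF.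
  have cG : {within box a b, continuous (fun x => \sum_(J <- subset_list 0)
      r^-1 ^+ (0 - #|J|) * `|F J x|)}.
    apply: within_continuous_sum => J _.
    by apply: within_continuousM; [exact: within_continuous_cst|exact/within_continuous_norm/cF].
  have /integrableP [] := box_integrable cG.
  rewrite (_ : box a b = setT); last by apply/seteqP; split=> // x _ [].
  move=> mG _; rewrite /= integral_dirac //.
  by rewrite diracT mul1e big_seq1 sub0n expr0 mul1r (_ : 0 = a) //; apply/rowP => -[].
pose a' := (rowuncons a).2; pose b' := (rowuncons b).2.
have vI t v : a ord0 ord0 <= t <= b ord0 ord0 -> box a' b' v -> box a b (rowcons (t, v)).
  by move=> tI Bv; apply/rowcons_box.
have aE : a = rowcons (a ord0 ord0, a') by rewrite -[LHS]rowunconsK.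
have Ba' : box a' b' a' by move=> k; rewrite !mxE ab lexx lerDl ltW.
have lS (J : {set 'I_m}) : ord0 \notin imset (lift ord0) (mem J).
  by apply/imsetP => -[k _ /eqP]; rewrite (negbTE (neq_lift _ _)).
have lSk (J : {set 'I_m}) k : k \notin J -> lift ord0 k \notin imset (lift ord0) (mem J).
  by move=> kS; rewrite mem_imset //; exact: lift_inj.
have cS (J : {set 'I_m}) : #|imset (lift ord0) (mem J)| = #|J|.
  by rewrite card_imset //; exact: lift_inj.
pose w (J : {set 'I_m}) := r^-1 ^+ (m - #|J|).
have w0 J : 0 <= w J by rewrite exprn_ge0 // invr_ge0 ltW.
have ri0 : 0 <= r^-1 by rewrite invr_ge0 ltW.
pose g x := \sum_(J <- subset_list m) w J * `|F (imset (lift ord0) (mem J)) x|.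
pose h x := \sum_(J <- subset_list m) w J * `|F (ord0 |: imset (lift ord0) (mem J)) x|.
have gh x : \sum_(J <- subset_list m.+1) r^-1 ^+ (m.+1 - #|J|) * `|F J x| = r^-1 * g x + h x.
  rewrite /= big_cat !big_map /= /g mulr_sumr; congr (_ + _).
    apply: eq_bigr => J _; rewrite cS subSn ?exprS ?mulrA //.
    by rewrite -[leqRHS]card_ord max_card.
  by apply: eq_bigr => J _; rewrite cardsU1 lS cS subSS.
have cg : {within box a b, continuous g}.
  apply: within_continuous_sum => J _.
  by apply: within_continuousM; [exact: within_continuous_cst|exact/within_continuous_norm/cF].
have ch : {within box a b, continuous h}.
  apply: within_continuous_sum => J _.
  by apply: within_continuousM; [exact: within_continuous_cst|exact/within_continuous_norm/cF].
have cgh : {within box a b, continuous (fun x => r^-1 * g x + h x)}.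
  apply: within_continuousD => //.
  by apply: within_continuousM => //; exact: within_continuous_cst.
have g0 x : 0 <= g x by rewrite sumr_ge0 // => J _; rewrite mulr_ge0.
have h0 x : 0 <= h x by rewrite sumr_ge0 // => J _; rewrite mulr_ge0.
under eq_integral do rewrite gh.
have [-> _] := rowcons_fubini cgh; rewrite -/a' -/b'.
have cl v (f : 'rV[R]_m.+1 -> R) : box a' b' v -> {within box a b, continuous f} ->
   {within `[a ord0 ord0, b ord0 ord0], continuous (fun t => f (rowcons (t, v)))}.
  move=> Bv cf; apply: (@within_continuous_comp _ _ _ (box a b)) cf; first exact: rowcons_continuous_l.
  by move=> t; rewrite /= in_itv => tI; exact: vI.
have cr t (f : 'rV[R]_m.+1 -> R) : a ord0 ord0 <= t <= b ord0 ord0 ->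
   {within box a b, continuous f} ->
   {within box a' b', continuous (fun v => f (rowcons (t, v)))}.
  move=> tI cf; apply: (@within_continuous_comp _ _ _ (box a b)) cf; first exact: rowcons_continuous_r.
  by move=> v; exact: vI.
have E1 := @interval_sup_le (fun t => F finset.set0 (rowcons (t, a')))
  (fun t => F [set ord0]%SET (rowcons (t, a'))) (a ord0 ord0) r r0.
rewrite {1}aE; apply: le_trans (E1 _ _ _) _; rewrite -?ab.
- exact: cl.
- exact: cl.
- move=> t /andP[t1 t2]; apply: is_derive_rowcons_l.
  rewrite -[[set ord0]%SET]finset.setU0; apply: dF; first by rewrite finset.in_set0.
    by apply: vI => //; rewrite (ltW t1) (ltW t2).
  by rewrite rowcons0 t1 t2.
have IHg t : a ord0 ord0 <= t <= b ord0 ord0 -> (`|F finset.set0 (rowcons (t, a'))|%:E <=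
     \int[row_measure m]_(v in box a' b') (g (rowcons (t, v)))%:E)%E.
  move=> tI; have := IH a' b' (fun J v => F (imset (lift ord0) (mem J)) (rowcons (t, v))).
  rewrite imset0; apply.
  - by move=> k; rewrite !mxE ab.
  - by move=> J; exact: cr.
  - move=> J k v kS Bv vk; rewrite imsetU1.
    apply: is_derive_rowcons_r; apply: dF; [exact: lSk|exact: vI|].
    by move: vk; rewrite rowconsS !mxE.
have IHh t : a ord0 ord0 <= t <= b ord0 ord0 -> (`|F [set ord0]%SET (rowcons (t, a'))|%:E <=
     \int[row_measure m]_(v in box a' b') (h (rowcons (t, v)))%:E)%E.
  move=> tI; have := IH a' b' (fun J v => F (ord0 |: imset (lift ord0) (mem J)) (rowcons (t, v))).
  rewrite imset0 finset.setU0; apply.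
  - by move=> k; rewrite !mxE ab.
  - by move=> J; exact: cr.
  - move=> J k v kS Bv vk; rewrite imsetU1 finset.setUCA.
    apply: is_derive_rowcons_r; apply: dF; [|exact: vI|].
      by rewrite in_setU1 negb_or eq_sym neq_lift lSk.
    by move: vk; rewrite rowconsS !mxE.
have cq : {within `[a ord0 ord0, b ord0 ord0], continuous
    (fun t => r^-1 * `|F finset.set0 (rowcons (t, a'))| + `|F [set ord0]%SET (rowcons (t, a'))|)}.
  apply: within_continuousD; last exact/within_continuous_norm/cl.
  by apply: within_continuousM; [exact: within_continuous_cst|exact/within_continuous_norm/cl].
apply: ge0_le_integral => //.
- by move=> t _; rewrite lee_fin addr_ge0 // mulr_ge0.
- by have /integrableP [] := itv_integrable cq.
- apply: (@measurable_rowcons_integral _ _ a b (fun x => r^-1 * g x + h x)) => // x.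
  by rewrite addr_ge0 // mulr_ge0.
move=> t; rewrite /= in_itv /= => tI.
have mB := @box_measurable R _ a' b'.
have ig := box_integrable (cr t g tI cg).
have ih := box_integrable (cr t h tI ch).
under eq_integral do rewrite EFinD EFinM.
rewrite ge0_integralD //; first last.
- by have /integrableP [] := ih.
- by move=> v _; rewrite lee_fin.
- by apply: measurable_funeM; have /integrableP [] := ig.
- by move=> v _; rewrite -EFinM lee_fin mulr_ge0.
rewrite ge0_integralZl //; first last.
- by move=> v _; rewrite lee_fin.
- by have /integrableP [] := ig.
rewrite EFinD EFinM; apply: leeD; last exact: IHh.
by apply: lee_wpmul2l; [rewrite lee_fin|exact: IHg].
Qed.

End BoxCalculus.

Section BoxIntegral.
Context {R : realType} {n : nat}.
Local Notation V := 'rV[R]_n.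
Implicit Types (a b : V) (f g : V -> R) (D : set V).

Definition bint a b f : R := \int[row_measure n]_(x in box a b) f x.

Lemma bintE a b f : {within box a b, continuous f} ->
  ((bint a b f)%:E = \int[row_measure n]_(x in box a b) (f x)%:E)%E.
Proof.
move=> cf; rewrite /bint /Rintegral fineK //; apply: integrable_fin_num => //.
  exact: box_measurable.
exact: box_integrable.
Qed.

Lemma bintD a b f g : {within box a b, continuous f} -> {within box a b, continuous g} ->
  bint a b (fun x => f x + g x) = bint a b f + bint a b g.
Proof.
by move=> cf cg; apply: RintegralD; [exact: box_measurable|exact: box_integrable|exact: box_integrable].
Qed.

Lemma bintZ a b (c : R) f : {within box a b, continuous f} ->
  bint a b (fun x => c * f x) = c * bint a b f.
Proof. by move=> cf; apply: RintegralZl; [exact: box_measurable|exact: box_integrable]. Qed.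

Lemma bint_ge0 a b f : (forall x, box a b x -> 0 <= f x) -> 0 <= bint a b f.
Proof. by move=> f0; apply: Rintegral_ge0. Qed.

Lemma bint_le a b f g : {within box a b, continuous f} -> {within box a b, continuous g} ->
  (forall x, box a b x -> f x <= g x) -> bint a b f <= bint a b g.
Proof.
move=> cf cg fg; apply: le_Rintegral => //; first exact: box_measurable.
  exact: box_integrable.
exact: box_integrable.
Qed.

Lemma eq_bint a b f g : (forall x, box a b x -> f x = g x) -> bint a b f = bint a b g.
Proof. by move=> fg; apply: eq_Rintegral => x; rewrite inE; exact: fg. Qed.

Lemma bint0 a b : bint a b (fun=> 0) = 0.
Proof. by rewrite /bint Rintegral_cst ?mul0r//; exact: box_measurable. Qed.

Lemma bint_sum (J : Type) (s : seq J) (P : pred J) a b (F : J -> V -> R) :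
  (forall j, P j -> {within box a b, continuous (F j)}) ->
  bint a b (fun x => \sum_(j <- s | P j) F j x) = \sum_(j <- s | P j) bint a b (F j).
Proof.
move=> cF; elim: s => [|j s IH].
  rewrite big_nil; transitivity (bint a b (fun=> 0)); last exact: bint0.
  by apply: eq_bint => x _; rewrite big_nil.
rewrite big_cons; case Pj: (P j).
  rewrite -IH -bintD; first by apply: eq_bint => x _; rewrite big_cons Pj.
    exact: cF.
  exact: within_continuous_sum.
by rewrite -IH; apply: eq_bint => x _; rewrite big_cons Pj.
Qed.

Lemma bint_subset a b a' b' f : box a' b' `<=` box a b -> {within box a b, continuous f} ->
  (forall x, box a b x -> 0 <= f x) -> bint a' b' f <= bint a b f.
Proof.
move=> s cf f0; rewrite -lee_fin !bintE //; last exact: continuous_subspaceW cf.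
apply: ge0_subset_integral => //.
- exact: box_measurable.
- exact: box_measurable.
- by apply/measurable_EFinP; exact: box_measurable_fun.
Qed.

Lemma bint_cst a b (c : R) : (forall k, a ord0 k <= b ord0 k) ->
  bint a b (fun=> c) = c * \prod_k (b ord0 k - a ord0 k).
Proof.
move=> ab; rewrite /bint Rintegral_cst; last exact: box_measurable.
by congr (c * _); rewrite -[RHS]/(fine (_ %:E)); congr fine; exact: row_measure_box.
Qed.

Lemma smooth_on_box D f a b : box a b `<=` D -> smooth_on D f ->
  {within box a b, continuous f}.
Proof. by move=> s /smooth_on_continuous; exact: continuous_subspaceW. Qed.

End BoxIntegral.

Ltac smooth := repeat first
  [ assumption | exact: smooth_on_cst | exact: smooth_on_coord
  | apply: smooth_onD | apply: smooth_onN | apply: smooth_onB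
  | apply: smooth_onM
  | apply: smooth_on_bigsum => ? _
  | match goal with H : forall _, smooth_on _ _ |- _ => exact: H end
  | match goal with H : forall _ _, smooth_on _ _ |- _ => exact: H end
  | (apply: smooth_on_rpartial; [assumption|]) ].

(** * Caccioppoli and rescaled elliptic estimates *)

Section HalfBox.
Context {R : realType} {n : nat}.
Local Notation V := 'rV[R]_n.
Implicit Types (x z : V) (f g : V -> R) (D : set V) (s : R).

Definition hbox_lo x s : V :=
  \row_k (if (k : nat) == 0%N then Num.max 0 (x ord0 k - s) else x ord0 k - s).
Definition hbox_hi x s : V := \row_k (x ord0 k + s).
Definition hbox x s : set V := box (hbox_lo x s) (hbox_hi x s).
Definition hint x s f : R := bint (hbox_lo x s) (hbox_hi x s) f.

Lemma hboxP x s y : hbox x s y <->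
  half_space y /\ forall k, `|y ord0 k - x ord0 k| <= s.
Proof.
split=> [H|[Hy H] k].
  split=> [k k0|k]; have := H k; rewrite !mxE.
    by rewrite k0 eqxx ge_max => /andP[/andP[]].
  rewrite ler_distl; case: ifP => _ //.
  by rewrite ge_max => /andP[/andP[_ ->] ->].
rewrite !mxE; have := H k; rewrite ler_distl => /andP[h1 h2]; rewrite h2 andbT.
by case: eqP => [/Hy y0|_]; rewrite ?ge_max ?y0.
Qed.

Lemma hbox_subset x s s' : s <= s' -> hbox x s `<=` hbox x s'.
Proof.
move=> ss y /hboxP [Hy H]; apply/hboxP; split=> // k.
exact: le_trans (H k) ss.
Qed.

Lemma hint_subset D x s s' f : s <= s' -> hbox x s' `<=` D -> smooth_on D f ->
  (forall y, hbox x s' y -> 0 <= f y) -> hint x s f <= hint x s' f.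
Proof.
move=> ss sD sf f0; apply: bint_subset => //; first exact: hbox_subset.
exact: smooth_on_box sf.
Qed.

Lemma hintD D x s f g : hbox x s `<=` D -> smooth_on D f -> smooth_on D g ->
  hint x s (fun x => f x + g x) = hint x s f + hint x s g.
Proof. by move=> sD sf sg; apply: bintD; apply: smooth_on_box; eauto. Qed.

Lemma hintZ D x s (c : R) f : hbox x s `<=` D -> smooth_on D f ->
  hint x s (fun x => c * f x) = c * hint x s f.
Proof. by move=> sD sf; apply: bintZ; apply: smooth_on_box; eauto. Qed.

Lemma hint_sum D (J : Type) (r : seq J) (P : pred J) x s (F : J -> V -> R) :
  hbox x s `<=` D -> (forall j, P j -> smooth_on D (F j)) ->
  hint x s (fun x => \sum_(j <- r | P j) F j x) = \sum_(j <- r | P j) hint x s (F j).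
Proof. by move=> sD sF; apply: bint_sum => j Pj; apply: smooth_on_box; eauto. Qed.

Lemma hint_le D x s f g : hbox x s `<=` D -> smooth_on D f -> smooth_on D g ->
  (forall y, hbox x s y -> f y <= g y) -> hint x s f <= hint x s g.
Proof. by move=> sD sf sg; apply: bint_le; apply: smooth_on_box; eauto. Qed.

Lemma hint_ibp D x s k f : relopen D -> half_space x -> 0 < s -> hbox x s `<=` D ->
  smooth_on D f ->
  (forall y, hbox x s y -> `|y ord0 k - x ord0 k| = s \/ half_space_boundary y -> f y = 0) ->
  hint x s (rpartial k f) = 0.
Proof.
move=> rD Hx s0 sD sf f0.
have sf' := smooth_on_rpartial k rD sf.
rewrite /hint -[LHS]/(fine (_)%:E) bintE; last exact: smooth_on_box sf'.
rewrite -[RHS]/(fine 0%E); congr fine; apply: (@box_ibp _ _ _ _ k f).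
- rewrite !mxE; case: eqP => [/Hx x0|_]; last by rewrite ltrD2l gtrN.
  by rewrite gt_max ltr_wpDl //= ltrD2l gtrN.
- exact: smooth_on_box sf.
- exact: smooth_on_box sf'.
- move=> y By; rewrite !mxE => /andP[h1 h2]; apply: (is_derive_rpartial rD) => //; first exact: sD.
  move: h1; rewrite /tangent_interior; case: eqP => [_|k0 _]; last by left.
  by rewrite gt_max => /andP[]; right.
- move=> y By; rewrite !mxE => -[|] yk; apply: f0 => //.
    move: yk; case: eqP => [k0|_] yk; last by left; rewrite yk addrAC subrr add0r normrN gtr0_norm.
    have [Hy _] := (hboxP _ _ _).1 By.
    move: yk; rewrite /Num.max; case: ifP => _ yk.
      by left; rewrite yk addrAC subrr add0r normrN gtr0_norm.
    by right; split=> //; exists k.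
  by left; rewrite yk addrAC subrr add0r gtr0_norm.
Qed.

Definition bump_poly x s (y : V) : R := \prod_k (1 - (s^-1 * (y ord0 k - x ord0 k)) ^+ 2).

Lemma smooth_on_bump_factor D x s k :
  smooth_on D (fun y : V => 1 - (s^-1 * (y ord0 k - x ord0 k)) ^+ 2).
Proof.
apply: (@eq_smooth_on _ _ _ (fun y : V => 1 - (s^-1 * (y ord0 k - x ord0 k)) *
  (s^-1 * (y ord0 k - x ord0 k)))) => [y _|]; first by rewrite expr2.
by smooth.
Qed.

Lemma smooth_on_bump_poly D x s : smooth_on D (bump_poly x s).
Proof. by apply: smooth_on_bigprod => k _; exact: smooth_on_bump_factor. Qed.

Lemma rpartial_const_line D f k y : relopen D -> D y ->
  (forall h, f (y + h *: basis_vec k) = f y) -> rpartial k f y = 0.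
Proof.
move=> [Q [_ DE]] Dy fc; rewrite /rpartial.
have Hy : half_space y by move: Dy; rewrite DE => -[].
have := rpartial_proper k Hy; set G := within _ _ => PG.
rewrite (_ : (fun h : R => _) = cst 0); first exact: lim_cst.
by apply/funext => h; rewrite fc subrr mulr0.
Qed.

Lemma bump_factor_bounds x s y k : 0 < s -> hbox x s y ->
  0 <= 1 - (s^-1 * (y ord0 k - x ord0 k)) ^+ 2 <= 1.
Proof.
move=> s0 /hboxP [_ /(_ k) H]; rewrite gerBl sqr_ge0 andbT subr_ge0.
rewrite -real_normK ?num_real// exprn_ile1 // normrM ger0_norm ?invr_ge0 ?(ltW s0)//.
by rewrite mulrC ler_pdivrMr // mul1r.
Qed.

Lemma bump_poly_bounds x s y : 0 < s -> hbox x s y -> 0 <= bump_poly x s y <= 1.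
Proof.
move=> s0 By; rewrite /bump_poly prodr_ge0 => [|k _]; last first.
  by have /andP[] := bump_factor_bounds k s0 By.
by rewrite prodr_ile1 // => k _; exact: bump_factor_bounds.
Qed.

Lemma bump_poly_lower x s t y : 0 < t < 1 -> 0 < s -> hbox x (t * s) y ->
  (1 - t ^+ 2) ^+ n <= bump_poly x s y.
Proof.
move=> /andP[t0 t1] s0 /hboxP [_ H].
rewrite -[n in X in X <= _]card_ord -prodr_const; apply: ler_prod => k _.
rewrite subr_ge0 exprn_ile1 ?(ltW t0) ?(ltW t1)//= lerB // -real_normK ?num_real//.
rewrite ler_pXn2r ?nnegrE ?(ltW t0)// normrM ger0_norm ?invr_ge0 ?(ltW s0)//.
by rewrite mulrC ler_pdivrMr.
Qed.

Lemma bump_poly_face x s (y : V) k : 0 < s -> `|y ord0 k - x ord0 k| = s -> bump_poly x s y = 0.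
Proof.
move=> s0 yk; rewrite /bump_poly (bigD1 k) //= -real_normK ?num_real// normrM yk.
by rewrite ger0_norm ?invr_ge0 ?(ltW s0)// mulVf ?gt_eqF// expr1n subrr mul0r.
Qed.

Lemma bump_poly_partial D x s y k : relopen D -> D y -> 0 < s -> hbox x s y ->
  `|rpartial k (bump_poly x s) y| <= 2 / s.
Proof.
move=> rD Dy s0 By.
pose p (l : 'I_n) (y : V) := 1 - (s^-1 * (y ord0 l - x ord0 l)) ^+ 2.
pose q (y : V) := \prod_(l | l != k) p l y.
have sp l : smooth_on D (p l) by exact: smooth_on_bump_factor.
have sq : smooth_on D q by apply: smooth_on_bigprod => l _.
have -> : bump_poly x s = fun y => p k y * q y.
  by apply/funext => u; rewrite /bump_poly (bigD1 k).
rewrite (rpartialM k rD Dy (sp k) sq).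
rewrite [rpartial k q y](rpartial_const_line rD Dy) ?mulr0 ?addr0; last first.
  move=> h; apply: eq_bigr => l lk; rewrite /p !mxE eqxx /= (negbTE lk).
  by rewrite mulr0 addr0.
have -> : rpartial k (p k) y = - (2 * (s^-1 * (s^-1 * (y ord0 k - x ord0 k)))).
  pose c (y : V) := s^-1 * (y ord0 k - x ord0 k).
  have sc : smooth_on D c by rewrite /c; smooth.
  have dc : rpartial k c y = s^-1.
    rewrite (rpartialM k rD Dy); [|by smooth|by smooth].
    rewrite (rpartial_cst _ k rD Dy) mul0r add0r.
    rewrite (rpartialD k rD Dy); [|by smooth|by smooth].
    by rewrite (rpartial_coord k k rD Dy) eqxx (rpartial_cst _ k rD Dy) addr0 mulr1.
  have -> : p k = fun y => 1 - c y * c y.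
    by apply/funext => u; rewrite /p /c expr2.
  rewrite (rpartialD k rD Dy); [|by smooth|by smooth].
  rewrite (rpartial_cst _ k rD Dy) add0r (rpartialN k rD Dy); last by smooth.
  by rewrite (rpartialM k rD Dy sc sc) dc /c; ring.
have /andP[q0 q1] : 0 <= q y <= 1.
  rewrite /q prodr_ge0 ?prodr_ile1 // => l _; first exact: bump_factor_bounds.
  by have /andP[] := bump_factor_bounds l s0 By.
rewrite normrM normrN ger0_norm // -[leRHS]mulr1; apply: ler_pM => //.
have si0 : 0 < s^-1 by rewrite invr_gt0.
rewrite !normrM (gtr0_norm si0) (gtr0_norm (ltr0Sn R 1)) ler_pM2l // -[leRHS]mulr1 ler_pM2l //.
by have [_ /(_ k)] := (hboxP _ _ _).1 By; rewrite mulrC ler_pdivrMr // mul1r.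
Qed.

End HalfBox.

Section Caccioppoli.
Context {R : realType} {n : nat}.
Local Notation V := 'rV[R]_n.

Lemma young (e a b : R) : 0 < e -> `|a * b| <= e * a ^+ 2 + (4 * e)^-1 * b ^+ 2.
Proof.
move=> e0; rewrite ler_norml; apply/andP; split.
  rewrite -subr_ge0 (_ : _ - _ = e * (a + (2 * e)^-1 * b) ^+ 2).
    by rewrite mulr_ge0 ?sqr_ge0// ltW.
  by field; rewrite gt_eqF.
rewrite -subr_ge0 (_ : _ - _ = e * (a - (2 * e)^-1 * b) ^+ 2).
  by rewrite mulr_ge0 ?sqr_ge0// ltW.
by field; rewrite gt_eqF.
Qed.

Definition energy_cross (L th : R) : R := n%:R * L ^+ 2 * (n.+1%:R / th).
Definition energy_const (L th : R) : R :=
  (energy_cross L th + 1) * (16 * n%:R) + (1 + 1 / th) + 1.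

Lemma energy_cross_ge0 (L th : R) : 0 < th -> 0 <= energy_cross L th.
Proof.
move=> th0; apply: mulr_ge0; last by rewrite divr_ge0 // ltW.
by apply: mulr_ge0 => //; exact: sqr_ge0.
Qed.

(* The pointwise inequality behind the energy estimate: [g] stands for
   [eta * grad v] and [e] for [2 * v * grad eta]. *)
Lemma energy_pointwise (A : 'I_n -> 'I_n -> R) (e g H : 'I_n -> R) (L th s eta v h : R) :
  0 < th -> 0 < s -> 0 <= eta <= 1 ->
  (forall j k, `|A j k| <= L) ->
  th * (\sum_k g k ^+ 2) <= \sum_j \sum_k A j k * g j * g k ->
  (forall j, e j ^+ 2 <= 16 * (s^-1 ^+ 2 * v ^+ 2)) ->
  th / 2 * (\sum_k g k ^+ 2) <=
  (\sum_j (e j + g j) * (\sum_k A j k * g k - eta * H j) + eta ^+ 2 * v * h) +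
  energy_const L th * (s ^+ 2 * h ^+ 2 + \sum_j H j ^+ 2 + s^-1 ^+ 2 * v ^+ 2).
Proof.
move=> th0 s0 /andP[eta0 eta1] AL ell He.
set G := \sum_k g k ^+ 2 in ell *; set HH := \sum_j H j ^+ 2.
set W := s^-1 ^+ 2 * v ^+ 2 in He *; set E2 := \sum_j e j ^+ 2.
have W0 : 0 <= W by rewrite mulr_ge0 ?sqr_ge0// exprn_ge0 // invr_ge0 ltW.
have G0 : 0 <= G by rewrite sumr_ge0 // => k _; exact: sqr_ge0.
have HH0 : 0 <= HH by rewrite sumr_ge0 // => k _; exact: sqr_ge0.
have E2W : E2 <= 16 * n%:R * W.
  apply: le_trans (ler_sum _ (fun j _ => He j)) _.
  rewrite sumr_const card_ord -[_ *+ n]mulr_natl le_eqVlt; apply/orP; left; apply/eqP; ring.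
pose c := th / (4 * n.+1%:R).
have c0 : 0 < c by rewrite divr_gt0 // mulr_gt0.
have B1 : - \sum_j \sum_k e j * A j k * g k <= th / 4 * G + energy_cross L th * E2.
  have step j k : - (e j * A j k * g k) <= c * g k ^+ 2 + (4 * c)^-1 * (L ^+ 2 * e j ^+ 2).
    apply: le_trans (ler_norm _) _; rewrite normrN mulrC.
    apply: le_trans (young _ _ c0) _; rewrite lerD2l ler_pM2l ?invr_gt0 ?mulr_gt0//.
    rewrite exprMn mulrC ler_wpM2r ?sqr_ge0//.
    have L0 : 0 <= L by apply: le_trans (AL j k).
    by rewrite -real_normK ?num_real// ler_pXn2r ?nnegrE.
  rewrite -sumrN; apply: (@le_trans _ _ (\sum_j (c * G + n%:R * ((4 * c)^-1 * L ^+ 2) * e j ^+ 2))).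
    apply: ler_sum => j _; rewrite -sumrN.
    apply: le_trans (ler_sum _ (fun k _ => step j k)) _.
    rewrite big_split /= -mulr_sumr -/G sumr_const card_ord lerD2l -[_ *+ n]mulr_natl.
    by rewrite !mulrA.
  rewrite big_split /= sumr_const card_ord -[_ *+ n]mulr_natl -mulr_sumr -/E2; apply: lerD.
    have -> : th / 4 * G = n.+1%:R * (c * G) by rewrite /c; field; rewrite nat1r pnatr_eq0.
    by apply: ler_wpM2r; [rewrite mulr_ge0 // ltW|rewrite ler_nat].
  have -> : (4 * c)^-1 = n.+1%:R / th by rewrite /c; field; rewrite nat1r pnatr_eq0 gt_eqF.
  by rewrite /energy_cross -[n%:R * L ^+ 2 * _]mulrA [L ^+ 2 * _]mulrC.
have etaH j : (eta * H j) ^+ 2 <= H j ^+ 2.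
  by rewrite exprMn -[leRHS]mul1r ler_wpM2r ?sqr_ge0// exprn_ile1.
have B2 : \sum_j e j * (eta * H j) <= E2 + HH.
  rewrite -big_split; apply: ler_sum => j _; apply: le_trans (ler_norm _) _.
  apply: le_trans (young _ _ ltr01) _; rewrite mul1r lerD2l.
  have := etaH j; have := sqr_ge0 (eta * H j); set X := _ ^+ 2; set Y := _ ^+ 2; lra.
have B3 : \sum_j g j * (eta * H j) <= th / 4 * G + 1 / th * HH.
  rewrite !mulr_sumr -big_split; apply: ler_sum => j _; apply: le_trans (ler_norm _) _.
  have th4 : 0 < th / 4 by rewrite divr_gt0.
  apply: le_trans (young _ _ th4) _; rewrite lerD2l.
  rewrite (_ : (4 * (th / 4))^-1 = 1 / th); last by field; rewrite gt_eqF.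
  by rewrite ler_wpM2l // divr_ge0 // ltW.
have B4 : - (eta ^+ 2 * v * h) <= s ^+ 2 * h ^+ 2 + W.
  apply: le_trans (ler_norm _) _; rewrite normrN.
  rewrite (_ : eta ^+ 2 * v * h = (eta ^+ 2 * (s * h)) * (s^-1 * v)); last first.
    by field; rewrite gt_eqF.
  apply: le_trans (young _ _ ltr01) _; rewrite mul1r.
  have h1 : (eta ^+ 2 * (s * h)) ^+ 2 <= s ^+ 2 * h ^+ 2.
    by rewrite exprMn -[s ^+ 2 * h ^+ 2]exprMn -[leRHS]mul1r ler_wpM2r ?sqr_ge0// exprn_ile1 ?sqr_ge0// exprn_ile1.
  apply: lerD => //; rewrite exprMn -/W; lra.
have E : \sum_j (e j + g j) * (\sum_k A j k * g k - eta * H j) =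
   \sum_j \sum_k A j k * g j * g k + \sum_j \sum_k e j * A j k * g k
   - \sum_j e j * (eta * H j) - \sum_j g j * (eta * H j).
  rewrite -big_split /= -!sumrB; apply: eq_bigr => j _.
  rewrite mulrBr mulrDl !mulr_sumr mulrDl.
  under [in RHS]eq_bigr do rewrite -mulrA (mulrCA (A j _)).
  under [X in _ = _ + X - _ - _]eq_bigr do rewrite -mulrA.
  by ring.
rewrite E; set S1 := \sum_j \sum_k A j k * g j * g k in ell *.
set T1 := \sum_j \sum_k e j * A j k * g k in B1 *.
set T2 := \sum_j e j * _ in B2 *; set T3 := \sum_j g j * _ in B3 *.
set h2 := s ^+ 2 * h ^+ 2 in B4 *.
have h20 : 0 <= h2 by rewrite mulr_ge0 ?sqr_ge0.
have cr0 := energy_cross_ge0 L th0.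
have t0 : 0 <= 1 / th by rewrite divr_ge0 // ltW.
have K1 : (energy_cross L th + 1) * E2 <= (energy_cross L th + 1) * (16 * n%:R) * W.
  by rewrite -mulrA ler_wpM2l // addr_ge0.
have K0 : 0 <= (energy_cross L th + 1) * (16 * n%:R).
  by apply: mulr_ge0; [exact: addr_ge0 | exact: mulr_ge0].
rewrite /energy_const; set K2 := (energy_cross L th + 1) * (16 * n%:R) in K0 K1 *.
set t := 1 / th in B3 t0 *; set x := energy_cross L th in B1 K1 cr0 *.
have P1 := mulr_ge0 K0 h20; have P2 := mulr_ge0 K0 HH0.
have P3 := mulr_ge0 t0 h20; have P4 := mulr_ge0 t0 W0.
rewrite !mulrDl !mulrDr; rewrite mulrDl in K1.
lra.
Qed.

Lemma caccioppoli (D Z : set V) (A : 'I_n -> 'I_n -> V -> R) (L th t : R) :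
  relopen D -> Z `<=` D -> (forall j k, smooth_on D (A j k)) -> 0 < th -> 0 < t < 1 ->
  (forall x j k, Z x -> `|A j k x| <= L) ->
  (forall x (y : 'I_n -> R), Z x -> th * (\sum_k y k ^+ 2) <= \sum_j \sum_k A j k x * y j * y k) ->
  exists C, 0 < C /\ forall (x : V) (s : R) (v h : V -> R) (H : 'I_n -> V -> R),
    half_space x -> 0 < s -> hbox x s `<=` Z ->
    smooth_on D v -> smooth_on D h -> (forall j, smooth_on D (H j)) ->
    (forall y, D y -> half_space_boundary y -> v y = 0) ->
    (forall y, D y -> \sum_j rpartial j (fun z => \sum_k A j k z * rpartial k v z) y =
       h y + \sum_j rpartial j (H j) y) ->
    hint x (t * s) (fun y => \sum_k rpartial k v y * rpartial k v y) <=
    C * (s ^+ 2 * hint x s (fun y => h y * h y) +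
         \sum_j hint x s (fun y => H j y * H j y) + s^-1 ^+ 2 * hint x s (fun y => v y * v y)).
Proof.
move=> rD ZD sA th0 t01 AL ell.
have [t0 t1] := andP t01.
pose c := (1 - t ^+ 2) ^+ n.
have c0 : 0 < c by rewrite exprn_gt0 // subr_gt0 expr_lt1 // ltW.
have th20 : 0 < th / 2 by rewrite divr_gt0.
have Kp : 0 < energy_const L th.
  rewrite /energy_const ltr_wpDl // addr_ge0 //; last by rewrite addr_ge0 // divr_ge0 // ltW.
  apply: mulr_ge0; last by rewrite mulr_ge0.
  by rewrite addr_ge0 // energy_cross_ge0.
pose C := (c ^+ 2)^-1 * ((th / 2)^-1 * energy_const L th).
exists C; split.
  apply: mulr_gt0; first by rewrite invr_gt0 exprn_gt0.
  by apply: mulr_gt0 => //; rewrite invr_gt0.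
move=> x s v h H Hx s0 sZ sv sh sH v0 eqn.
have sD : hbox x s `<=` D by move=> y /sZ /ZD.
pose eta := bump_poly x s.
have seta : smooth_on D eta by exact: smooth_on_bump_poly.
pose B j y := \sum_k A j k y * rpartial k v y - H j y.
have sB j : smooth_on D (B j) by rewrite /B; smooth.
pose Phi j y := eta y * eta y * v y * B j y.
have sPhi j : smooth_on D (Phi j) by rewrite /Phi; smooth.
have I0 j : hint x s (rpartial j (Phi j)) = 0.
  apply: (hint_ibp rD Hx s0 sD (sPhi j)) => y By [yj|yb].
    by rewrite /Phi /eta (bump_poly_face s0 yj) !mul0r.
  by rewrite /Phi v0 ?mulr0 ?mul0r//; exact: sD.
pose E y := \sum_j rpartial j (Phi j) y.
have sE : smooth_on D E by rewrite /E; smooth.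
have IE : hint x s E = 0.
  rewrite /E (@hint_sum _ _ D) //; last by move=> j _; smooth.
  by rewrite big1.
have EE y : D y -> E y = \sum_j (2 * rpartial j eta y * v y + eta y * rpartial j v y) *
     (\sum_k A j k y * (eta y * rpartial k v y) - eta y * H j y) + eta y ^+ 2 * v y * h y.
  move=> Dy.
  have P j : rpartial j (Phi j) y =
     (2 * rpartial j eta y * v y + eta y * rpartial j v y) * (eta y * B j y) +
     eta y ^+ 2 * v y * rpartial j (B j) y.
    rewrite (rpartialM j rD Dy); [|by smooth|exact: sB].
    rewrite (rpartialM j rD Dy); [|by smooth|exact: sv].
    by rewrite (rpartialM j rD Dy seta seta); ring.
  rewrite /E (eq_bigr _ (fun j _ => P j)) big_split /= -mulr_sumr; congr (_ + _).
    apply: eq_bigr => j _; congr (_ * _); rewrite /B mulrBr mulr_sumr; congr (_ - _).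
    by apply: eq_bigr => k _; ring.
  congr (_ * _); rewrite -[RHS](addrK (\sum_j rpartial j (H j) y)) -eqn // -sumrB.
  apply: eq_bigr => j _; rewrite /B (rpartialD j rD Dy); [|by smooth|by smooth].
  by rewrite (rpartialN j rD Dy).
have e_le y j : hbox x s y -> (2 * rpartial j eta y * v y) ^+ 2 <= 16 * (s^-1 ^+ 2 * v y ^+ 2).
  move=> By; have Dy := sD y By.
  have := bump_poly_partial j rD Dy s0 By; rewrite -/eta => He.
  rewrite exprMn mulrA ler_wpM2r ?sqr_ge0// (_ : 16 * s^-1 ^+ 2 = (2 * (2 / s)) ^+ 2).
    by rewrite -real_normK ?num_real// ler_pXn2r ?nnegrE ?mulr_ge0 ?invr_ge0 ?(ltW s0)// normrM gtr0_norm // ler_pM2l.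
  by rewrite !exprMn; ring.
pose G y := \sum_k (eta y * rpartial k v y) * (eta y * rpartial k v y).
have sG : smooth_on D G by rewrite /G; smooth.
pose RH y := s ^+ 2 * (h y * h y) + \sum_j H j y * H j y + s^-1 ^+ 2 * (v y * v y).
have sRH : smooth_on D RH by rewrite /RH; smooth.
have PW y : hbox x s y -> th / 2 * G y <= E y + energy_const L th * RH y.
  move=> By; have Dy := sD y By; rewrite EE //.
  have := @energy_pointwise (fun j k => A j k y) (fun j => 2 * rpartial j eta y * v y)
   (fun k => eta y * rpartial k v y) (fun j => H j y) L th s (eta y) (v y) (h y) th0 s0.
  rewrite (eq_bigr (fun k => (eta y * rpartial k v y) * (eta y * rpartial k v y))); last by [].
  rewrite (_ : \sum_j H j y ^+ 2 = \sum_j H j y * H j y); last by [].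
  apply.
  - exact: bump_poly_bounds.
  - by move=> j k; apply: AL; exact: sZ.
  - by apply: ell; exact: sZ.
  - by move=> j; exact: e_le.
have Int : th / 2 * hint x s G <= energy_const L th * hint x s RH.
  rewrite -(hintZ _ sD) // -(hintZ _ sD) //.
  have := @hint_le _ _ D x s (fun y => th / 2 * G y) (fun y => E y + energy_const L th * RH y).
  rewrite (hintD sD) //; last by smooth.
  by rewrite IE add0r; apply => //; smooth.
have tss : t * s <= s by rewrite ler_piMl ?ltW.
have Low : c ^+ 2 * hint x (t * s) (fun y => \sum_k rpartial k v y * rpartial k v y) <= hint x s G.
  apply: (@le_trans _ _ (hint x (t * s) G)); last first.
    apply: (hint_subset tss sD sG) => y _; rewrite sumr_ge0 // => k _; exact: sqr_ge0.
  have sD' : hbox x (t * s) `<=` D by move=> y /(hbox_subset tss)/sD.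
  rewrite -(hintZ _ sD'); last by smooth.
  apply: (hint_le sD'); [by smooth|by []|] => y By.
  rewrite mulr_sumr; apply: ler_sum => k _.
  rewrite [leRHS]mulrACA; apply: ler_wpM2r; first exact: sqr_ge0.
  have := bump_poly_lower t01 s0 By; rewrite -/eta -/c => ce.
  by rewrite expr2; apply: ler_pM => //; exact: ltW.
have -> : s ^+ 2 * hint x s (fun y => h y * h y) + \sum_j hint x s (fun y => H j y * H j y) +
   s^-1 ^+ 2 * hint x s (fun y => v y * v y) = hint x s RH.
  rewrite /RH (hintD sD); [|by smooth|by smooth]; rewrite (hintD sD); [|by smooth|by smooth].
  rewrite (hintZ _ sD); last by smooth.
  rewrite (hintZ _ sD); last by smooth.
  by rewrite (@hint_sum _ _ D) // => j _; smooth.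
apply: (@le_trans _ _ ((c ^+ 2)^-1 * hint x s G)).
  by rewrite (ler_pdivlMl _ _ (exprn_gt0 2 c0)); exact: Low.
rewrite /C -mulrA; apply: ler_wpM2l; first by rewrite invr_ge0 exprn_ge0 // ltW.
by rewrite -mulrA (ler_pdivlMl _ _ th20); exact: Int.
Qed.

End Caccioppoli.

Section RpartialsLinear.
Context {R : realType} {n : nat}.
Local Notation V := 'rV[R]_n.
Implicit Types (D : set V) (f g : V -> R).

Lemma rpartialsD D s f g : relopen D -> smooth_on D f -> smooth_on D g ->
  forall y, D y -> rpartials s (fun z => f z + g z) y = rpartials s f y + rpartials s g y.
Proof.
move=> rD sf sg; elim: s => [//|k s IH] y Dy /=.
rewrite -(rpartialD k rD Dy (smooth_on_rpartials s rD sf) (smooth_on_rpartials s rD sg)).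
apply: (rpartial_eq k rD IH Dy); apply: smooth_on_rpartials => //; exact: smooth_onD.
Qed.

Lemma rpartialsZ D s (c : R) f : relopen D -> smooth_on D f ->
  forall y, D y -> rpartials s (fun z => c * f z) y = c * rpartials s f y.
Proof.
move=> rD sf; elim: s => [//|k s IH] y Dy /=.
rewrite -(rpartialZ c k rD Dy (smooth_on_rpartials s rD sf)).
apply: (rpartial_eq k rD IH Dy); apply: smooth_on_rpartials => //.
by apply: smooth_onM => //; exact: smooth_on_cst.
Qed.

Lemma rpartialsN D s f : relopen D -> smooth_on D f ->
  forall y, D y -> rpartials s (fun z => - f z) y = - rpartials s f y.
Proof.
move=> rD sf y Dy; rewrite -mulN1r -(rpartialsZ _ _ rD sf Dy).
by congr (rpartials s _ y); apply/funext => z; rewrite mulN1r.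
Qed.

Lemma rpartials0 D s : relopen D -> forall y, D y -> rpartials s (fun=> 0) y = 0.
Proof.
move=> rD y Dy.
rewrite -[RHS](mul0r (rpartials s (fun=> 0) y)) -(rpartialsZ s 0 rD (smooth_on_cst 0) Dy).
by congr (rpartials s _ y); apply/funext => z; rewrite mul0r.
Qed.

Lemma rpartials_sum (J : Type) (r : seq J) (P : pred J) D s (F : J -> V -> R) :
  relopen D -> (forall j, P j -> smooth_on D (F j)) -> forall y, D y ->
  rpartials s (fun z => \sum_(j <- r | P j) F j z) y = \sum_(j <- r | P j) rpartials s (F j) y.
Proof.
move=> rD sF y Dy; elim: r => [|j r IH].
  rewrite big_nil -[RHS](rpartials0 s rD Dy); congr (rpartials s _ y).
  by apply/funext => z; rewrite big_nil.
rewrite big_cons; case Pj: (P j).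
  rewrite -IH -(rpartialsD s rD (sF _ Pj) _ Dy); last exact: smooth_on_bigsum.
  by congr (rpartials s _ y); apply/funext => z; rewrite big_cons Pj.
by rewrite -IH; congr (rpartials s _ y); apply/funext => z; rewrite big_cons Pj.
Qed.

End RpartialsLinear.

Lemma bint_sqr_le {R : realType} {n : nat} (a b : 'rV[R]_n) (f : 'rV[R]_n -> R) :
  (forall k, a ord0 k < b ord0 k) -> {within box a b, continuous f} ->
  bint a b f ^+ 2 <= \prod_k (b ord0 k - a ord0 k) * bint a b (fun x => f x * f x).
Proof.
move=> ab cf; set v := \prod_k _; have v0 : 0 < v by rewrite prodr_gt0 // => k _; rewrite subr_gt0.
pose m := bint a b f / v.
have cff : {within box a b, continuous (fun x => f x * f x)} by exact: within_continuousM.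
have cst c : {within box a b, continuous (fun=> c : R)} by exact: within_continuous_cst.
have cm : {within box a b, continuous (fun x => - (2 * m) * f x)} by exact: within_continuousM.
have : 0 <= bint a b (fun x => (f x * f x + - (2 * m) * f x) + m ^+ 2).
  apply: bint_ge0 => x _; rewrite (_ : _ + _ = (f x - m) ^+ 2); first exact: sqr_ge0.
  by ring.
rewrite (bintD (within_continuousD cff cm) (cst _)) (bintD cff cm) (bintZ _ cf) bint_cst -/v => [|k]; last exact: ltW.
have -> : - (2 * m) * bint a b f = - (2 * (bint a b f) ^+ 2 / v) by rewrite /m; field; rewrite gt_eqF.
have -> : m ^+ 2 * v = bint a b f ^+ 2 / v by rewrite /m; field; rewrite gt_eqF.
set X := bint a b f ^+ 2; rewrite -[X <= _]ler_pdivrMl // [v^-1 * X]mulrC -mulrA.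
by move: (X / v) => y; lra.
Qed.

Section OperatorOrder.
Context {R : realType} {n : nat}.
Local Notation V := 'rV[R]_n.
Context (D Z : set V) (A : 'I_n -> 'I_n -> V -> R) (w : V -> R) (L th : R).
Context (rD : relopen D) (ZD : Z `<=` D) (cZ : compact Z).
Context (sA : forall j k, smooth_on D (A j k)) (sw : smooth_on D w).
Context (th0 : 0 < th) (AL : forall x j k, Z x -> `|A j k x| <= L).
Context (ell : forall x (y : 'I_n -> R), Z x ->
  th * (\sum_k y k ^+ 2) <= \sum_j \sum_k A j k x * y j * y k).
Context (A0 : forall x (k : 'I_n), D x -> k = 0%N :> nat -> A k k x != 0).

(* Data of the rescaled estimates: think of [U k] as [(- w^-1 div (A grad))^k U_0],
   with all L^2 norms normalised at the length scale [r]. *)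
Record admissible (x : V) (r : R) (U : nat -> V -> R) : Prop := Admissible {
  adm_half : half_space x;
  adm_gt0 : 0 < r;
  adm_le1 : r <= 1;
  adm_sub : hbox x (2 * r) `<=` Z;
  adm_smooth : forall k, smooth_on D (U k);
  adm_dirichlet : forall k y, D y -> half_space_boundary y -> U k y = 0;
  adm_eq : forall k y, D y ->
    \sum_j rpartial j (fun z => \sum_l A j l z * rpartial l (U k) z) y = - (w y * U k.+1 y);
  adm_norm : forall k, hint x (2 * r) (fun y => U k y * U k y) <= r^-1 ^+ (4 * k)
}.

Definition order_le (p : nat) (g : (nat -> V -> R) -> V -> R) : Prop :=
  (forall U, (forall k, smooth_on D (U k)) -> smooth_on D (g U)) /\
  forall s : R, 0 < s < 2 -> exists2 C : R, 0 <= C &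
    forall x r U, admissible x r U ->
      hint x (s * r) (fun y => g U y * g U y) <= C * r^-1 ^+ (2 * p).

Lemma adm_hbox x r U s : admissible x r U -> 0 < s < 2 -> hbox x (s * r) `<=` Z.
Proof.
move=> ad /andP[s0 s2] y /(@hbox_subset _ _ _ _ (2 * r)); move/(_ _)/(adm_sub ad); apply.
by rewrite ler_pM2r ?(adm_gt0 ad)// ltW.
Qed.

Lemma adm_hboxD x r U s : admissible x r U -> 0 < s < 2 -> hbox x (s * r) `<=` D.
Proof. by move=> ad s2 y /(adm_hbox ad s2)/ZD. Qed.

Lemma adm_invr_ge1 x r U : admissible x r U -> 1 <= r^-1.
Proof. by move=> ad; rewrite invf_ge1 ?(adm_gt0 ad) ?(adm_le1 ad). Qed.

Lemma order_leW p q g : (p <= q)%N -> order_le p g -> order_le q g.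
Proof.
move=> pq [sg Hg]; split=> // s s2; have [C C0 HC] := Hg s s2; exists C => // x r U ad.
apply: le_trans (HC _ _ _ ad) _; apply: ler_wpM2l => //.
by apply: ler_weXn2l; [exact: adm_invr_ge1 ad|rewrite leq_mul2l pq orbT].
Qed.

Lemma eq_order_le p g g' :
  (forall U, (forall k, smooth_on D (U k)) -> forall y, D y -> g U y = g' U y) ->
  order_le p g -> order_le p g'.
Proof.
move=> E [sg Hg]; split=> [U sU|s s2]; first exact: eq_smooth_on (E U sU) (sg U sU).
have [C C0 HC] := Hg s s2; exists C => // x r U ad.
rewrite (_ : hint _ _ _ = hint x (s * r) (fun y => g U y * g U y)); first exact: HC.
apply: eq_bint => y /(adm_hboxD ad s2) Dy; rewrite E //; exact: adm_smooth ad.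
Qed.

Lemma eq_adm_order_le p g g' :
  (forall U, (forall k, smooth_on D (U k)) -> smooth_on D (g' U)) ->
  (forall x r U, admissible x r U -> forall y, D y -> g U y = g' U y) ->
  order_le p g -> order_le p g'.
Proof.
move=> sg' E [sg Hg]; split=> // s s2.
have [C C0 HC] := Hg s s2; exists C => // x r U ad.
rewrite (_ : hint _ _ _ = hint x (s * r) (fun y => g U y * g U y)); first exact: HC.
by apply: eq_bint => y /(adm_hboxD ad s2) Dy; rewrite (E _ _ _ ad).
Qed.

Lemma order_le0 p : order_le p (fun _ _ => 0).
Proof.
split=> [U _|s s2]; first exact: smooth_on_cst.
exists 0 => // x r U ad; rewrite [leRHS]mul0r /hint (@eq_bint _ _ _ _ _ (fun=> 0)).
  by rewrite bint0.
by move=> y _; rewrite mul0r.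
Qed.

Lemma order_leD p g h : order_le p g -> order_le p h -> order_le p (fun U y => g U y + h U y).
Proof.
move=> [sg Hg] [sh Hh]; split=> [U sU|s s2]; first by apply: smooth_onD; eauto.
have [C C0 HC] := Hg s s2; have [C' C'0 HC'] := Hh s s2.
exists (2 * C + 2 * C'); first by rewrite addr_ge0 // mulr_ge0.
move=> x r U ad; have sD := adm_hboxD ad s2.
have {}sg := sg U (adm_smooth ad); have {}sh := sh U (adm_smooth ad).
apply: (@le_trans _ _ (hint x (s * r)
   (fun y => 2 * (g U y * g U y) + 2 * (h U y * h U y)))).
  apply: (hint_le sD); [by smooth|by smooth|move=> y _].
  rewrite -subr_ge0 (_ : _ - _ = (g U y - h U y) ^+ 2); first exact: sqr_ge0.
  by ring.
rewrite (hintD sD); [|by smooth|by smooth].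
rewrite (hintZ _ sD); last by smooth.
rewrite (hintZ _ sD); last by smooth.
by rewrite [leRHS]mulrDl -!mulrA; apply: lerD; apply: ler_wpM2l => //; [exact: HC|exact: HC'].
Qed.

Lemma order_le_sum (J : Type) (s : seq J) (P : pred J) p g :
  (forall j, P j -> order_le p (g j)) ->
  order_le p (fun U y => \sum_(j <- s | P j) g j U y).
Proof.
move=> Hg; elim: s => [|j s IH].
  by apply: eq_order_le (order_le0 p) => U _ y _; rewrite big_nil.
case Pj: (P j); last by apply: eq_order_le IH => U _ y _; rewrite big_cons Pj.
apply: eq_order_le (order_leD (Hg j Pj) IH) => U _ y _; by rewrite big_cons Pj.
Qed.

Lemma smooth_bounded c : smooth_on D c -> exists B, 0 < B /\ forall y, Z y -> `|c y| <= B.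
Proof.
move=> sc; apply: (continuous_compact_bounded cZ).
exact: (continuous_subspaceW ZD (smooth_on_continuous sc)).
Qed.

Lemma order_leM p c g : smooth_on D c -> order_le p g -> order_le p (fun U y => c y * g U y).
Proof.
move=> sc [sg Hg]; split=> [U sU|s s2]; first by apply: smooth_onM; eauto.
have [C C0 HC] := Hg s s2; have [B [B0 HB]] := smooth_bounded sc.
exists (B ^+ 2 * C); first by rewrite mulr_ge0 // sqr_ge0.
move=> x r U ad; have sD := adm_hboxD ad s2; have {}sg := sg U (adm_smooth ad).
apply: (@le_trans _ _ (B ^+ 2 * hint x (s * r) (fun y => g U y * g U y))).
  rewrite -(hintZ _ sD); last by smooth.
  apply: (hint_le sD); [by smooth|by smooth|move=> y By].
  rewrite mulrACA; apply: ler_wpM2r; first exact: sqr_ge0.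
  rewrite -expr2 -[leLHS]real_normK ?num_real// ler_pXn2r ?nnegrE// ?(ltW B0)//.
  exact/HB/(adm_hbox ad s2).
by rewrite -[leRHS]mulrA; apply: ler_wpM2l; [exact: sqr_ge0|exact: HC].
Qed.

Lemma order_leN p g : order_le p g -> order_le p (fun U y => - g U y).
Proof.
move=> Hg; apply: eq_order_le (order_leM (smooth_on_cst (-1)) Hg) => U _ y _.
by rewrite mulN1r.
Qed.

Lemma order_le_leibniz t c q g : smooth_on D c ->
  (forall t', subseq t' t -> order_le (q + size t') (fun U => rpartials t' (g U))) ->
  order_le (q + size t) (fun U => rpartials t (fun y => c y * g U y)).
Proof.
elim/last_ind: t c q g => [|t l IH] c q g sc Hg.
  by apply: order_leM => //; exact: (Hg [::]).
have sg : forall U, (forall k, smooth_on D (U k)) -> smooth_on D (g U).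
  by have [] := Hg [::] (sub0seq _).
rewrite size_rcons addnS.
apply: (@eq_order_le _ (fun U y => rpartials t (fun y => rpartial l c y * g U y) y +
    rpartials t (fun y => c y * rpartial l (g U) y) y)).
  move=> U sU y Dy; have sgU := sg U sU; rewrite rpartials_rcons -(rpartialsD _ rD _ _ Dy); [|by smooth|by smooth].
  apply: (@rpartials_eq _ _ D) => //; first by smooth.
  by move=> z Dz; rewrite (rpartialM l rD Dz).
apply: order_leD.
  apply: (order_leW (leqnSn _)); apply: IH => [|t' st']; first by smooth.
  by apply: Hg; exact: subseq_trans st' (subseq_rcons _ _).
rewrite -addSn; apply: IH => // t' st'.
have := Hg (rcons t' l); rewrite size_rcons addnS addSn => H.
apply: eq_order_le (H _) => [U _ y _|]; first by rewrite rpartials_rcons.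
by rewrite -!cats1 cat_subseq.
Qed.

Lemma order_le_commutator t c q g : smooth_on D c ->
  (forall U, (forall k, smooth_on D (U k)) -> smooth_on D (g U)) ->
  (forall t', subseq t' t -> (size t' < size t)%N ->
     order_le (q + size t') (fun U => rpartials t' (g U))) ->
  order_le (q + (size t).-1) (fun U y =>
     rpartials t (fun y => c y * g U y) y - c y * rpartials t (g U) y).
Proof.
elim/last_ind: t c q g => [|t l IH] c q g sc sg Hg.
  by apply: eq_order_le (order_le0 _) => U _ y _; rewrite subrr.
rewrite size_rcons in Hg *.
apply: (@eq_order_le _ (fun U y => rpartials t (fun y => rpartial l c y * g U y) y +
    (rpartials t (fun y => c y * rpartial l (g U) y) y -
     c y * rpartials t (rpartial l (g U)) y))).
  move=> U sU y Dy; have sgU := sg U sU; rewrite !rpartials_rcons addrA -(rpartialsD _ rD _ _ Dy); [|by smooth|by smooth].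
  congr (_ - _); apply: (@rpartials_eq _ _ D) => //; first by smooth.
  by move=> z Dz; rewrite (rpartialM l rD Dz).
apply: order_leD.
  apply: order_le_leibniz => [|t' st']; first by smooth.
  by apply: Hg; [exact: subseq_trans st' (subseq_rcons _ _)|rewrite ltnS size_subseq].
have [t0|t0] := eqVneq t [::].
  by rewrite t0; apply: eq_order_le (order_le0 _) => U _ y _; rewrite subrr.
have -> : (q + (size t).+1.-1 = q.+1 + (size t).-1)%N.
  by move: t0; case: (t) => //= a s _; rewrite addnS addSn.
apply: IH => // [U sU|t' st' ts]; first by apply: smooth_on_rpartial => //; exact: sg.
have := Hg (rcons t' l); rewrite size_rcons addnS addSn => H.
apply: eq_order_le (H _ _) => [U _ y _||]; first by rewrite rpartials_rcons.
- by rewrite -!cats1 cat_subseq.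
- by [].
Qed.

Definition tangential (t : seq 'I_n) := all (fun k : 'I_n => k != 0%N :> nat) t.

Lemma order_le_base k : order_le (2 * k) (fun U => U k).
Proof.
split=> [U sU|s s2]; first exact: sU.
exists 1 => // x r U ad; rewrite mul1r mulnA.
apply: le_trans (adm_norm ad k); apply: (@hint_subset _ _ D).
- by rewrite ler_pM2r ?(adm_gt0 ad)//; case/andP: s2 => _ /ltW.
- by move=> y /(adm_sub ad)/ZD.
- by apply: smooth_onM; exact: adm_smooth ad k.
- by move=> y _; exact: sqr_ge0.
Qed.

Definition div_commutator (t : seq 'I_n) (k : nat) (j : 'I_n) (U : nat -> V -> R) (y : V) :=
  \sum_l (rpartials t (fun z => A j l z * rpartial l (U k) z) y
          - A j l y * rpartials t (rpartial l (U k)) y).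

Lemma smooth_on_div_commutator t k j U : (forall k, smooth_on D (U k)) ->
  smooth_on D (div_commutator t k j U).
Proof.
move=> sU; apply: smooth_on_bigsum => l _; apply: smooth_onB.
  by apply: (smooth_on_rpartials _ rD); smooth.
by apply: smooth_onM => //; apply: (smooth_on_rpartials _ rD); smooth.
Qed.

Lemma differentiated_equation t k x r U : admissible x r U -> forall y, D y ->
  \sum_j rpartial j (fun z => \sum_l A j l z * rpartial l (rpartials t (U k)) z) y =
  - rpartials t (fun z => w z * U k.+1 z) y +
  \sum_j rpartial j (fun z => - div_commutator t k j U z) y.
Proof.
move=> ad y Dy; have sU := adm_smooth ad.
have sv := smooth_on_rpartials t rD (sU k).
have sK j : smooth_on D (div_commutator t k j U) by exact: smooth_on_div_commutator.
have sF j : smooth_on D (fun z => \sum_l A j l z * rpartial l (U k) z) by smooth.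
apply/eqP; rewrite -subr_eq -sumrB; apply/eqP.
transitivity (\sum_j rpartial j (rpartials t (fun z => \sum_l A j l z * rpartial l (U k) z)) y).
  apply: eq_bigr => j _; rewrite (rpartialN j rD Dy) // opprK.
  rewrite -(rpartialD j rD Dy); [|by smooth|exact: sK].
  apply: (rpartial_eq j rD _ Dy) => [z Dz|]; last by apply: smooth_onD; [smooth|exact: sK].
  rewrite /div_commutator -big_split /= (rpartials_sum _ _ rD _ Dz); last by move=> *; smooth.
  apply: eq_bigr => l _; rewrite -(rpartial_rpartials _ _ rD (sU k) Dz); ring.
rewrite -(rpartialsN t rD _ Dy); last by smooth.
transitivity (rpartials t (fun z => \sum_j rpartial j (fun z => \sum_l A j l z * rpartial l (U k) z) z) y).
  rewrite (rpartials_sum _ _ rD _ Dy); last by move=> j _; smooth.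
  by apply: eq_bigr => j _; exact: (rpartial_rpartials j t rD (sF j) Dy).
apply: (rpartials_eq t rD _ _ Dy); first by smooth.
by move=> z Dz; rewrite (adm_eq ad k Dz).
Qed.

Lemma tangential_dirichlet t k x r U : admissible x r U -> tangential t ->
  forall y, D y -> half_space_boundary y -> rpartials t (U k) y = 0.
Proof.
move=> ad; elim: t => [_|l t IH /andP[l0 tt]] y Dy yb /=; first exact: adm_dirichlet ad k y Dy yb.
apply: (rpartial_tangent0 rD Dy _ l0 _ yb); last exact: IH.
exact: (smooth_on_rpartials _ rD (adm_smooth ad k)).
Qed.

Lemma order_le_tangential m k t l : tangential t -> size t = m ->
  order_le (2 * k + m).+1 (fun U => rpartial l (rpartials t (U k))).
Proof.
elim/ltn_ind: m k t l => m IH k t l tt st.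
have Hv k' t' : tangential t' -> (size t' <= m)%N ->
    order_le (2 * k' + size t') (fun U => rpartials t' (U k')).
  case: t' => [|l' t'] /=; first by rewrite addn0 => _ _; exact: order_le_base.
  by move=> /andP[_ tt'] st'; rewrite addnS; exact: (IH (size t')).
have Hdv k' t' l' : tangential t' -> (size t' < m)%N ->
    order_le ((2 * k').+1 + size t') (fun U => rpartials t' (rpartial l' (U k'))).
  move=> tt' st'; apply: eq_order_le (IH _ st' k' t' l' tt' erefl) => U sU y Dy.
  exact: (rpartial_rpartials l' t' rD (sU k') Dy).
have tsub t' : subseq t' t -> tangential t'.
  by move=> st'; apply/allP => z /(mem_subseq st') zt; exact: (allP tt).
have HK j : order_le (2 * k + m) (div_commutator t k j).
  apply: order_le_sum => l' _.
  have [t0|t0] := eqVneq t [::].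
    by apply: eq_order_le (order_le0 _) => U _ y _; rewrite t0 subrr.
  have -> : (2 * k + m = (2 * k).+1 + (size t).-1)%N.
    by rewrite -st; move: t0; case: (t) => //= a s _; rewrite addnS addSn.
  apply: order_le_commutator => [//|U sU|t' st' tm]; first by smooth.
  by apply: Hdv; [exact: tsub|rewrite -st].
have Hh : order_le (2 * k.+1 + m) (fun U y => - rpartials t (fun z => w z * U k.+1 z) y).
  rewrite -st; apply: order_leN; apply: order_le_leibniz => // t' st'.
  by apply: Hv; [exact: tsub|rewrite -st size_subseq].
have {Hv} Hv := Hv k t tt; rewrite st leqnn in Hv.
have {}Hv := Hv isT.
split=> [U sU|s s2]; first exact: (smooth_on_rpartial l rD (smooth_on_rpartials t rD (sU k))).
have /andP[s0 s2'] := s2.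
pose s' := (s + 2) / 2.
have s'2 : 0 < s' < 2 by rewrite /s'; lra.
have s'1 : 1 <= s' by rewrite /s'; lra.
have s'0 : 0 < s' by case/andP: s'2.
have ss' : 0 < s / s' < 1 by rewrite divr_gt0 //= ltr_pdivrMr // mul1r /s'; lra.
have [Cc [Cc0 HC]] := caccioppoli rD ZD sA th0 ss' AL ell.
have [Ch Ch0 {}Hh] := Hh.2 _ s'2.
have [Cv Cv0 {}Hv] := Hv.2 _ s'2.
have : forall j, exists Cj : R, 0 <= Cj /\ forall x r U, admissible x r U ->
    hint x (s' * r) (fun y => div_commutator t k j U y * div_commutator t k j U y)
      <= Cj * r^-1 ^+ (2 * (2 * k + m)).
  by move=> j; have [Cj Cj0 Hj] := (HK j).2 _ s'2; exists Cj.
move=> /choice [CK HCK].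
exists (Cc * (s' ^+ 2 * Ch + \sum_j CK j + s'^-1 ^+ 2 * Cv)).
  apply: mulr_ge0; first exact: ltW.
  apply: addr_ge0; last by apply: mulr_ge0 => //; exact: sqr_ge0.
  apply: addr_ge0; first by apply: mulr_ge0 => //; exact: sqr_ge0.
  by apply: sumr_ge0 => j _; exact: (HCK j).1.
move=> x r U ad; have r0 := adm_gt0 ad; have sU := adm_smooth ad.
have sD := adm_hboxD ad s2; have sZ' := adm_hbox ad s'2.
have sv := smooth_on_rpartials t rD (sU k).
have sh : smooth_on D (fun y => - rpartials t (fun z => w z * U k.+1 z) y).
  by apply: smooth_onN; apply: (smooth_on_rpartials _ rD); smooth.
have sH j : smooth_on D (fun z => - div_commutator t k j U z).
  by apply: smooth_onN; exact: smooth_on_div_commutator.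
have := HC x (s' * r) _ _ (fun j z => - div_commutator t k j U z) (adm_half ad)
  (mulr_gt0 s'0 r0) sZ' sv sh sH (tangential_dirichlet k ad tt) (differentiated_equation t k ad).
rewrite mulrA divfK ?gt_eqF// => {}HC.
apply: (@le_trans _ _ (hint x (s * r)
    (fun y => \sum_k0 rpartial k0 (rpartials t (U k)) y * rpartial k0 (rpartials t (U k)) y))).
  apply: (hint_le sD); [by smooth|by smooth|move=> y _].
  rewrite (bigD1 l) //= lerDl sumr_ge0 // => i _; exact: sqr_ge0.
apply: le_trans HC _; rewrite -[leRHS]mulrA; apply: ler_wpM2l; first exact: ltW.
set X := r^-1; have X1 : 1 <= X by exact: adm_invr_ge1 ad.
have Xr : X * r = 1 by rewrite mulVf // gt_eqF.
pose N := (2 * (2 * k + m))%N.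
have E1 : (2 * (2 * k + m).+1 = N.+2)%N by rewrite /N mulnS.
have E2 : (2 * (2 * k.+1 + m) = N.+4)%N by rewrite /N mulnS -addnA mulnDr.
have XN : X ^+ N <= X ^+ N.+2 by apply: ler_weXn2l => //; rewrite -addn2 leq_addr.
have {}Hh := Hh x r U ad; rewrite E2 in Hh.
have {}Hv := Hv x r U ad; rewrite -/N in Hv.
rewrite E1 2!mulrDl; apply: lerD; first apply: lerD.
- apply: le_trans (ler_wpM2l (sqr_ge0 _) Hh) _.
  have -> : (s' * r) ^+ 2 * (Ch * r^-1 ^+ N.+4) = s' ^+ 2 * Ch * X ^+ N.+2 * (X * r) ^+ 2.
    by rewrite -/X !exprMn !exprS expr0; ring.
  by rewrite Xr expr1n mulr1.
- rewrite mulr_suml; apply: ler_sum => j _.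
  rewrite (_ : hint _ _ _ = hint x (s' * r)
     (fun y => div_commutator t k j U y * div_commutator t k j U y)); last first.
    by apply: eq_bint => y _; rewrite mulrNN.
  apply: le_trans ((HCK j).2 _ _ _ ad) _; apply: ler_wpM2l XN; exact: (HCK j).1.
- apply: le_trans (ler_wpM2l (sqr_ge0 _) Hv) _.
  by rewrite le_eqVlt -/X invfM -/X exprMn !exprS; apply/orP; left; apply/eqP; ring.
Qed.

Lemma order_le_partials a k s : count (fun l : 'I_n => l == 0%N :> nat) s = a ->
  order_le (2 * k + size s) (fun U => rpartials s (U k)).
Proof.
set nrm := fun l : 'I_n => l == 0%N :> nat.
elim/ltn_ind: a k s => a IH k s sa.
have tangP t : ~~ has nrm t -> tangential t.
  by rewrite /tangential -all_predC => /allP H; apply/allP => z /H.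
have [/hasP [d ds d0]|/tangP ts] := boolP (has nrm s); last first.
  case: s ts {sa} => [_|l t /andP[_ tt]] /=; first by rewrite addn0; exact: order_le_base.
  by rewrite addnS; exact: order_le_tangential.
have p1 := perm_to_rem ds; set t := rem d s in p1.
have [/hasP [d' dt d'0]|/tangP ts] := boolP (has nrm t); last first.
  rewrite (perm_size p1) /= addnS.
  apply: eq_order_le (@order_le_tangential _ k t d ts erefl) => U sU y Dy.
  by apply/esym; exact: (rpartials_perm rD (sU k) p1 Dy).
have dd' : d' = d by apply: val_inj; rewrite /= (eqP d0) (eqP d'0).
rewrite {}dd' {d' d'0} in dt.
have p2 := perm_to_rem dt; set t2 := rem d t in p2.
have p3 : perm_eq s (t2 ++ [:: d; d]).
  rewrite perm_sym perm_catC /= perm_sym; apply: (perm_trans p1); by rewrite perm_cons.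
have ca : (count nrm t2).+2 = a.
  by rewrite -sa (seq.permP p3) count_cat /= d0 /= addn2.
have ss : size s = (size t2).+2 by rewrite (perm_size p3) size_cat addn2.
have ord_sub t' k' u : subseq t' t2 -> (count nrm u < 2)%N ->
    order_le (2 * k' + size t' + size u) (fun U => rpartials t' (rpartials u (U k'))).
  move=> st' cu; have := IH (count nrm (t' ++ u)) _ k' (t' ++ u) erefl.
  rewrite size_cat addnA => H; apply: eq_order_le (H _) => [U _ y _|].
    by rewrite rpartials_cat.
  by rewrite count_cat -ca -addn2 -addnS; apply: leq_add => //; exact: leq_count_subseq.
pose T1 U y := w y * U k.+1 y.
pose T2 U y := \sum_(p : 'I_n * 'I_n) rpartial p.1 (A p.1 p.2) y * rpartial p.2 (U k) y.
pose T3 U y := \sum_(p : 'I_n * 'I_n | p != (d, d)) A p.1 p.2 y * rpartial p.1 (rpartial p.2 (U k)) y.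
pose N U y := - (T1 U y + T2 U y + T3 U y).
have s1 U : (forall k, smooth_on D (U k)) -> smooth_on D (T1 U) by move=> sU; rewrite /T1; smooth.
have s2 U : (forall k, smooth_on D (U k)) -> smooth_on D (T2 U) by move=> sU; rewrite /T2; smooth.
have s3 U : (forall k, smooth_on D (U k)) -> smooth_on D (T3 U).
  by move=> sU; rewrite /T3; apply: smooth_on_bigsum => p _; smooth.
have sAoo : smooth_on D (fun y => (A d d y)^-1).
  by apply: smooth_onV => // y Dy; apply: A0 => //; exact/eqP.
apply: (@eq_adm_order_le _ (fun U => rpartials t2 (fun y => (A d d y)^-1 * N U y))).
- by move=> U sU; exact: (smooth_on_rpartials _ rD (sU k)).
- move=> x r U ad y Dy; have sU := adm_smooth ad.
  rewrite (rpartials_perm rD (sU k) p3 Dy) rpartials_cat.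
  have sN : smooth_on D (N U).
    by apply: smooth_onN; apply: smooth_onD; [apply: smooth_onD|]; auto.
  apply: (rpartials_eq t2 rD (smooth_onM sAoo sN) _ Dy) => z Dz /=.
  have E : \sum_j rpartial j (fun z0 => \sum_l A j l z0 * rpartial l (U k) z0) z =
      T2 U z + (A d d z * rpartial d (rpartial d (U k)) z + T3 U z).
    have -> : A d d z * rpartial d (rpartial d (U k)) z + T3 U z =
        \sum_(p : 'I_n * 'I_n) A p.1 p.2 z * rpartial p.1 (rpartial p.2 (U k)) z.
      by rewrite [RHS](bigD1 (d, d)).
    rewrite /T2 -big_split /=.
    rewrite -(pair_bigA _ (fun j l => rpartial j (A j l) z * rpartial l (U k) z +
      A j l z * rpartial j (rpartial l (U k)) z)) /=.
    apply: eq_bigr => j _; rewrite (rpartial_sum _ _ rD Dz); last by move=> l _; smooth.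
    by apply: eq_bigr => l _; rewrite (rpartialM j rD Dz) //; smooth.
  rewrite (adm_eq ad k Dz) in E.
  rewrite (_ : N U z = A d d z * rpartial d (rpartial d (U k)) z); last first.
    by rewrite /N /T1; move: E; lra.
  by rewrite mulKf //; exact: (A0 Dz (eqP d0)).
rewrite ss -!addSnnS; apply: order_le_leibniz => // t' st'.
have sub2 t'' : subseq t'' t' -> subseq t'' t2 by move=> h; exact: subseq_trans h st'.
apply: (@eq_order_le _ (fun U y => - (rpartials t' (T1 U) y + rpartials t' (T2 U) y +
    rpartials t' (T3 U) y))).
  move=> U sU y Dy; have := s1 U sU; have := s2 U sU; have := s3 U sU => h3 h2 h1.
  rewrite /N (rpartialsN _ rD _ Dy); last by apply: smooth_onD => //; exact: smooth_onD.
  rewrite (rpartialsD _ rD _ _ Dy) //; last by exact: smooth_onD.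
  by rewrite (rpartialsD _ rD _ _ Dy).
apply: order_leN; apply: order_leD; first apply: order_leD.
- apply: order_le_leibniz => // t'' st''.
  have := ord_sub t'' k.+1 [::] (sub2 _ st'') isT.
  by rewrite /= addn0 mulnS.
- apply: (@eq_order_le _ (fun U y => \sum_(p : 'I_n * 'I_n)
     rpartials t' (fun y => rpartial p.1 (A p.1 p.2) y * rpartial p.2 (U k) y) y)).
    by move=> U sU y Dy; rewrite (rpartials_sum _ _ rD _ Dy) // => p _; smooth.
  apply: order_le_sum => p _; apply: (order_leW (leqnSn _)); rewrite -addSn.
  apply: order_le_leibniz => [|t'' st'']; first by smooth.
  have := ord_sub t'' k [:: p.2] (sub2 _ st''); rewrite /= addn0 => H.
  by apply: order_leW (H _); [rewrite addn1|case: (nrm p.2)].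
- apply: (@eq_order_le _ (fun U y => \sum_(p : 'I_n * 'I_n | p != (d, d))
     rpartials t' (fun y => A p.1 p.2 y * rpartial p.1 (rpartial p.2 (U k)) y) y)).
    by move=> U sU y Dy; rewrite (rpartials_sum _ _ rD _ Dy) // => p _; smooth.
  apply: order_le_sum => -[j l] jl; apply: order_le_leibniz => // t'' st''.
  have := ord_sub t'' k [:: j; l] (sub2 _ st''); rewrite addn2 => H.
  apply: (order_leW _ (H _)) => //; move: jl; rewrite /= /nrm xpair_eqE negb_and.
  have nd i : i != d -> (i == 0%N :> nat) = false.
    by apply: contraNF => /eqP i0; apply/eqP/val_inj; rewrite /= i0 (eqP d0).
  by case/orP => /nd ->; case: (_ == _).
Qed.

Lemma pointwise_bound s : exists2 C : R, 0 <= C & forall x r U, admissible x r U ->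
  rpartials s (U 0%N) x ^+ 2 <= C * r^-1 ^+ (n + 2 * size s).
Proof.
have oJ (J : {set 'I_n}) : exists C : R, 0 <= C /\ forall x r U, admissible x r U ->
    hint x r (fun y => rpartials (enum J ++ s) (U 0%N) y * rpartials (enum J ++ s) (U 0%N) y)
      <= C * r^-1 ^+ (2 * (#|J| + size s)).
  have [_ /(_ 1)] := @order_le_partials _ 0 (enum J ++ s) erefl.
  rewrite ltr01 ltr1n => /(_ isT) [C C0 HC]; exists C; split=> // x r U ad.
  by have := HC x r U ad; rewrite mul1r muln0 add0n size_cat -cardE.
have /choice [CJ HCJ] := oJ.
exists ((\sum_(J <- subset_list n) Num.sqrt (CJ J)) ^+ 2); first exact: sqr_ge0.
move=> x r U ad; have r0 := adm_gt0 ad; have sU := adm_smooth ad; have Hx := adm_half ad.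
pose b : V := \row_k (x ord0 k + r).
have bE k : b ord0 k = x ord0 k + r by rewrite mxE.
have xb k : x ord0 k <= b ord0 k by rewrite bE lerDl ltW.
pose F (J : {set 'I_n}) := rpartials (enum J ++ s) (U 0%N).
have sF J : smooth_on D (F J) by exact: smooth_on_rpartials.
have boxh : box x b `<=` hbox x r.
  move=> y By; apply/hboxP; split=> [k k0|k].
    by apply: le_trans (Hx k k0) _; have /andP[] := By k.
  by rewrite ler_distl; have := By k; rewrite bE => /andP[h ->]; rewrite andbT (le_trans _ h) // gerBl ltW.
have hD : hbox x r `<=` D by have := adm_hboxD ad (s := 1); rewrite mul1r ltr01 ltr1n => /(_ isT).
have sD : box x b `<=` D by move=> y /boxh/hD.
have cF J : {within box x b, continuous (F J)} by exact: smooth_on_box (sF J).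
have sup := @box_sup_le R n x b r F r0 bE cF.
have {}sup : `|F finset.set0 x| <= bint x b (fun y => \sum_(J <- subset_list n) r^-1 ^+ (n - #|J|) * `|F J y|).
  rewrite -lee_fin bintE; last first.
    apply: within_continuous_sum => J _; apply: within_continuousM; first exact: within_continuous_cst.
    exact/within_continuous_norm/cF.
  apply: sup => J k y kJ By yk; have Dy := sD y By.
  have -> : F (k |: J) y = rpartial k (F J) y.
    rewrite -[RHS]/(rpartials ((k :: enum J) ++ s) (U 0%N) y).
    apply: (rpartials_perm rD (sU 0%N) _ Dy); rewrite perm_cat2r.
    by rewrite uniq_perm ?enum_uniq //= ?mem_enum ?kJ ?enum_uniq// => z; rewrite !inE !mem_enum !inE.
  apply: (is_derive_rpartial rD Dy (sF J)); rewrite /tangent_interior.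
  have [k0|] := eqVneq (k : nat) 0%N; last by left.
  by right; apply: le_lt_trans (Hx k k0) _; case/andP: yk.
have F0 : F finset.set0 x = rpartials s (U 0%N) x by rewrite /F enum_set0.
rewrite -F0 -real_normK ?num_real//.
set X := r^-1 in sup *; have X0 : 0 <= X by rewrite invr_ge0 ltW.
have Xr : X * r = 1 by rewrite mulVf // gt_eqF.
set Y := X ^+ (n + 2 * size s); have Y0 : 0 <= Y by exact: exprn_ge0.
have cN (J : {set (ordinal n)}) : {within box x b, continuous (fun y => `|F J y|)} by exact/within_continuous_norm/cF.
suff main (J : {set (ordinal n)}) : X ^+ (n - #|J|) * bint x b (fun y => `|F J y|) <= Num.sqrt (CJ J) * Num.sqrt Y.
  rewrite -[Y]sqr_sqrtr // -exprMn ler_pXn2r ?nnegrE ?mulr_ge0 ?sqrtr_ge0 ?sumr_ge0 //.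
  apply: le_trans sup _; rewrite bint_sum; last first.
    by move=> J _; apply: within_continuousM => //; exact: within_continuous_cst.
  by rewrite mulr_suml; apply: ler_sum => J _; rewrite (bintZ _ (cN J)); exact: main.
have [CJ0 /(_ _ _ _ ad) HJ] := HCJ J; rewrite -/X in HJ.
rewrite -sqrtrM // -[leLHS]ger0_norm ?mulr_ge0 ?exprn_ge0 ?bint_ge0//.
rewrite -sqrtr_sqr ler_wsqrtr // exprMn.
have xb' k : x ord0 k < b ord0 k by rewrite bE ltrDl.
have := bint_sqr_le xb' (cN J).
rewrite (eq_bigr (fun=> r)) => [|k _]; last by rewrite bE addrAC subrr add0r.
rewrite prodr_const card_ord (eq_bint (f := fun y => `|F J y| * `|F J y|) (g := fun y => F J y * F J y)) => [BI|y _]; last first.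
  by rewrite -normrM ger0_norm // -expr2 sqr_ge0.
have BH : bint x b (fun y => F J y * F J y) <= CJ J * X ^+ (2 * (#|J| + size s)).
  apply: le_trans HJ; apply: bint_subset => //.
  - by apply: smooth_on_box hD _; exact: smooth_onM.
  - by move=> y _; rewrite -expr2 sqr_ge0.
have Jn : (#|J| <= n)%N by rewrite -[X in (_ <= X)%N]card_ord max_card.
apply: (@le_trans _ _ (X ^+ (n - #|J|) ^+ 2 * (r ^+ n * (CJ J * X ^+ (2 * (#|J| + size s)))))).
  apply: ler_wpM2l; first exact: sqr_ge0.
  by apply: le_trans BI _; apply: ler_wpM2l BH; rewrite exprn_ge0 // ltW.
have -> : X ^+ (n - #|J|) ^+ 2 * (r ^+ n * (CJ J * X ^+ (2 * (#|J| + size s)))) =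
    CJ J * (r ^+ n * (X ^+ ((n - #|J|) * 2) * X ^+ (2 * (#|J| + size s)))).
  by rewrite (exprM X (n - #|J|) 2); move: (X ^+ _) (X ^+ _) (r ^+ n) => p q t; ring.
have -> : r ^+ n * (X ^+ ((n - #|J|) * 2) * X ^+ (2 * (#|J| + size s))) = (X * r) ^+ n * Y.
  rewrite -exprD (_ : ((n - #|J|) * 2 + 2 * (#|J| + size s) = n + (n + 2 * size s))%N).
    by rewrite exprD exprMn mulrA [r ^+ n * _]mulrC.
  by rewrite mulnC -mulnDr addnA subnK // mulnDr addnA -[(2 * n)%N]/(n + (n + 0))%N addn0.
by rewrite Xr expr1n mul1r.
Qed.

End OperatorOrder.

(** * Riemannian volume in charts *)

Section ChangeOfVariables.
Local Open Scope ereal_scope.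
Context {R : realType} {d d' : measure_display} {X : measurableType d} {Y : measurableType d'}.
Context (mu : {measure set X -> \bar R}) (nu : {measure set Y -> \bar R}).
Context (phi : Y -> X) (w : Y -> R) (B : set X) (E : set Y).
Context (mB : measurable B) (mE : measurable E) (mphi : measurable_fun E phi).
Context (mw : measurable_fun E w) (w0 : forall y, E y -> (0 <= w y)%R).
Context (EB : forall y, E y -> B (phi y)).
Context (muE : forall S, measurable S -> S `<=` B ->
  mu S = \int[nu]_(y in E) (\1_S (phi y) * w y)%:E).
Import HBNNSimple.

Let measurable_indic_comp (S : set X) (k : R) : measurable S ->
  measurable_fun E (fun y => (k * \1_S (phi y) * w y)%:E).
Proof.
move=> mS; apply/measurable_EFinP; apply: measurable_funM => //.
apply: measurable_funM => //.
exact: (measurableT_comp (f := \1_S : X -> R)) mphi.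
Qed.

Lemma nnsfun_change_of_variables (f : {nnsfun X >-> R}) :
  \int[mu]_(x in B) (f x)%:E = \int[nu]_(y in E) (f (phi y) * w y)%:E.
Proof.
transitivity (\sum_(k \in range f) \int[nu]_(y in E) (k * \1_(f @^-1` [set k]) (phi y) * w y)%:E).
  under eq_integral do rewrite fimfunE -fsumEFin//.
  rewrite ge0_integral_fsum//; last 2 first.
  - by move=> y; apply/measurable_EFinP/measurable_funM => //; exact: measurable_funTS.
  - by move=> y x _; rewrite nnfun_muleindic_ge0.
  apply: eq_fsbigr => r /[1!inE] -[x0 _ fx0]; have r0 : (0 <= r)%R by rewrite -fx0.
  have mr : measurable (f @^-1` [set r]) by [].
  have -> : \int[mu]_(x in B) (r * \1_(f @^-1` [set r]) x)%:E = r%:E * mu (f @^-1` [set r] `&` B).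
    by rewrite integralZl_indic_nnsfun// integral_indic.
  rewrite muE; [|exact: measurableI|by move=> ? []].
  rewrite -ge0_integralZl_EFin//; last 2 first.
  - by move=> y Ey; rewrite lee_fin mulr_ge0 ?w0.
  - have := @measurable_indic_comp (f @^-1` [set r] `&` B) 1 (measurableI _ _ mr mB).
    by under eq_fun do rewrite mul1r.
  apply: eq_integral => y /[1!inE] Ey; rewrite -EFinM mulrA; congr (_ * _ * _)%:E.
  by rewrite indicI /= [\1_B _]indicE mem_set ?mulr1//; exact: EB.
rewrite -ge0_integral_fsum//.
- apply: eq_integral => y _; rewrite fsumEFin// fimfunE; congr (_%:E).
  by rewrite !fsbig_finite//= mulr_suml.
- by move=> k; exact: measurable_indic_comp.
- move=> k y Ey; rewrite lee_fin mulr_ge0 ?w0//.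
  by have := nnfun_muleindic_ge0 f k (phi y); rewrite lee_fin.
Qed.

Lemma ge0_change_of_variables (f : X -> \bar R) :
  measurable_fun B f -> (forall x, B x -> 0 <= f x) ->
  \int[mu]_(x in B) f x = \int[nu]_(y in E) (f (phi y) * (w y)%:E).
Proof.
move=> mf f0; pose f_ := nnsfun_approx mB mf.
transitivity (limn (fun n => \int[mu]_(x in B) (f_ n x)%:E)).
  rewrite -monotone_convergence//.
  - apply: eq_integral => y /[!inE] yD; apply/esym/cvg_lim => //.
    exact: cvg_nnsfun_approx.
  - by move=> n; apply/measurable_EFinP/measurable_funTS.
  - by move=> n y _; rewrite lee_fin.
  - by move=> y _ m n mn; rewrite lee_fin; exact/lefP/nd_nnsfun_approx.
rewrite [X in limn X](_ : _ = (fun n => \int[nu]_(y in E) (f_ n (phi y) * w y)%:E)); last first.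
  by apply/funext => n; exact: nnsfun_change_of_variables.
rewrite -monotone_convergence//.
- apply: eq_integral => y /[1!inE] Ey; apply/cvg_lim => //.
  under eq_fun do rewrite EFinM.
  by apply: cvgeMr => //; apply: cvg_nnsfun_approx => //; exact: EB.
- move=> n; apply/measurable_EFinP; apply: measurable_funM => //.
  exact: (measurableT_comp (f := f_ n)) mphi.
- by move=> n y Ey; rewrite lee_fin mulr_ge0 ?w0.
- move=> y Ey m n mn; rewrite lee_fin ler_wpM2r ?w0//; exact/lefP/nd_nnsfun_approx.
Qed.

Lemma change_of_variables (f : X -> R) : measurable_fun B f ->
  \int[mu]_(x in B) (f x)%:E = \int[nu]_(y in E) (f (phi y) * w y)%:E.
Proof.
move=> mf; rewrite integralE [RHS]integralE.
have mf' : measurable_fun B (EFin \o f) by exact/measurable_EFinP.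
congr (_ - _).
  rewrite ge0_change_of_variables//; last exact: measurable_funepos.
  apply: eq_integral => y /[1!inE] Ey.
  rewrite !funeposE -!EFin_max -EFinM; congr (_%:E).
  by rewrite maxr_pMl ?w0// mul0r.
rewrite ge0_change_of_variables//; last exact: measurable_funeneg.
apply: eq_integral => y /[1!inE] Ey.
rewrite !funenegE -!EFinN -!EFin_max -EFinM; congr (_%:E).
by rewrite maxr_pMl ?w0// mul0r mulNr.
Qed.

End ChangeOfVariables.

Section PositiveMatrix.
Context {R : realType} {n : nat}.
Implicit Types (g : 'M[R]_n) (v : 'rV[R]_n).

Definition qform g v : R := (v *m g *m v^T) ord0 ord0.

Lemma qformE g v : qform g v = \sum_j \sum_k g j k * v ord0 j * v ord0 k.
Proof.
rewrite /qform mxE exchange_big /=; apply: eq_bigr => k _.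
rewrite !mxE mulr_suml; apply: eq_bigr => j _; rewrite [v ord0 j * _]mulrC; ring.
Qed.

Lemma qform1 v : qform 1%:M v = \sum_k v ord0 k ^+ 2.
Proof. by rewrite /qform mulmx1 mxE; apply: eq_bigr => k _; rewrite !mxE expr2. Qed.

Lemma sum_sqr_gt0 v : v != 0 -> 0 < \sum_k v ord0 k ^+ 2.
Proof.
move=> v0; rewrite lt_neqAle sumr_ge0 ?andbT; last by move=> k _; exact: sqr_ge0.
apply: contraNneq v0 => /esym E; apply/eqP/rowP => k; rewrite mxE.
by apply/eqP; rewrite -sqrf_eq0; apply/eqP/(psumr_eq0P _ E) => // j _; exact: sqr_ge0.
Qed.

Lemma posdef_det_gt0 g : (forall v, v != 0 -> 0 < qform g v) -> 0 < \det g.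
Proof.
move=> pg.
pose m (t : R) := g + t *: (1%:M - g).
have m0 t : 0 <= t <= 1 -> \det (m t) != 0.
  move=> /andP[t0 t1]; apply/negP => /det0P [v v0 vm].
  have : 0 < (1 - t) * qform g v + t * qform 1%:M v.
    have := pg v v0; have := sum_sqr_gt0 v0; rewrite qform1.
    have [->|t0'] := eqVneq t 0; first by rewrite subr0 mul1r mul0r addr0.
    have {t0' }t0' : 0 < t by rewrite lt_def t0'.
    by move=> h1 h2; apply: ltr_wpDl; [apply: mulr_ge0; [rewrite subr_ge0|exact: ltW]|exact: mulr_gt0].
  rewrite (_ : _ + _ = qform (m t) v); first by rewrite /qform vm mul0mx mxE ltxx.
  rewrite !qformE !mulr_sumr -big_split; apply: eq_bigr => j _ /=.
  rewrite !mulr_sumr -big_split; apply: eq_bigr => k _ /=; rewrite !mxE; ring.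
pose p : {poly R} := \det (map_mx polyC g + 'X *: map_mx polyC (1%:M - g)).
have pE t : p.[t] = \det (m t).
  rewrite -horner_evalE -det_map_mx; congr (\det _); apply/matrixP => i j.
  by rewrite !mxE /= horner_evalE !hornerE.
rewrite ltNge; apply/negP => g0.
have [||t /m0] := @poly_ivt _ p 0 1; first exact: ler01.
  by rewrite !pE /m scale0r addr0 scale1r addrC subrK det1 g0 ler01.
by rewrite -pE => /negP h /h.
Qed.

Lemma posdef_unitmx g : (forall v, v != 0 -> 0 < qform g v) -> g \in unitmx.
Proof. by move=> /posdef_det_gt0 h; rewrite unitmxE unitfE gt_eqF. Qed.

(* With [z = y g^-1], expand [0 <= (z - t y) g (z - t y)^T] at [t = 1 / K]. *)
Lemma qform_inv_ge g (K : R) v : g^T = g -> (forall v, v != 0 -> 0 < qform g v) -> 0 < K ->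
  (forall v, qform g v <= K * \sum_k v ord0 k ^+ 2) ->
  K^-1 * (\sum_k v ord0 k ^+ 2) <= qform (invmx g) v.
Proof.
move=> gT pg K0 gK; have ug := posdef_unitmx pg.
have iT : (invmx g)^T = invmx g by rewrite trmx_inv gT.
pose z := v *m invmx g; pose t := K^-1.
have pos u : 0 <= qform g u.
  by have [->|/pg/ltW//] := eqVneq u 0; rewrite /qform !mul0mx mxE.
have : qform g (z - t *: v) = qform (invmx g) v - 2 * t * (\sum_k v ord0 k ^+ 2) + t ^+ 2 * qform g v.
  have E1 : (z - t *: v) *m g = v - t *: (v *m g).
    by rewrite mulmxBl -scalemxAl /z mulmxKV.
  have E2 : (z - t *: v)^T = invmx g *m v^T - t *: v^T.
    by rewrite linearB linearZ /= /z trmx_mul iT.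
  rewrite {1}/qform E1 E2 mulmxBl !mulmxBr -!scalemxAl -!scalemxAr !mulmxA mulmxK //.
  have -> : qform (invmx g) v = (v *m invmx g *m v^T) 0 0 by [].
  have -> : qform g v = (v *m g *m v^T) 0 0 by [].
  rewrite -qform1 /qform mulmx1 !mxE.
  by ring.
have := pos (z - t *: v) => /[swap] ->.
have := gK v; set N := \sum_k _; set Q := qform g v => QN.
have : t ^+ 2 * Q <= t * N.
  apply: le_trans (ler_wpM2l (sqr_ge0 _) QN) _.
  rewrite (_ : _ * _ = t * N) // /t; field; by rewrite gt_eqF.
rewrite -/t; lra.
Qed.

End PositiveMatrix.

Section SmoothMatrix.
Context {R : realType} {n : nat}.
Local Notation V := 'rV[R]_n.

Lemma smooth_on_det m (D : set V) (g : V -> 'M[R]_m) :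
  (forall j k, smooth_on D (fun x => g x j k)) -> smooth_on D (fun x => \det (g x)).
Proof.
move=> sg; rewrite /determinant; apply: smooth_on_bigsum => s _.
apply: smooth_onM; first exact: smooth_on_cst.
by apply: smooth_on_bigprod => j _; exact: sg.
Qed.

Lemma smooth_on_invmx m (D : set V) (g : V -> 'M[R]_m) j k :
  (forall j k, smooth_on D (fun x => g x j k)) -> (forall x, D x -> g x \in unitmx) ->
  smooth_on D (fun x => invmx (g x) j k).
Proof.
move=> sg ug; apply: (@eq_smooth_on _ _ _ (fun x => (\det (g x))^-1 * ((-1) ^+ (k + j) *
    \det (row' k (col' j (g x)))))).
  by move=> x Dx; rewrite /invmx ug // !mxE.
apply: smooth_onM.
  apply: smooth_onV; last exact: smooth_on_det.
  by move=> x /ug; rewrite unitmxE unitfE.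
apply: smooth_onM; first exact: smooth_on_cst.
apply: smooth_on_det => a b; apply: eq_smooth_on (sg (lift k a) (lift j b)) => x _.
by rewrite !mxE.
Qed.

End SmoothMatrix.

Lemma within_measurable_fun (X Y : ptopologicalType) (D : set X) (f : X -> Y) :
  closed D -> {within D, continuous f} -> measurable_fun (D : set (borel X)) (f : borel X -> borel Y).
Proof.
move=> cD cf; apply: borel_measurable_fun => U oU.
have /open_subspaceP : open (f @^-1` U : set (subspace D)).
  by apply: open_comp oU => x _; exact: cf.
move=> [V oV VE]; rewrite setIC (_ : _ `&` D = V `&` D) //.
by apply: measurableI; [exact: borel_open|exact: borel_closed].
Qed.

Section VolumeBox.
Context {R : realType} {n : nat} {M : ptopologicalType} {I : finType}.
Context (A : atlas R n M I) (G : I -> 'rV[R]_n -> 'M[R]_n).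
Context (vol : {measure set (borel M) -> \bar R}).
Context (hM : hausdorff_space M) (mG : riemannian_metric A G) (volG : riemannian_volume A G vol).
Local Notation V := 'rV[R]_n.
Implicit Types (i : I) (x : V) (p : M).

Lemma chart_image_relopen i : relopen (chart_image A i).
Proof. exact: chart_map_image_open. Qed.

Lemma chart_invP i x : chart_image A i x ->
  chart_dom A i (chart_inv A i x) /\ chart_map A i (chart_inv A i x) = x.
Proof. by move=> [p Dp <-]; rewrite chart_mapK. Qed.

Lemma sqrt_det_gt0 i x : chart_image A i x -> 0 < sqrt_det G i x.
Proof.
by move=> Dx; rewrite sqrtr_gt0; apply: posdef_det_gt0; exact: (metric_pos mG).
Qed.

Lemma sqrt_det_ge0 i x : 0 <= sqrt_det G i x.
Proof. exact: sqrtr_ge0. Qed.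

Lemma smooth_on_sqrt_det i : smooth_on (chart_image A i) (sqrt_det G i).
Proof.
apply: smooth_on_sqrt => [x Dx|]; first by apply: posdef_det_gt0; exact: (metric_pos mG).
by apply: smooth_on_det => j k; exact: (metric_smooth mG).
Qed.

Lemma smooth_on_metric_inv i j k : smooth_on (chart_image A i) (fun x => invmx (G i x) j k).
Proof.
apply: smooth_on_invmx => [j' k'|x Dx]; first exact: (metric_smooth mG).
by apply: posdef_unitmx; exact: (metric_pos mG).
Qed.

Definition chart_box i (a b : V) : set M := chart_inv A i @` box a b.

Section OneBox.
Context (i : I) (a b : V) (abD : box a b `<=` chart_image A i).

Lemma chart_boxP p : chart_box i a b p <-> chart_dom A i p /\ box a b (chart_map A i p).
Proof.
split=> [[x Bx <-]|[Dp Bp]]; first by have [d ->] := chart_invP (abD Bx).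
by exists (chart_map A i p) => //; rewrite chart_mapK.
Qed.

Lemma chart_box_continuous : {within box a b, continuous (chart_inv A i)}.
Proof. exact: (continuous_subspaceW abD (@chart_inv_continuous _ _ _ _ A i)). Qed.

Lemma chart_box_compact : compact (chart_box i a b).
Proof. by apply: continuous_compact; [exact: chart_box_continuous|exact: box_compact]. Qed.

Lemma chart_box_closed : closed (chart_box i a b).
Proof. exact: compact_closed hM chart_box_compact. Qed.

Lemma chart_box_measurable : measurable (chart_box i a b : set (borel M)).
Proof. exact: borel_closed chart_box_closed. Qed.

Lemma sqrt_det_box_measurable : measurable_fun (box a b : set (brow n)) (sqrt_det G i : brow n -> R).
Proof. by apply: box_measurable_fun; apply: (smooth_on_box abD); exact: smooth_on_sqrt_det. Qed.

Lemma vol_chart_box (S : set (borel M)) : measurable S -> S `<=` chart_box i a b ->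
  (vol S = \int[row_measure n]_(x in box a b) (\1_S (chart_inv A i x) * sqrt_det G i x)%:E)%E.
Proof.
move=> mS SB.
rewrite (volG (i := i) mS) => [|p /SB /chart_boxP[]//].
have minv : measurable_fun (box a b : set (brow n)) (chart_inv A i : brow n -> borel M).
  by apply: within_measurable_fun chart_box_continuous; exact: box_closed.
pose f (x : brow n) := (\1_S (chart_inv A i x) * sqrt_det G i x)%:E.
have mf : measurable_fun (box a b : set (brow n)) f.
  apply/measurable_EFinP; apply: measurable_funM; last exact: sqrt_det_box_measurable.
  exact: (measurableT_comp (f := \1_S : borel M -> R)) minv.
have -> : (fun x : V => (\1_(chart_map A i @` S) x * sqrt_det G i x)%:E) = f \_ (box a b).
  apply/funext => x; rewrite patchE /f; case: ifPn => [/set_mem Bx|/negP Bx].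
    have [d E] := chart_invP (abD Bx); congr (_ * _)%:E; rewrite !indicE; congr (_ : bool)%:R.
    apply/idP/idP => /set_mem; last by move=> Sx; apply/mem_set; exists (chart_inv A i x).
    by move=> [p Sp <-]; apply/mem_set; rewrite chart_mapK //; have /SB/chart_boxP[] := Sp.
  rewrite indicE memNset ?mul0r// => -[p Sp px]; apply: Bx; apply/mem_set.
  by rewrite -px; have /SB/chart_boxP[] := Sp.
rewrite lebesgue_integral_rVE.
- by rewrite -integral_mkcond.
- exact: (measurable_restrictT _ (box_measurable a b)).1 mf.
- move=> x; rewrite patchE; case: ifP => // _; rewrite /f lee_fin mulr_ge0 //; exact: sqrt_det_ge0.
Qed.

Lemma vol_integral (f : M -> R) :
  measurable_fun (chart_box i a b : set (borel M)) (f : borel M -> R) ->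
  (\int[vol]_(p in chart_box i a b) (f p)%:E =
   \int[row_measure n]_(x in box a b) (f (chart_inv A i x) * sqrt_det G i x)%:E)%E.
Proof.
apply: change_of_variables => //.
- exact: chart_box_measurable.
- exact: box_measurable.
- by apply: within_measurable_fun chart_box_continuous; exact: box_closed.
- exact: sqrt_det_box_measurable.
- by move=> x _; exact: sqrt_det_ge0.
- by move=> x Bx; exists x.
- by move=> S mS SB; exact: vol_chart_box.
Qed.

End OneBox.
End VolumeBox.

(** * Test functions and the invariance of the Laplacian *)

Section Flat.
Context {R : realType}.

Definition flat (k : nat) (t : R) : R := if 0 < t then t^-1 ^+ k * expR (- t^-1) else 0.

Lemma flat_ge0 k t : 0 <= flat k t.
Proof.
rewrite /flat; case: ifP => // t0; apply: mulr_ge0; last exact: expR_ge0.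
by rewrite exprn_ge0 // invr_ge0 ltW.
Qed.

Lemma flat0_gt0 t : 0 < t -> 0 < flat 0 t.
Proof. by rewrite /flat => ->; rewrite mul1r expR_gt0. Qed.

Lemma flat_le0 k t : t <= 0 -> flat k t = 0.
Proof. by rewrite /flat leNgt => /negbTE ->. Qed.

Lemma flat_le_sqr k t : 0 < t -> flat k t <= (k.+2)`!%:R * t ^+ 2.
Proof.
move=> t0; rewrite /flat t0; set y := t^-1; have y0 : 0 < y by rewrite invr_gt0.
have := expR_ge1Dxn k.+1 (ltW y0) => H.
have {}H : y ^+ k.+2 <= (k.+2)`!%:R * expR y.
  rewrite mulrC -ler_pdivrMr ?ltr0n ?fact_gt0//; apply: le_trans H; by rewrite lerDr.
rewrite expRN ler_pdivrMr ?expR_gt0//.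
rewrite (_ : y ^+ k = t ^+ 2 * y ^+ k.+2).
  rewrite (_ : _ * t ^+ 2 * _ = t ^+ 2 * ((k.+2)`!%:R * expR y)); last by ring.
  by apply: ler_wpM2l; first exact: sqr_ge0.
have ty : t * y = 1 by rewrite mulfV // gt_eqF.
transitivity ((t * y) ^+ 2 * y ^+ k); first by rewrite ty expr1n mul1r.
by rewrite !exprS; ring.
Qed.

Lemma is_derive_flat k (t : R) :
  is_derive t (1 : R) (flat k) (- k%:R * flat k.+1 t + flat k.+2 t).
Proof.
have [t0|t0|t0] := ltgtP t 0.
- rewrite !(flat_le0 _ (ltW t0)) mulr0 addr0.
  apply/is_deriveP => e e0; exists (- t) => [|h]; first by rewrite oppr_gt0.
  rewrite ltr_norml => /andP[_ ht].
  have th : t + h <= 0 by rewrite -lerBrDl sub0r ltW.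
  rewrite [h%:A]mulr1 mulr0 (flat_le0 _ th) (flat_le0 _ (ltW t0)) !subr0 normr0.
  by apply: mulr_ge0 => //; exact: ltW.
- pose g (y : R) := y ^+ k * expR (- y).
  have tn : t != 0 by rewrite gt_eqF.
  have dN : is_derive (t^-1) (1 : R) (fun y : R => - y) (-1).
    by apply: is_deriveN; exact: is_derive_id.
  have dE : is_derive (t^-1) (1 : R) (fun y : R => expR (- y)) (expR (- t^-1) * (-1)).
    exact: (is_derive1_comp (is_derive_expR _) dN).
  have dg : is_derive (t^-1) (1 : R) g
      (t^-1 ^+ k * (expR (- t^-1) * (-1)) + expR (- t^-1) * (k%:R * t^-1 ^+ k.-1)).
    have dX : is_derive (t^-1) (1 : R) (fun y : R => y ^+ k) (k%:R * t^-1 ^+ k.-1).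
      have := is_deriveX k (is_derive_id (t^-1) (1 : R)).
      by rewrite exprfctE /GRing.scale /= mulr1.
    exact: (is_deriveM dX dE).
  have dV : is_derive t (1 : R) (fun y : R => y^-1) (- (t^-1 * t^-1)).
    have di := is_derive_id t (1 : R).
    apply: is_derive_eq; first exact: (is_deriveV tn di).
    by rewrite /GRing.scale /= mulr1 -exprVn expr2.
  have dgV := is_derive1_comp dg dV.
  have E : \forall y \near t, (g \o (fun y : R => y^-1)) y = flat k y.
    near=> y; rewrite /= /flat /g ifT //; near: y; exact: lt_nbhsr.
  apply: is_derive_eq; first exact: (near_eq_is_derive E dgV).
  rewrite /flat t0 !exprS; case: k {g dg dgV E} => [|k] /=; first by rewrite expr0; ring.
  by rewrite exprS; ring.
- rewrite t0 !flat_le0 // mulr0 addr0.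
  apply/is_deriveP => e e0; pose c : R := (k.+2)`!%:R.
  have c0 : 0 < c by rewrite ltr0n fact_gt0.
  exists (e / c) => [|h hr]; first exact: divr_gt0.
  rewrite [h%:A]mulr1 add0r mulr0 !subr0 (flat_le0 _ (lexx 0)) subr0 ger0_norm ?flat_ge0//.
  have [h0|h0] := leP h 0; first by rewrite flat_le0 // mulr_ge0 // ltW.
  apply: le_trans (flat_le_sqr _ h0) _; rewrite gtr0_norm // in hr *.
  rewrite expr2 mulrA; apply: ler_wpM2r; first exact: ltW.
  by rewrite -/c mulrC -ler_pdivlMr // ltW.
Unshelve. all: by end_near.
Qed.

Lemma Ck_flat n m k (W : set 'rV[R]_n) (F : 'rV[R]_n -> R) : open W -> Ck m W F ->
  Ck m W (flat k \o F).
Proof.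
move=> oW; elim: m k => [|m IH] k HF.
  split=> // x Wx; apply: continuous_comp; first exact: (Ck_cont HF).
  have [/derivable1_diffP/differentiable_continuous] := is_derive_flat k (F x).
  by [].
apply: (@Ck_comp1 _ _ m W F (flat k) (fun t => - k%:R * flat k.+1 t + flat k.+2 t) oW) => //.
  by move=> x _; exact: is_derive_flat.
have HF' := CkS HF.
apply: (@Ck_eq _ _ _ _ (fun x => - k%:R * (flat k.+1 \o F) x + (flat k.+2 \o F) x)) => //.
apply: Ck_D => //; last exact: IH.
by apply: Ck_M => //; [exact: Ck_cst|exact: IH].
Qed.

Lemma smooth_on_flat n k (D : set 'rV[R]_n) (f : 'rV[R]_n -> R) : smooth_on D f ->
  smooth_on D (fun x => flat k (f x)).
Proof.
move=> sf; apply: (@smooth_on_op1 _ _ D f (flat k) setT openT) => //.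
by move=> W F m oW _ HF; exact: Ck_flat.
Qed.

Definition cutoff (t : R) : R := flat 0 t / (flat 0 t + flat 0 (1 - t)).

Lemma cutoff_den_gt0 t : 0 < flat 0 t + flat 0 (1 - t).
Proof.
have [t0|t0] := leP t 0; first by rewrite ltr_wpDl ?flat_ge0 ?flat0_gt0// subr_gt0 (le_lt_trans t0).
by rewrite ltr_wpDr ?flat_ge0 ?flat0_gt0.
Qed.

Lemma smooth_on_cutoff n (D : set 'rV[R]_n) (f : 'rV[R]_n -> R) : smooth_on D f ->
  smooth_on D (fun x => cutoff (f x)).
Proof.
move=> sf; apply: smooth_onM; first exact: smooth_on_flat.
apply: smooth_onV => [x _|]; first by rewrite gt_eqF ?cutoff_den_gt0.
apply: smooth_onD; first exact: smooth_on_flat.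
by apply: smooth_on_flat; apply: smooth_onB => //; exact: smooth_on_cst.
Qed.

Lemma cutoff_ge0 t : 0 <= cutoff t.
Proof. by rewrite divr_ge0 ?flat_ge0// ltW // cutoff_den_gt0. Qed.

Lemma cutoff0 t : t <= 0 -> cutoff t = 0.
Proof. by move=> t0; rewrite /cutoff (flat_le0 0 t0) mul0r. Qed.

Lemma cutoff1 t : 1 <= t -> cutoff t = 1.
Proof.
move=> t1; rewrite /cutoff (@flat_le0 0 (1 - t)) ?subr_le0// addr0 divff //.
by rewrite gt_eqF // flat0_gt0 // (lt_le_trans _ t1).
Qed.

End Flat.

Section Plateau.
Context {R : realType} {n : nat}.
Local Notation V := 'rV[R]_n.
Implicit Types (x y : V) (s : R).

Definition plateau x s y : R :=
  \prod_k cutoff ((4 - ((y ord0 k - x ord0 k) / s) ^+ 2) / 3).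

Lemma smooth_on_plateau (D : set V) x s : smooth_on D (plateau x s).
Proof.
apply: smooth_on_bigprod => k _; apply: smooth_on_cutoff.
apply: smooth_onM; last exact: smooth_on_cst.
apply: smooth_onB; first exact: smooth_on_cst.
have h : smooth_on D (fun y : V => (y ord0 k - x ord0 k) / s).
  apply: smooth_onM; last exact: smooth_on_cst.
  by apply: smooth_onB; [exact: smooth_on_coord|exact: smooth_on_cst].
exact: smooth_onM.
Qed.

Lemma plateau_ge0 x s y : 0 <= plateau x s y.
Proof. by apply: prodr_ge0 => k _; exact: cutoff_ge0. Qed.

Lemma plateau1 x s y : 0 < s -> (forall k, `|y ord0 k - x ord0 k| <= s) -> plateau x s y = 1.
Proof.
move=> s0 H; apply: big1 => k _; apply: cutoff1.
suff : ((y ord0 k - x ord0 k) / s) ^+ 2 <= 1 by lra.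
rewrite -real_normK ?num_real// expr_le1 //.
by rewrite normrM normfV (gtr0_norm s0) ler_pdivrMr // mul1r.
Qed.

Lemma plateau0 x s y k : 0 < s -> 2 * s <= `|y ord0 k - x ord0 k| -> plateau x s y = 0.
Proof.
move=> s0 H; rewrite /plateau (bigD1 k) //= cutoff0 ?mul0r//.
suff : 2 ^+ 2 <= ((y ord0 k - x ord0 k) / s) ^+ 2 by lra.
rewrite -[leRHS]real_normK ?num_real// ler_pXn2r ?nnegrE//.
by rewrite normrM normfV (gtr0_norm s0) ler_pdivlMr.
Qed.

End Plateau.

Section LocalSmooth.
Context {R : realType} {n : nat}.
Local Notation V := 'rV[R]_n.
Implicit Types (D : set V) (f g : V -> R) (x y : V).

Lemma smooth_on_local D f : D `<=` half_space ->
  (forall x, D x -> exists D', [/\ relopen D', D' x & smooth_on (D `&` D') f]) ->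
  smooth_on D f.
Proof.
move=> DH H x Dx; have [D' [[Q [oQ D'E]] D'x sf]] := H x Dx.
have [W [F [oW Wx sF EF]]] := sf x (conj Dx D'x).
exists (W `&` Q), F; split.
- exact: openI.
- by split=> //; move: D'x; rewrite D'E => -[].
- by move=> s y [Wy _]; exact: sF.
- move=> y [Wy Qy] Dy; apply: EF => //; split=> //; rewrite D'E; split=> //; exact: DH.
Qed.

Lemma relopen_half D : relopen D -> D `<=` half_space.
Proof. by move=> [Q [_ ->]] x []. Qed.

Lemma relopen_ball D x : relopen D -> D x -> exists2 r : R, 0 < r &
  forall y, half_space y -> `|y - x| < r -> D y.
Proof.
move=> [Q [oQ ->]] [Qx Hx].
have /nbhs_ballP [r r0 Hr] := open_nbhs_nbhs (conj oQ Qx).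
by exists r => // y Hy yr; split=> //; apply: Hr; rewrite -ball_normE /= distrC.
Qed.

Lemma relopen_hbox D x : relopen D -> D x -> exists2 s : R, 0 < s & hbox x s `<=` D.
Proof.
move=> rD Dx; have [r r0 Hr] := relopen_ball rD Dx; exists (r / 2); first by rewrite divr_gt0.
move=> y /hboxP [Hy yx]; apply: Hr => //; apply/mx_norm_ltP => // k.
rewrite !mxE; apply: le_lt_trans (yx k) _.
by rewrite ltr_pdivrMr // ltr_pMr // ltr1n.
Qed.

Lemma relopen_line D k x : relopen D -> D x -> tangent_interior k x ->
  exists2 r : R, 0 < r & forall h, `|h| < r -> D (x + h *: basis_vec k).
Proof.
move=> rD Dx tk; have Hx := relopen_half rD Dx; have [r r0 Hr] := relopen_ball rD Dx.
have [r' r'0 Hr'] : exists2 r' : R, 0 < r' & forall h, `|h| < r' ->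
    half_space (x + h *: basis_vec k).
  case: tk => [k0|xk].
    exists 1 => // h _ l l0; rewrite !mxE eqxx /= (_ : (l == k) = false).
      by rewrite mulr0 addr0 Hx.
    by apply/negP => /eqP lk; rewrite -lk l0 in k0.
  exists (x ord0 k) => // h; rewrite ltr_norml => /andP[h1 _] l l0.
  rewrite !mxE eqxx /=; have [->|_] := eqVneq l k; last by rewrite mulr0 addr0 Hx.
  by rewrite mulr1 -lerBlDl sub0r ltW.
exists (Num.min r r') => [|h]; first by rewrite lt_min r0.
rewrite lt_min => /andP[h1 h2]; apply: Hr; first exact: Hr'.
by rewrite addrC addKr normrZ; apply: le_lt_trans h1; rewrite ler_piMr // basis_vec_norm.
Qed.

Lemma rpartial_min0 D f k x : relopen D -> D x -> smooth_on D f -> tangent_interior k x ->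
  (forall y, D y -> f x <= f y) -> rpartial k f x = 0.
Proof.
move=> rD Dx sf tk fx; set d := rpartial k f x; apply/eqP; apply: contraT => d0.
have /is_deriveP H := is_derive_rpartial rD Dx sf tk.
have [r r0 Hr] := relopen_line rD Dx tk.
have dp : 0 < `|d| by rewrite normr_gt0.
have [r2 r20 Hr2] := H (`|d| / 2) (divr_gt0 dp (ltr0Sn _ 1)).
pose m := Num.min r r2 / 2.
have m0 : 0 < m by rewrite divr_gt0 // lt_min r0.
have : m < Num.min r r2 by rewrite ltr_pdivrMr ?ltr_pMr ?ltr1n ?lt_min ?r0.
rewrite lt_min => /andP[mr mr2].
pose h := - (Num.sg d * m).
have hm : `|h| = m by rewrite normrN normrM normr_sg d0 mul1r gtr0_norm.
have hd : h * d = - (m * `|d|) by rewrite /h normrEsg; ring.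
have := Hr2 h; rewrite hm => /(_ mr2); rewrite -/d hd => E.
have /fx fh : D (x + h *: basis_vec k) by apply: Hr; rewrite hm.
have := le_trans (ler_norm _) E; have := mulr_gt0 m0 dp.
set X := m * `|d|; rewrite (_ : `|d| / 2 * m = X / 2); last by rewrite /X; ring.
by move: fh; lra.
Qed.

Lemma interior_tangent x k : half_space x -> ~ half_space_boundary x -> tangent_interior k x.
Proof.
move=> Hx nb; have [k0|] := eqVneq (k : nat) 0%N; last by left.
right; rewrite lt_def Hx // andbT; apply/eqP => xk; apply: nb; split=> //.
by exists k.
Qed.

Lemma hbox_interior x : half_space x -> ~ half_space_boundary x ->
  exists2 s : R, 0 < s & forall y, hbox x s y -> ~ half_space_boundary y.
Proof.
move=> Hx nb; have [[k k0]|nk] := pselect (exists k : 'I_n, k = 0%N :> nat); last first.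
  by exists 1 => // y _ [_ [k [k0 _]]]; apply: nk; exists k.
have xk : 0 < x ord0 k by have [|//] := interior_tangent k Hx nb; rewrite k0.
exists (x ord0 k / 2); first by rewrite divr_gt0.
move=> y /hboxP [_ /(_ k)] H [_ [l [l0 yl]]].
have lk : l = k by apply: val_inj; rewrite /= l0 k0.
by move: H; rewrite -lk yl sub0r normrN gtr0_norm ?lk//; lra.
Qed.

End LocalSmooth.

Section ManifoldFunctions.
Context {R : realType} {n : nat} {M : ptopologicalType} {I : finType}.
Context (A : atlas R n M I) (hM : hausdorff_space M).
Local Notation V := 'rV[R]_n.
Implicit Types (i j : I) (p : M) (f g : M -> R) (D : set V).

Definition rsmooth f : Prop := forall i, smooth_on (chart_image A i) (f \o chart_inv A i).

Lemma rsmooth_cst (c : R) : rsmooth (fun=> c).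
Proof. by move=> i; exact: smooth_on_cst. Qed.

Lemma rsmoothD f g : rsmooth f -> rsmooth g -> rsmooth (fun p => f p + g p).
Proof. by move=> sf sg i; exact: smooth_onD (sf i) (sg i). Qed.

Lemma rsmoothM f g : rsmooth f -> rsmooth g -> rsmooth (fun p => f p * g p).
Proof. by move=> sf sg i; exact: smooth_onM (sf i) (sg i). Qed.

Lemma rsmooth_sum (J : Type) (s : seq J) (P : pred J) (F : J -> M -> R) :
  (forall l, rsmooth (F l)) -> rsmooth (fun p => \sum_(l <- s | P l) F l p).
Proof. by move=> sF i; apply: smooth_on_bigsum => j _; exact: sF. Qed.

Lemma chart_map_nbhs i p (Q : set V) : chart_dom A i p ->
  nbhs (chart_map A i p) Q -> nbhs p (chart_map A i @^-1` Q).
Proof.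
move=> Dp HQ; have /subspace_continuousP := @chart_map_continuous _ _ _ _ A i.
move=> /(_ p Dp) /(_ _ HQ); rewrite /= /within /=.
have oD : nbhs p (chart_dom A i) by apply: open_nbhs_nbhs; split=> //; exact: chart_dom_open.
by move=> H; near=> q; (have : chart_dom A i q by near: q); near: q.
Unshelve. all: by end_near. Qed.

Lemma chart_map_open i (Q : set V) : open Q -> open (chart_dom A i `&` chart_map A i @^-1` Q).
Proof.
move=> oQ; rewrite openE => p [Dp Qp]; apply: filterI.
  by apply: open_nbhs_nbhs; split=> //; exact: chart_dom_open.
by apply: chart_map_nbhs => //; apply: open_nbhs_nbhs.
Qed.

Lemma rsmooth_continuous f : rsmooth f -> continuous f.
Proof.
move=> sf p; have [i Dp] := chart_dom_cover A p.
have Ip : chart_image A i (chart_map A i p) by exists p.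
have /subspace_continuousP /(_ _ Ip) cf := smooth_on_continuous (sf i).
apply/cvgrPdist_lt => e e0.
move/cvgrPdist_lt : cf => /(_ e e0); rewrite near_withinE => H.
have {}H := chart_map_nbhs Dp H.
have oD : nbhs p (chart_dom A i) by apply: open_nbhs_nbhs; split=> //; exact: chart_dom_open.
near=> q.
have Dq : chart_dom A i q by near: q.
have : `|(f \o chart_inv A i) (chart_map A i p) - (f \o chart_inv A i) (chart_map A i q)| < e.
  have : chart_image A i (chart_map A i q) by exists q.
  by near: q.
by rewrite /= !chart_mapK.
Unshelve. all: by end_near. Qed.

Lemma rsmooth_measurable f : rsmooth f -> measurable_fun [set: borel M] (f : borel M -> R).
Proof.
move=> /rsmooth_continuous cf; apply: borel_measurable_realfun; first exact: closedT.
by apply: continuous_subspaceT => x; exact: cf.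
Qed.

Lemma chart_preimage_relopen i (W : set M) : open W ->
  relopen [set x | chart_image A i x /\ W (chart_inv A i x)].
Proof.
move=> oW; have /open_subspaceP [U oU UE] :
    open (chart_inv A i @^-1` W : set (subspace (chart_image A i))).
  by apply: open_comp oW => x _; exact: (@chart_inv_continuous _ _ _ _ A i).
have -> : [set x | chart_image A i x /\ W (chart_inv A i x)] = U `&` chart_image A i.
  by rewrite UE; apply/seteqP; split=> x [].
by apply: relopen_openI => //; exact: chart_image_relopen.
Qed.

Definition overlap i j : set V := [set x | chart_image A i x /\ chart_dom A j (chart_inv A i x)].
Definition transition i j : V -> V := chart_map A j \o chart_inv A i.

Lemma overlap_relopen i j : relopen (overlap i j).
Proof. by apply: chart_preimage_relopen; exact: chart_dom_open. Qed.

Lemma overlap_smooth i j a : smooth_on (overlap i j) (fun x => transition i j x ord0 a).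
Proof.
apply: (smooth_onW _ (@transition_smooth _ _ _ _ A i j a)) => x [Ix Dx].
by have [Di E] := chart_invP Ix; exists (chart_inv A i x).
Qed.

Lemma transition_image i j x : overlap i j x -> chart_image A j (transition i j x).
Proof. by move=> [_ Dx]; exists (chart_inv A i x). Qed.

Lemma transition_inv i j x : overlap i j x -> chart_inv A j (transition i j x) = chart_inv A i x.
Proof. by move=> [_ Dx]; rewrite /transition /= chart_mapK. Qed.

Lemma overlap_map i j p : chart_dom A i p -> chart_dom A j p -> overlap i j (chart_map A i p).
Proof. by move=> Di Dj; split; [exists p|rewrite chart_mapK]. Qed.

Lemma chart_image_half i : chart_image A i `<=` half_space.
Proof. exact: chart_map_half. Qed.

Definition lift i D (h : V -> R) (p : M) : R :=
  if pselect (chart_dom A i p /\ D (chart_map A i p)) then h (chart_map A i p) else 0.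

Lemma lift_in i D h p : chart_dom A i p -> D (chart_map A i p) ->
  lift i D h p = h (chart_map A i p).
Proof. by move=> Dp Ep; rewrite /lift; case: pselect => // -[]. Qed.

Lemma lift_out i D h a b p : (forall x, D x -> ~ box a b x -> h x = 0) ->
  box a b `<=` chart_image A i -> ~ chart_box A i a b p -> lift i D h p = 0.
Proof.
move=> h0 ab np; rewrite /lift; case: pselect => // -[Dp Ep].
by apply: h0 => // Bp; apply: np; apply/chart_boxP.
Qed.

Lemma lift_inv i D h x : chart_image A i x -> D x -> lift i D h (chart_inv A i x) = h x.
Proof. by move=> /chart_invP [d E] Dx; rewrite lift_in // E. Qed.

Lemma lift_smooth_at i j D h a b : D `<=` chart_image A i -> relopen D ->
  box a b `<=` chart_image A i -> (forall x, box a b x -> overlap i j x -> D x) ->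
  smooth_on D h -> (forall x, D x -> ~ box a b x -> h x = 0) ->
  smooth_on (chart_image A j) (lift i D h \o chart_inv A j).
Proof.
move=> Di rD bi bD sh h0.
apply: smooth_on_local => [|x Ix]; first exact: chart_image_half.
have [xb|nb] := pselect (chart_box A i a b (chart_inv A j x)); last first.
  exists [set y | chart_image A j y /\ (~` chart_box A i a b) (chart_inv A j y)]; split.
  - apply: chart_preimage_relopen; apply: closed_openC; exact: (chart_box_closed hM bi).
  - by split.
  - apply: (@eq_smooth_on _ _ _ (fun=> 0)); last exact: smooth_on_cst.
    by move=> y [_ [_ ny]] /=; rewrite (lift_out h0 bi ny).
have [Dp Bp] := (chart_boxP bi _).1 xb.
have [Q [oQ DE]] := rD.
have DQ y : chart_image A i y -> D y <-> Q y.
  by move=> /chart_image_half Hy; rewrite DE; split=> [[]|].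
exists [set y | chart_image A j y /\ (chart_dom A i `&` chart_map A i @^-1` Q) (chart_inv A j y)]; split.
- exact/chart_preimage_relopen/chart_map_open.
- split=> //; split=> //; apply/DQ; first by exists (chart_inv A j x).
  by apply: bD => //; apply: overlap_map => //; exact: (chart_invP Ix).1.
- have sub y : (chart_image A j `&` [set y | chart_image A j y /\
      (chart_dom A i `&` chart_map A i @^-1` Q) (chart_inv A j y)]) y ->
      overlap j i y /\ D (transition j i y).
    by move=> [_ [Iy [Dy Qy]]]; split=> //; apply/DQ => //; exists (chart_inv A j y).
  apply: (@eq_smooth_on _ _ _ (h \o transition j i)).
    by move=> y /sub [[Iy Dy] ty] /=; rewrite lift_in.
  apply: (smooth_on_comp sh) => [k|y /sub []//].
  by apply: (smooth_onW _ (@overlap_smooth j i k)) => y /sub [].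
Qed.

Lemma lift_smooth i D h a b : D `<=` chart_image A i -> relopen D -> box a b `<=` D ->
  smooth_on D h -> (forall x, D x -> ~ box a b x -> h x = 0) -> rsmooth (lift i D h).
Proof.
move=> Di rD bD sh h0 j; apply: (lift_smooth_at Di rD _ _ sh h0) => [x /bD /Di //|x Bx _].
exact: bD.
Qed.

End ManifoldFunctions.

Section Geometry.
Context {R : realType} {n : nat} {M : ptopologicalType} {I : finType}.
Context (A : atlas R n M I) (G : I -> 'rV[R]_n -> 'M[R]_n).
Context (hM : hausdorff_space M) (mG : riemannian_metric A G).
Local Notation V := 'rV[R]_n.
Implicit Types (i : I) (p : M) (f g : M -> R) (x y : V).

Lemma chain_rule i (j : I) f x k : rsmooth A f -> overlap A i j x ->
  rpartial k (f \o chart_inv A i) x =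
  \sum_a rpartial a (f \o chart_inv A j) (transition A i j x) * Defs.jacobian A i j x k a.
Proof.
move=> sf Ox; have rO := overlap_relopen A i j.
transitivity (rpartial k ((f \o chart_inv A j) \o transition A i j) x).
  apply: (rpartial_eq k rO _ Ox) => [y Oy|]; first by rewrite /= transition_inv.
  by apply: (smooth_onW _ (sf i)) => y [].
rewrite (rpartial_comp k rO (chart_image_relopen A j) Ox (sf j)) //.
- by apply: eq_bigr => a _; rewrite mxE.
- by move=> a; exact: overlap_smooth.
- by move=> y; exact: transition_image.
Qed.

Lemma jacobian_metric i (j : I) x : overlap A i j x ->
  G i x = Defs.jacobian A i j x *m G j (transition A i j x) *m (Defs.jacobian A i j x)^T.
Proof.
move=> [Ix Dj]; have [Di E] := chart_invP Ix.
by have := metric_change mG Di Dj; rewrite E.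
Qed.

Lemma metric_unitmx i x : chart_image A i x -> G i x \in unitmx.
Proof. by move=> Ix; apply: posdef_unitmx; exact: (metric_pos mG). Qed.

Lemma jacobian_unitmx i (j : I) x : overlap A i j x -> Defs.jacobian A i j x \in unitmx.
Proof.
move=> Ox; have := metric_unitmx (proj1 Ox).
by rewrite (jacobian_metric Ox) !unitmx_mul -andbA => /andP[].
Qed.

(* In another chart the first coordinate would have a vanishing differential at
   an interior minimum, while the transition map is invertible. *)
Lemma chart_interior i p : chart_dom A i p -> ~ half_space_boundary (chart_map A i p) ->
  minterior A p.
Proof.
move=> Di nb [j Dj [Hy [k [k0 yk]]]]; set x := chart_map A i p in nb.
have Ox : overlap A i j x by exact: overlap_map.
have tx : transition A i j x = chart_map A j p by rewrite /transition /= /x chart_mapK.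
have J0 l : Defs.jacobian A i j x l k = 0.
  rewrite mxE -[rpartial _ _ _]/(rpartial l (fun y => transition A i j y ord0 k) x).
  apply: (@rpartial_min0 _ _ (overlap A i j)) => //; first exact: overlap_relopen.
  - exact: overlap_smooth.
  - by apply: interior_tangent nb; apply: chart_image_half (proj1 Ox).
  - move=> y /transition_image /chart_image_half Ty.
    by rewrite tx yk; exact: Ty.
have E : Defs.jacobian A i j x *m (delta_mx k 0 : 'cV_n) = 0.
  by apply/matrixP => l m; rewrite -colE mxE J0 mxE.
have /matrixP /(_ k 0) : (delta_mx k 0 : 'cV[R]_n) = 0.
  by rewrite -[LHS](mulKmx (jacobian_unitmx Ox)) E mulmx0.
by rewrite !mxE !eqxx => /eqP; rewrite oner_eq0.
Qed.

Definition grad_form i (f g : V -> R) x : R :=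
  \sum_j \sum_k invmx (G i x) j k * rpartial k f x * rpartial j g x.

Lemma grad_formE i (f g : V -> R) x : grad_form i f g x =
  ((\row_k rpartial k g x) *m invmx (G i x) *m (\row_k rpartial k f x)^T) ord0 ord0.
Proof.
rewrite mxE /grad_form exchange_big /=; apply: eq_bigr => k _.
rewrite !mxE mulr_suml; apply: eq_bigr => j _; rewrite !mxE; ring.
Qed.

Lemma grad_form_change i (j : I) f g x : rsmooth A f -> rsmooth A g -> overlap A i j x ->
  grad_form i (f \o chart_inv A i) (g \o chart_inv A i) x =
  grad_form j (f \o chart_inv A j) (g \o chart_inv A j) (transition A i j x).
Proof.
move=> sf sg Ox; rewrite !grad_formE; set y := transition A i j x.
set J := Defs.jacobian A i j x; have uJ : J \in unitmx := jacobian_unitmx Ox.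
have uG : G j y \in unitmx := metric_unitmx (transition_image Ox).
have dE h : rsmooth A h -> \row_k rpartial k (h \o chart_inv A i) x =
    (\row_k rpartial k (h \o chart_inv A j) y) *m J^T.
  move=> sh; apply/rowP => k; rewrite !mxE (chain_rule k sh Ox).
  by apply: eq_bigr => a _; rewrite !mxE.
have iG : invmx (G i x) = invmx J^T *m invmx (G j y) *m invmx J.
  apply: (can_inj (mulKmx (metric_unitmx (proj1 Ox)))).
  rewrite mulmxV ?(metric_unitmx (proj1 Ox))// (jacobian_metric Ox) -/J -/y !mulmxA.
  by rewrite mulmxK ?unitmx_tr// mulmxK // mulmxV.
rewrite (dE f sf) (dE g sg) iG trmx_mul trmxK !mulmxA mulmxK ?unitmx_tr//.
by rewrite mulmxKV.
Qed.

Definition lap_chart i (f : V -> R) x : R :=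
  - ((sqrt_det G i x)^-1 * \sum_j rpartial j (fun y =>
       \sum_k sqrt_det G i y * invmx (G i y) j k * rpartial k f y) x).

Definition flux i (j : 'I_n) (f : V -> R) y : R :=
  \sum_k sqrt_det G i y * invmx (G i y) j k * rpartial k f y.

Lemma smooth_on_flux D i (j : 'I_n) (f : V -> R) : relopen D -> D `<=` chart_image A i ->
  smooth_on D f -> smooth_on D (flux i j f).
Proof.
move=> rD Di sf; apply: smooth_on_bigsum => k _; apply: smooth_onM; last exact: smooth_on_rpartial.
apply: smooth_onM; first exact: (smooth_onW Di (smooth_on_sqrt_det mG (i := i))).
exact: (smooth_onW Di (smooth_on_metric_inv mG (i := i) j k)).
Qed.

Lemma smooth_on_lap_chart D i (f : V -> R) : relopen D -> D `<=` chart_image A i ->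
  smooth_on D f -> smooth_on D (lap_chart i f).
Proof.
move=> rD Di sf; apply: smooth_onN; apply: smooth_onM.
  apply: smooth_onV => [x /Di Ix|]; first by rewrite gt_eqF // (sqrt_det_gt0 mG).
  exact: (smooth_onW Di (smooth_on_sqrt_det mG (i := i))).
by apply: smooth_on_bigsum => j _; apply: smooth_on_rpartial => //; exact: smooth_on_flux.
Qed.

Lemma smooth_on_grad_form D i (f g : V -> R) : relopen D -> D `<=` chart_image A i ->
  smooth_on D f -> smooth_on D g -> smooth_on D (grad_form i f g).
Proof.
move=> rD Di sf sg; apply: smooth_on_bigsum => j _; apply: smooth_on_bigsum => k _.
apply: smooth_onM; last exact: smooth_on_rpartial.
apply: smooth_onM; last exact: smooth_on_rpartial.
exact: (smooth_onW Di (smooth_on_metric_inv mG (i := i) j k)).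
Qed.

Lemma lap_chart_eq D i (f g : V -> R) x : relopen D -> D `<=` chart_image A i ->
  smooth_on D f -> (forall y, D y -> f y = g y) -> D x -> lap_chart i f x = lap_chart i g x.
Proof.
move=> rD Di sf fg Dx; rewrite /lap_chart; congr (- (_ * _)); apply: eq_bigr => j _.
apply: (rpartial_eq j rD _ Dx) => [y Dy|]; last exact: smooth_on_flux.
by apply: eq_bigr => k _; rewrite (rpartial_eq k rD fg Dy).
Qed.

Lemma hint_energy D i x s (f b : V -> R) : relopen D -> D `<=` chart_image A i ->
  half_space x -> 0 < s -> hbox x s `<=` D -> smooth_on D f -> smooth_on D b ->
  (forall y, hbox x s y -> (exists k, `|y ord0 k - x ord0 k| = s) \/ half_space_boundary y -> b y = 0) ->
  hint x s (fun y => lap_chart i f y * b y * sqrt_det G i y) =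
  hint x s (fun y => grad_form i f b y * sqrt_det G i y).
Proof.
move=> rD Di Hx s0 sD sf sb b0.
have sF j : smooth_on D (flux i j f) by exact: smooth_on_flux.
have sFb j : smooth_on D (fun y => flux i j f y * b y) by exact: smooth_onM.
have I0 j : hint x s (rpartial j (fun y => flux i j f y * b y)) = 0.
  apply: (hint_ibp rD Hx s0 sD (sFb j)) => y By H.
  by rewrite b0 ?mulr0//; case: H => [H|]; [left; exists j|right].
have sw : smooth_on D (sqrt_det G i) by exact: (smooth_onW Di (smooth_on_sqrt_det mG (i := i))).
have sl := smooth_on_lap_chart rD Di sf.
have sg := smooth_on_grad_form rD Di sf sb.
have S0 : hint x s (fun y => \sum_j rpartial j (fun y => flux i j f y * b y) y) = 0.
  rewrite (@hint_sum _ _ D) //; last by move=> j _; exact: smooth_on_rpartial.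
  by rewrite big1.
have E y : D y -> \sum_j rpartial j (fun y => flux i j f y * b y) y =
    - 1 * (lap_chart i f y * b y * sqrt_det G i y) + grad_form i f b y * sqrt_det G i y.
  move=> Dy; have w0 : sqrt_det G i y != 0 by rewrite gt_eqF // (sqrt_det_gt0 mG (Di y Dy)).
  transitivity (\sum_j (rpartial j (flux i j f) y * b y + flux i j f y * rpartial j b y)).
    by apply: eq_bigr => j _; rewrite (rpartialM j rD Dy).
  rewrite big_split /= -mulr_suml; congr (_ + _).
    have -> : lap_chart i f y = - ((sqrt_det G i y)^-1 * \sum_j rpartial j (flux i j f) y) by [].
    move: w0; set W := sqrt_det G i y; move: (\sum_j _) => S W0.
    by field.
  rewrite /grad_form mulr_suml; apply: eq_bigr => j _.
  by rewrite !mulr_suml; apply: eq_bigr => k _; ring.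
have S0' : hint x s (fun y => - 1 * (lap_chart i f y * b y * sqrt_det G i y) + grad_form i f b y * sqrt_det G i y) = 0.
  by rewrite -S0; apply: eq_bint => y By; rewrite E //; exact: sD.
move: S0'; rewrite (hintD sD); [|by smooth|by smooth].
rewrite (hintZ _ sD); last by smooth.
by move=> H; lra.
Qed.

End Geometry.

Section Vanishing.
Context {R : realType} {n : nat}.
Local Notation V := 'rV[R]_n.
Implicit Types (D : set V) (f : V -> R) (x y : V) (s : R).

Lemma smooth_on_near D f x e : relopen D -> D x -> smooth_on D f -> 0 < e ->
  exists2 s, 0 < s & hbox x s `<=` [set y | D y /\ `|f y - f x| < e].
Proof.
move=> rD Dx sf e0; apply: relopen_hbox; last by rewrite /= subrr normr0.
have /open_subspaceP [U oU UE] : open ((fun y => `|f y - f x|) @^-1` [set t : R | t < e] : set (subspace D)).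
  apply: open_comp; last exact: open_lt.
  move=> y _; exact: (within_continuous_norm (smooth_on_continuous (smooth_onB sf (smooth_on_cst (f x))))).
have -> : [set y | D y /\ `|f y - f x| < e] = U `&` D.
  by rewrite UE; apply/seteqP; split=> y [].
exact: relopen_openI.
Qed.

Lemma plateau_out x s y : 0 < s -> half_space y -> ~ hbox x (2 * s) y -> plateau x s y = 0.
Proof.
move=> s0 Hy nb; have [H|/existsNP [k /negP H]] := pselect (forall k, `|y ord0 k - x ord0 k| <= 2 * s).
  by exfalso; apply: nb; apply/hboxP.
by apply: (plateau0 (k := k) s0); rewrite -ltNge in H; exact: ltW.
Qed.

Lemma hbox_side_gt0 x s : half_space x -> 0 < s ->
  0 < \prod_k (hbox_hi x s ord0 k - hbox_lo x s ord0 k).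
Proof.
move=> Hx s0; apply: prodr_gt0 => k _; rewrite !mxE subr_gt0; case: eqP => [/Hx xk|_].
  by rewrite gt_max ltr_wpDl //= ltrD2l gtrN.
by rewrite ltrD2l gtrN.
Qed.

Lemma hint_sqr_eq0 D x s (h w : V -> R) : relopen D -> D x -> 0 < s ->
  hbox x (2 * s) `<=` D -> smooth_on D h -> smooth_on D w -> (forall y, D y -> 0 < w y) ->
  hint x (2 * s) (fun y => h y * (h y * plateau x s y) * w y) = 0 -> h x = 0.
Proof.
move=> rD Dx s0 sD sh sw w0 I0; apply/eqP; apply: contraT => hx.
have Hx := relopen_half rD Dx.
pose F y := h y * h y * w y.
have sF : smooth_on D F by rewrite /F; smooth.
have Fx : 0 < F x by rewrite mulr_gt0 ?w0// -expr2 exprn_even_gt0.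
have Fx2 : 0 < F x / 2 by rewrite divr_gt0.
have [t t0 Ht] := smooth_on_near rD Dx sF Fx2.
pose r := Num.min t s.
have r0 : 0 < r by rewrite lt_min t0.
have rt : r <= t by rewrite ge_min lexx.
have rs : r <= s by rewrite ge_min lexx orbT.
have rs2 : r <= 2 * s by lra.
have sp : smooth_on D (plateau x s) by exact: smooth_on_plateau.
have lo : hint x r (fun=> F x / 2) <= hint x r (fun y => h y * (h y * plateau x s y) * w y).
  apply: (@hint_le _ _ D); [by move=> y /(hbox_subset rs2)/sD|by smooth|by smooth|move=> y By].
  rewrite plateau1 //; last by move=> k; apply: le_trans rs; exact: ((hboxP _ _ _).1 By).2.
  have [_] := Ht y (hbox_subset rt By).
  by rewrite mulr1 -/(F y) ltr_norml => /andP[]; lra.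
have hi : hint x r (fun y => h y * (h y * plateau x s y) * w y) <= 0.
  rewrite -[leRHS]I0; apply: (hint_subset rs2 sD); first by smooth.
  move=> y /sD/w0/ltW wy; apply: mulr_ge0 => //; rewrite mulrA; apply: mulr_ge0; last exact: plateau_ge0.
  exact: sqr_ge0.
have := le_trans lo hi; rewrite /hint bint_cst; last first.
  by move=> k; rewrite !mxE; case: eqP => [/Hx xk|_]; rewrite ?ge_max; lra.
by rewrite leNgt mulr_gt0 //; exact: hbox_side_gt0.
Qed.

End Vanishing.

Section LaplacianInvariance.
Context {R : realType} {n : nat} {M : ptopologicalType} {I : finType}.
Context (A : atlas R n M I) (G : I -> 'rV[R]_n -> 'M[R]_n).
Context (vol : {measure set (borel M) -> \bar R}).
Context (hM : hausdorff_space M) (mG : riemannian_metric A G) (volG : riemannian_volume A G vol).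
Local Notation V := 'rV[R]_n.
Implicit Types (i : I) (p : M) (f g e : M -> R) (x y : V).

Definition chart_cube i x s : set M := chart_box A i (hbox_lo x s) (hbox_hi x s).

Lemma chart_cubeP i x s p : hbox x s `<=` chart_image A i ->
  chart_cube i x s p <-> chart_dom A i p /\ hbox x s (chart_map A i p).
Proof. by move=> xs; exact: chart_boxP. Qed.

Lemma vol_hint i x s e : hbox x s `<=` chart_image A i -> rsmooth A e ->
  (forall p, ~ chart_cube i x s p -> e p = 0) ->
  Rintegral vol setT e = hint x s (fun y => e (chart_inv A i y) * sqrt_det G i y).
Proof.
move=> xs se e0; rewrite /Rintegral.
have -> : (\int[vol]_(p in setT) (e p)%:E = \int[vol]_(p in chart_cube i x s) (e p)%:E)%E.
  rewrite [RHS]integral_mkcond; apply: eq_integral => p _; rewrite patchE.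
  by case: ifPn => // /negP np; rewrite e0 // => /mem_set.
rewrite (vol_integral hM mG volG xs) //.
by apply: measurable_funTS; exact: rsmooth_measurable.
Qed.

Lemma hint_le_vol i x s e : hbox x s `<=` chart_image A i -> rsmooth A e ->
  (forall p, 0 <= e p) ->
  ((hint x s (fun y => e (chart_inv A i y) * sqrt_det G i y))%:E <=
   \int[vol]_(p in [set: borel M]) (e p)%:E)%E.
Proof.
move=> xs se e0.
have -> : ((hint x s (fun y => e (chart_inv A i y) * sqrt_det G i y))%:E =
    \int[vol]_(p in chart_cube i x s) (e p)%:E)%E.
  rewrite (vol_integral hM mG volG xs); last first.
    by apply: measurable_funTS; exact: rsmooth_measurable.
  rewrite /hint bintE //; apply: (smooth_on_box xs); apply: smooth_onM; first exact: se.
  exact: smooth_on_sqrt_det.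
apply: ge0_subset_integral => //.
- exact: (chart_box_measurable hM xs).
- by apply/measurable_EFinP; exact: rsmooth_measurable.
- by move=> p _; rewrite lee_fin.
Qed.

Lemma grad_form_local D i (f b : V -> R) x : relopen D -> D x ->
  (forall y, D y -> b y = 0) -> grad_form G i f b x = 0.
Proof.
move=> rD Dx b0; apply: big1 => j _; apply: big1 => k _.
by rewrite (rpartial_local j rD Dx b0) mulr0.
Qed.

Lemma chart_cube_open_compl i j x s : hbox x s `<=` chart_image A i ->
  relopen [set y | chart_image A j y /\ (~` chart_cube i x s) (chart_inv A j y)].
Proof.
move=> xs; apply: chart_preimage_relopen; apply: closed_openC.
exact: (chart_box_closed hM xs).
Qed.

Lemma lap_chart_change i (j : I) f x : rsmooth A f -> overlap A i j x ->
  ~ half_space_boundary x ->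
  lap_chart G i (f \o chart_inv A i) x =
  lap_chart G j (f \o chart_inv A j) (transition A i j x).
Proof.
move=> sf Ox nbx; pose D := overlap A i j; pose y := transition A i j x.
have rD : relopen D by exact: overlap_relopen.
have Di : D `<=` chart_image A i by move=> z [].
have [Ix Djx] := Ox; have Hx := chart_image_half Ix.
have [Dix Ex] := chart_invP Ix.
have Iy : chart_image A j y by exact: transition_image.
have Hy := chart_image_half Iy.
have nby : ~ half_space_boundary y.
  have := @chart_interior _ _ _ _ A G mG i (chart_inv A i x) Dix.
  by rewrite Ex => /(_ nbx) mx yb; apply: mx; exists j.
have [t1 t10 Ht1] := relopen_hbox (chart_image_relopen A j) Iy.
have [t2 t20 Ht2] := hbox_interior Hy nby.
pose t := Num.min t1 t2; have t0 : 0 < t by rewrite lt_min t10.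
have yt : hbox y t `<=` chart_image A j by move=> z /(hbox_subset (s' := t1)); rewrite ge_min lexx => /(_ isT)/Ht1.
have nbt z : hbox y t z -> ~ half_space_boundary z.
  by move=> /(hbox_subset (s' := t2)); rewrite ge_min lexx orbT => /(_ isT)/Ht2.
pose W := chart_dom A j `&` chart_map A j @^-1` (ball y (t / 2)).
have oW : open W by apply: chart_map_open; exact: ball_open.
have Wx : W (chart_inv A i x) by split=> //; apply: ballxx; rewrite divr_gt0.
have [s1 s10 Hs1] := relopen_hbox (chart_preimage_relopen A i oW) (conj Ix Wx).
have [s2 s20 Hs2] := hbox_interior Hx nbx.
pose s := Num.min s1 s2 / 2; have s0 : 0 < s by rewrite divr_gt0 // lt_min s10.
have s2E : 2 * s = Num.min s1 s2 by rewrite /s mulrC divfK.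
have xsW z : hbox x (2 * s) z -> D z /\ hbox y (t / 2) (transition A i j z).
  move=> /(hbox_subset (s' := s1)); rewrite s2E ge_min lexx => /(_ isT)/Hs1 [Iz [Dz Bz]].
  split=> //; apply/hboxP; split; first by apply: (@chart_image_half _ _ _ _ A j); exists (chart_inv A i z).
  move=> k; move: Bz; rewrite -ball_normE /= => /mx_norm_ltP -/(_ _ k).
  by rewrite divr_gt0 // !mxE distrC => /(_ isT)/ltW.
have nbs z : hbox x (2 * s) z -> ~ half_space_boundary z.
  by move=> /(hbox_subset (s' := s2)); rewrite s2E ge_min lexx orbT => /(_ isT)/Hs2.
have xsD : hbox x (2 * s) `<=` D by move=> z /xsW[].
have xsi : hbox x (2 * s) `<=` chart_image A i by move=> z /xsD/Di.
pose fi := f \o chart_inv A i; pose fj := f \o chart_inv A j.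
have sli : smooth_on (chart_image A i) (lap_chart G i fi).
  by apply: (smooth_on_lap_chart mG) => //; exact: chart_image_relopen.
have slj : smooth_on (chart_image A j) (lap_chart G j fj).
  by apply: (smooth_on_lap_chart mG) => //; exact: chart_image_relopen.
have slt : smooth_on D (lap_chart G j fj \o transition A i j).
  apply: (smooth_on_comp slj); first by move=> a; exact: overlap_smooth.
  by move=> z; exact: transition_image.
pose h z := lap_chart G i fi z - lap_chart G j fj (transition A i j z).
have sh : smooth_on D h by exact: (smooth_onB (smooth_onW Di sli) slt).
pose hp z := h z * plateau x s z.
have shp : smooth_on D hp by apply: smooth_onM => //; exact: smooth_on_plateau.
have hp0 z : D z -> ~ hbox x (2 * s) z -> hp z = 0.
  by move=> Dz nz; rewrite /hp (plateau_out s0) ?mulr0//; exact: chart_image_half (Di z Dz).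
pose b := lift A i D hp.
have sb : rsmooth A b by exact: (lift_smooth hM Di rD xsD shp hp0).
have cubes p : chart_cube i x (2 * s) p -> chart_dom A i p /\ D (chart_map A i p) /\
    chart_cube j y t p /\ hbox y (t / 2) (chart_map A j p).
  move=> /(chart_cubeP _ xsi) [Dp Bp]; have [Dm Tm] := xsW _ Bp.
  have Tp : transition A i j (chart_map A i p) = chart_map A j p by rewrite /transition /= chart_mapK.
  have Djp : chart_dom A j p by case: Dm => _; rewrite chart_mapK.
  rewrite Tp in Tm; split=> //; split=> //; split=> //.
  by apply/(chart_cubeP _ yt); split=> //; apply: hbox_subset Tm; rewrite ler_pdivrMr // ler_pMr // ler1n.
have s20' : 0 < 2 * s by rewrite mulr_gt0.
have bO p : ~ chart_cube i x (2 * s) p -> b p = 0 by exact: (lift_out hp0 xsi).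
have bi z : hbox x (2 * s) z -> b (chart_inv A i z) = hp z.
  by move=> Bz; apply: lift_inv; [exact: xsi|exact: xsD].
have gi0 z : D z -> ~ hbox x (2 * s) z -> grad_form G i fi (b \o chart_inv A i) z = 0.
  move=> Dz nz; have [Dz' Ez] := chart_invP (Di z Dz).
  apply: (grad_form_local _ _ (chart_cube_open_compl i xsi)); last by move=> z' [_ /bO].
  by split; [exact: Di|move=> /(chart_cubeP _ xsi); rewrite Ez => -[]].
have gj0 z : chart_image A j z -> ~ chart_cube i x (2 * s) (chart_inv A j z) ->
    grad_form G j fj (b \o chart_inv A j) z = 0.
  move=> Iz nz; apply: (grad_form_local _ _ (chart_cube_open_compl j xsi)); first by split.
  by move=> z' [_ /bO].
pose e1 := lift A i D (grad_form G i fi (b \o chart_inv A i)).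
have sgi : smooth_on D (grad_form G i fi (b \o chart_inv A i)).
  apply: (smooth_on_grad_form mG rD Di); [exact: smooth_onW Di (sf i)|exact: smooth_onW Di (sb i)].
have se1 : rsmooth A e1 by exact: (lift_smooth hM Di rD xsD sgi gi0).
have e1O p : ~ chart_cube i x (2 * s) p -> e1 p = 0 by exact: (lift_out gi0 xsi).
have e1j z : chart_image A j z -> e1 (chart_inv A j z) = grad_form G j fj (b \o chart_inv A j) z.
  move=> Iz; have [cz|nz] := pselect (chart_cube i x (2 * s) (chart_inv A j z)); last by rewrite e1O // gj0.
  have [Dp [Dm _]] := cubes _ cz.
  have Tz : transition A i j (chart_map A i (chart_inv A j z)) = z.
    by rewrite /transition /= chart_mapK //; have [] := chart_invP Iz.
  have := grad_form_change mG sf sb Dm; rewrite Tz => <-; exact: lift_in.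
pose l2 z := lap_chart G j fj (transition A i j z) * hp z.
have sl2 : smooth_on D l2 by exact: (smooth_onM slt shp).
have l20 z : D z -> ~ hbox x (2 * s) z -> l2 z = 0 by move=> Dz nz; rewrite /l2 hp0 ?mulr0.
pose e2 := lift A i D l2.
have se2 : rsmooth A e2 by exact: (lift_smooth hM Di rD xsD sl2 l20).
have e2O p : ~ chart_cube i x (2 * s) p -> e2 p = 0 by exact: (lift_out l20 xsi).
have e2j z : chart_image A j z -> e2 (chart_inv A j z) = lap_chart G j fj z * b (chart_inv A j z).
  move=> Iz; have [cz|nz] := pselect (chart_cube i x (2 * s) (chart_inv A j z)); last first.
    by rewrite e2O // bO // mulr0.
  have [Dp [Dm _]] := cubes _ cz.
  have Tz : transition A i j (chart_map A i (chart_inv A j z)) = z.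
    by rewrite /transition /= chart_mapK //; have [] := chart_invP Iz.
  by rewrite /e2 /b (lift_in _ Dp Dm) (lift_in _ Dp Dm) /l2 Tz.
have cubej p : ~ chart_cube j y t p -> ~ chart_cube i x (2 * s) p.
  by move=> np /cubes [_ [_ []]].
have E1 : hint x (2 * s) (fun z => lap_chart G i fi z * b (chart_inv A i z) * sqrt_det G i z) =
    hint x (2 * s) (fun z => grad_form G i fi (b \o chart_inv A i) z * sqrt_det G i z).
  apply: (hint_energy mG (chart_image_relopen A i) (@subset_refl _ _) Hx s20' xsi (sf i) (sb i)).
  move=> z Bz [[k zk]|/(nbs z Bz)//]; rewrite /= bi // /hp (plateau0 (k := k)) ?mulr0//.
  by rewrite zk.
have E3 : hint y t (fun z => lap_chart G j fj z * b (chart_inv A j z) * sqrt_det G j z) =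
    hint y t (fun z => grad_form G j fj (b \o chart_inv A j) z * sqrt_det G j z).
  apply: (hint_energy mG (chart_image_relopen A j) (@subset_refl _ _) Hy t0 yt (sf j) (sb j)).
  move=> z Bz [[k zk]|/(nbt z Bz)//] /=; apply: bO => /cubes [_ [_ [_ /hboxP [_ /(_ k)]]]].
  by have [_ ->] := chart_invP (yt z Bz); rewrite zk; lra.
have E2 : hint x (2 * s) (fun z => grad_form G i fi (b \o chart_inv A i) z * sqrt_det G i z) =
    hint y t (fun z => grad_form G j fj (b \o chart_inv A j) z * sqrt_det G j z).
  transitivity (Rintegral vol setT e1).
    rewrite (vol_hint xsi se1 e1O); apply: eq_bint => z Bz.
    by rewrite /e1 lift_inv //; [exact: xsi|exact: xsD].
  rewrite (vol_hint yt se1 (fun p np => e1O p (cubej p np))); apply: eq_bint => z Bz.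
  by rewrite e1j //; exact: yt.
have E4 : hint y t (fun z => lap_chart G j fj z * b (chart_inv A j z) * sqrt_det G j z) =
    hint x (2 * s) (fun z => l2 z * sqrt_det G i z).
  transitivity (Rintegral vol setT e2); last first.
    rewrite (vol_hint xsi se2 e2O); apply: eq_bint => z Bz.
    by rewrite /e2 lift_inv //; [exact: xsi|exact: xsD].
  rewrite (vol_hint yt se2 (fun p np => e2O p (cubej p np))); apply: eq_bint => z Bz.
  by rewrite e2j //; exact: yt.
have sw : smooth_on D (sqrt_det G i) by exact: (smooth_onW Di (smooth_on_sqrt_det mG (i := i))).
have sli' : smooth_on D (lap_chart G i fi) by exact: smooth_onW Di sli.
have E5 : hint x (2 * s) (fun z => h z * (h z * plateau x s z) * sqrt_det G i z) = 0.
  have E6 : hint x (2 * s) (fun z => lap_chart G i fi z * b (chart_inv A i z) * sqrt_det G i z) =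
      hint x (2 * s) (fun z => lap_chart G i fi z * hp z * sqrt_det G i z).
    by apply: eq_bint => z Bz; rewrite bi.
  transitivity (hint x (2 * s) (fun z => lap_chart G i fi z * hp z * sqrt_det G i z +
     (-1) * (l2 z * sqrt_det G i z))).
    apply: eq_bint => z _; rewrite -[h z * plateau x s z]/(hp z) {1}/h /l2.
    move: (lap_chart G i fi z) (lap_chart G j fj (transition A i j z)) (hp z) (sqrt_det G i z) => c1 c2 c3 c4.
    by ring.
  have s1' : smooth_on D (fun z => lap_chart G i fi z * hp z * sqrt_det G i z).
    exact: (smooth_onM (smooth_onM sli' shp) sw).
  have s2' : smooth_on D (fun z => l2 z * sqrt_det G i z) by exact: (smooth_onM sl2 sw).
  rewrite (hintD xsD s1' (smooth_onM (smooth_on_cst (-1)) s2')) (hintZ _ xsD s2').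
  have -> := etrans (esym E4) (etrans E3 (etrans (esym E2) (etrans (esym E1) E6))).
  by rewrite mulN1r subrr.
have := hint_sqr_eq0 rD Ox s0 xsD sh sw (fun z Dz => sqrt_det_gt0 mG (Di z Dz)) E5.
by move=> /eqP; rewrite subr_eq0 => /eqP.
Qed.

End LaplacianInvariance.

(** * Eigenvalue equation and Dirichlet condition *)

Section ComplexParts.
Context {R : realType}.
Implicit Types (c : bool) (z : R[i]).

Definition part c z : R := if c then complex.Re z else complex.Im z.

Lemma partD c z z' : part c (z + z') = part c z + part c z'.
Proof. by case: c; case: z; case: z'. Qed.

Lemma partN c z : part c (- z) = - part c z.
Proof. by case: c; case: z. Qed.

Lemma part0 c : part c 0 = 0.
Proof. by case: c. Qed.

Lemma part_sum (J : Type) (s : seq J) (P : pred J) c (F : J -> R[i]) :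
  part c (\sum_(j <- s | P j) F j) = \sum_(j <- s | P j) part c (F j).
Proof. by apply: big_morph => [z z'|]; [exact: partD|exact: part0]. Qed.

Lemma part_realM c (r : R) z : part c (r%:C * z) = r * part c z.
Proof. by case: c; case: z => a b /=; rewrite !mul0r ?subr0 ?addr0. Qed.

Lemma part_Mreal c (r : R) z : part c (z * r%:C) = part c z * r.
Proof. by rewrite mulrC part_realM mulrC. Qed.

Lemma part_ext z z' : (forall c, part c z = part c z') -> z = z'.
Proof. by case: z z' => a b [a' b'] H; have /= -> := H true; have /= -> := H false. Qed.

End ComplexParts.

Section CPartials.
Context {R : realType} {n : nat}.
Local Notation V := 'rV[R]_n.
Implicit Types (D : set V) (F : V -> R[i]) (a : 'I_n -> nat).

Definition multi_seq a : seq 'I_n := flatten [seq nseq (a k) k | k <- enum 'I_n].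

Lemma part_cpartial c k F x : part c (cpartial k F x) = rpartial k (fun y => part c (F y)) x.
Proof. by case: c. Qed.

Lemma part_cpartials c a F x :
  part c (cpartials a F x) = rpartials (multi_seq a) (fun y => part c (F y)) x.
Proof.
rewrite /cpartials /multi_seq; elim: (enum 'I_n) x => //= k s IH x.
rewrite rpartials_cat.
elim: (a k) x => [|m IHm] x; first exact: IH.
by rewrite iterS part_cpartial /=; congr (rpartial k _ x); apply/funext => y; exact: IHm.
Qed.

Lemma size_multi_seq a : size (multi_seq a) = (\sum_k a k)%N.
Proof.
rewrite /multi_seq size_flatten /shape -map_comp sumnE big_map big_enum.
by apply: eq_bigr => k _; rewrite /= size_nseq.
Qed.

Lemma rpartials_local D s (f : V -> R) x : relopen D -> D x -> (forall y, D y -> f y = 0) ->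
  rpartials s f x = 0.
Proof.
move=> rD Dx f0; rewrite -(rpartials0 s rD Dx); apply/esym.
by apply: (rpartials_eq s rD _ _ Dx) => [|y /f0->//]; exact: smooth_on_cst.
Qed.

Lemma cpartials_local D a F x : relopen D -> D x -> (forall y, D y -> F y = 0) ->
  cpartials a F x = 0.
Proof.
move=> rD Dx F0; apply: part_ext => c; rewrite part_cpartials part0.
by apply: (rpartials_local _ rD Dx) => y Dy; rewrite F0 // part0.
Qed.

End CPartials.

Section EigenEquation.
Context {R : realType} {n : nat} {M : ptopologicalType} {I : finType}.
Context (A : atlas R n M I) (G : I -> 'rV[R]_n -> 'M[R]_n).
Context (vol : {measure set (borel M) -> \bar R}).
Context (hM : hausdorff_space M) (mG : riemannian_metric A G) (volG : riemannian_volume A G vol).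
Local Notation V := 'rV[R]_n.
Implicit Types (i : I) (p : M) (u : M -> R[i]) (x y : V) (c : bool).

Lemma msmooth_part u c : msmooth A u -> rsmooth A (fun p => part c (u p)).
Proof. by move=> su i; have [s1 s2] := su i; case: c. Qed.

Lemma msmooth_parts u : (forall c, rsmooth A (fun p => part c (u p))) -> msmooth A u.
Proof. by move=> H i; split; [exact: (H true)|exact: (H false)]. Qed.

Lemma part_cintegral c u : part c (cintegral vol u) = Rintegral vol setT (fun p => part c (u p)).
Proof. by case: c. Qed.

Lemma part_laplacian_chart c i (F : V -> R[i]) x :
  part c (laplacian_chart G i F x) = lap_chart G i (fun y => part c (F y)) x.
Proof.
rewrite /laplacian_chart partN part_realM part_sum; congr (- (_ * _)).
apply: eq_bigr => j _; rewrite part_cpartial; congr (rpartial j _ x).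
apply/funext => y; rewrite part_sum; apply: eq_bigr => k _.
by rewrite part_realM part_cpartial.
Qed.

Lemma msmooth_real (b : M -> R) : rsmooth A b -> msmooth A (fun p => (b p)%:C).
Proof. by move=> sb i; split=> /=; [exact: sb|exact: smooth_on_cst]. Qed.

Lemma diff_operator_local k Q (phi : M -> R[i]) (W : set M) p :
  diff_operator A k Q -> msmooth A phi -> open W -> W p ->
  (forall q, W q -> phi q = 0) -> Q phi p = 0.
Proof.
move=> dQ sphi oW Wp phi0; have [i Dp] := chart_dom_cover A p.
have [c [_ Hc]] := dQ i.
have Ip : chart_image A i (chart_map A i p) by exists p.
rewrite -[p in LHS](chart_mapK Dp) (Hc _ sphi _ Ip); apply: big1 => a _.
rewrite (cpartials_local _ (chart_preimage_relopen A i oW)) ?mulr0//.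
  by split=> //; rewrite chart_mapK.
by move=> y [_ Wy]; exact: phi0.
Qed.

Lemma cube_minterior i x s : hbox x s `<=` chart_image A i ->
  (forall y, hbox x s y -> ~ half_space_boundary y) -> chart_cube A i x s `<=` minterior A.
Proof.
move=> xs nb p /(chart_cubeP _ xs) [Dp Bp].
exact: (chart_interior mG Dp (nb _ Bp)).
Qed.

Lemma eigen_interior i x c u (l : R) : msmooth A u ->
  weak_apply A vol 2 (laplacian A G) u (fun p => l%:C * u p) ->
  chart_image A i x -> ~ half_space_boundary x ->
  lap_chart G i (fun y => part c (u (chart_inv A i y))) x = l * part c (u (chart_inv A i x)).
Proof.
move=> su [_ [Q [[dQ tQ] wQ]]] Ix nbx; have Hx := chart_image_half Ix.
pose D := chart_image A i; have rD : relopen D := chart_image_relopen A i.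
pose f p := part c (u p); have sf : rsmooth A f by exact: msmooth_part.
pose fi := f \o chart_inv A i; have sfi : smooth_on D fi := sf i.
have sl : smooth_on D (lap_chart G i fi) by exact: (smooth_on_lap_chart mG rD (@subset_refl _ _)).
pose h z := l * fi z - lap_chart G i fi z.
have sh : smooth_on D h by exact: (smooth_onB (smooth_onM (smooth_on_cst l) sfi) sl).
have [s1 s10 Hs1] := relopen_hbox rD Ix.
have [s2 s20 Hs2] := hbox_interior Hx nbx.
pose s := Num.min s1 s2 / 4; have s0 : 0 < s by rewrite divr_gt0 // lt_min s10.
have s4 : 2 * (2 * s) = Num.min s1 s2 by rewrite /s; field.
have xs4 : hbox x (2 * (2 * s)) `<=` D.
  by move=> z /(hbox_subset (s' := s1)); rewrite s4 ge_min lexx => /(_ isT)/Hs1.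
have nb4 z : hbox x (2 * (2 * s)) z -> ~ half_space_boundary z.
  by move=> /(hbox_subset (s' := s2)); rewrite s4 ge_min lexx orbT => /(_ isT)/Hs2.
have s24 : hbox x (2 * s) `<=` hbox x (2 * (2 * s)) by apply: hbox_subset; lra.
have xs2 : hbox x (2 * s) `<=` D by move=> z /s24/xs4.
have nb2 z : hbox x (2 * s) z -> ~ half_space_boundary z by move=> /s24/nb4.
pose hp z := h z * plateau x s z.
have shp : smooth_on D hp by exact: (smooth_onM sh (smooth_on_plateau _ _)).
have hp0 z : D z -> ~ hbox x (2 * s) z -> hp z = 0.
  by move=> Dz nz; rewrite /hp (plateau_out s0) ?mulr0//; exact: chart_image_half Dz.
pose b := lift A i D hp.
have sb : rsmooth A b by exact: (lift_smooth hM (@subset_refl _ _) rD xs2 shp hp0).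
have bO p : ~ chart_cube A i x (2 * s) p -> b p = 0 by exact: (lift_out hp0 xs2).
have s20' : 0 < 2 * s by rewrite mulr_gt0.
have pl0 z : D z -> ~ hbox x (2 * (2 * s)) z -> plateau x (2 * s) z = 0.
  by move=> Dz nz; apply: plateau_out => //; exact: chart_image_half Dz.
pose chi := lift A i D (plateau x (2 * s)).
have schi : rsmooth A chi.
  by apply: (lift_smooth hM (@subset_refl _ _) rD xs4 _ pl0); exact: smooth_on_plateau.
have chiO p : ~ chart_cube A i x (2 * (2 * s)) p -> chi p = 0 by exact: (lift_out pl0 xs4).
have chi1 p : chart_cube A i x (2 * s) p -> chi p = 1.
  move=> /(chart_cubeP _ xs2) [Dp /[dup] Bp /hboxP [_ Hp]].
  by rewrite /chi lift_in ?plateau1//; exact: xs2.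
pose phi p := (b p)%:C; pose v p := (chi p)%:C * u p.
have sphi : msmooth A phi by exact: msmooth_real.
have partv c' p : part c' (v p) = chi p * part c' (u p) by rewrite part_realM.
have sv : msmooth A v.
  apply: msmooth_parts => c'; rewrite (_ : (fun p => _) = fun p => chi p * part c' (u p)).
    by apply: rsmoothM => //; exact: msmooth_part.
  by apply/funext => p; exact: partv.
have tphi : test_function A phi.
  split=> //; exists (chart_cube A i x (2 * s)); split.
  - exact: chart_box_compact.
  - exact: cube_minterior.
  - by move=> p /bO; rewrite /phi => ->.
have tv : test_function A v.
  split=> //; exists (chart_cube A i x (2 * (2 * s))); split.
  - exact: chart_box_compact.
  - exact: cube_minterior.
  - by move=> p /chiO; rewrite /v => ->; rewrite mul0r.
have oC : open (~` chart_cube A i x (2 * s)).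
  by apply: closed_openC; exact: (chart_box_closed hM xs2).
have main : cintegral vol (fun p => l%:C * u p * phi p) =
    cintegral vol (fun p => laplacian A G v p * phi p).
  rewrite (wQ phi tphi) (tQ v phi tv tphi); congr (cintegral vol _); apply/funext => p.
  have [cp|np] := pselect (chart_cube A i x (2 * s) p).
    by rewrite /v chi1 // mul1r.
  rewrite (diff_operator_local dQ sphi oC np) ?mulr0// => q /bO.
  by rewrite /phi => ->.
have {}main := congr1 (part c) main; rewrite !part_cintegral in main.
pose e1 p := l * f p * b p.
have se1 : rsmooth A e1 by apply: rsmoothM => //; apply: rsmoothM => //; exact: rsmooth_cst.
pose l2 z := lap_chart G i fi z * hp z.
have sl2 : smooth_on D l2 by exact: (smooth_onM sl shp).
have l20 z : D z -> ~ hbox x (2 * s) z -> l2 z = 0 by move=> Dz nz; rewrite /l2 hp0 ?mulr0.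
pose e2 := lift A i D l2.
have se2 : rsmooth A e2 by exact: (lift_smooth hM (@subset_refl _ _) rD xs2 sl2 l20).
have e2O p : ~ chart_cube A i x (2 * s) p -> e2 p = 0 by exact: (lift_out l20 xs2).
have lapv p : part c (laplacian A G v p * phi p) = e2 p.
  rewrite part_Mreal; have [cp|np] := pselect (chart_cube A i x (2 * s) p); last by rewrite bO // e2O // mulr0.
  have [Dp Bp] := (chart_cubeP _ xs2).1 cp; set z := chart_map A i p in Bp.
  have Dz : D z by exists p.
  rewrite /e2 /b (lift_in _ Dp Dz) (lift_in _ Dp Dz) -/z /l2.
  have [[k zk]|inz] := pselect (exists k, `|z ord0 k - x ord0 k| = 2 * s).
    by rewrite /hp (plateau0 (k := k)) ?zk// !mulr0.
  congr (_ * _); rewrite /laplacian part_laplacian_chart.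
  set j := projT1 _; have Dj : chart_dom A j p by rewrite /j; case: cid.
  rewrite (_ : (fun y => part c ((v \o chart_inv A j) y)) =
     (fun q => chi q * f q) \o chart_inv A j); last by apply/funext => y; rewrite /= partv.
  have sg : rsmooth A (fun q => chi q * f q) by exact: rsmoothM.
  have mp : minterior A p by exact: (cube_minterior xs2 nb2 cp).
  rewrite (lap_chart_change hM mG volG sg (overlap_map Dj Dp)); last by move=> yb; apply: mp; exists j.
  rewrite /transition /= (chart_mapK Dj) -/z.
  have rDz : relopen (ball x (2 * s) `&` D) by apply: relopen_openI => //; exact: ball_open.
  apply: (lap_chart_eq mG rDz) => [y []//||y [By Dy]|].
  - by apply: (smooth_onW _ (sg i)) => y [].
  - rewrite /= chi1 ?mul1r//; apply/(chart_cubeP _ xs2); have [Dq ->] := chart_invP Dy; split=> //.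
    apply/hboxP; split; first exact: chart_image_half Dy.
    move=> k; move: By; rewrite -ball_normE /= => /mx_norm_ltP -/(_ s20' k).
    by rewrite !mxE distrC => /ltW.
  - split=> //; rewrite -ball_normE /=; apply/mx_norm_ltP => // k; rewrite !mxE distrC.
    rewrite lt_neqAle; have [_ /(_ k) ->] := (hboxP _ _ _).1 Bp.
    by rewrite andbT; apply/eqP => zk; apply: inz; exists k.
have E1 : Rintegral vol setT e1 = Rintegral vol setT e2.
  transitivity (Rintegral vol setT (fun p => part c (laplacian A G v p * phi p))).
    by rewrite -main; apply: eq_Rintegral => p _; rewrite part_Mreal part_realM.
  by apply: eq_Rintegral => p _; exact: lapv.
have sw : smooth_on D (sqrt_det G i) := smooth_on_sqrt_det mG (i := i).
have e1O p : ~ chart_cube A i x (2 * s) p -> e1 p = 0 by move=> /bO; rewrite /e1 => ->; rewrite mulr0.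
rewrite (vol_hint hM mG volG xs2 se1 e1O) (vol_hint hM mG volG xs2 se2 e2O) in E1.
pose l1 z := l * fi z * hp z.
have sl1 : smooth_on D l1 by exact: (smooth_onM (smooth_onM (smooth_on_cst l) sfi) shp).
have E2 : hint x (2 * s) (fun z => l1 z * sqrt_det G i z) = hint x (2 * s) (fun z => l2 z * sqrt_det G i z).
  transitivity (hint x (2 * s) (fun y => e1 (chart_inv A i y) * sqrt_det G i y)).
    by apply: eq_bint => z Bz; rewrite /e1 /b (lift_inv _ (xs2 z Bz) (xs2 z Bz)).
  by rewrite E1; apply: eq_bint => z Bz; rewrite /e2 (lift_inv _ (xs2 z Bz) (xs2 z Bz)).
have E5 : hint x (2 * s) (fun z => h z * (h z * plateau x s z) * sqrt_det G i z) = 0.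
  transitivity (hint x (2 * s) (fun z => l1 z * sqrt_det G i z +
     (-1) * (l2 z * sqrt_det G i z))).
    apply: eq_bint => z _; rewrite -[h z * plateau x s z]/(hp z) {1}/h /l1 /l2.
    move: (lap_chart G i fi z) (fi z) (hp z) (sqrt_det G i z) => c1 c2 c3 c4.
    by ring.
  have s1' : smooth_on D (fun z => l1 z * sqrt_det G i z) by exact: (smooth_onM sl1 sw).
  have s2' : smooth_on D (fun z => l2 z * sqrt_det G i z) by exact: (smooth_onM sl2 sw).
  rewrite (hintD xs2 s1' (smooth_onM (smooth_on_cst (-1)) s2')) (hintZ _ xs2 s2') E2.
  by rewrite mulN1r subrr.
have := hint_sqr_eq0 rD Ix s0 xs2 sh sw (fun z Dz => sqrt_det_gt0 mG Dz) E5.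
by move=> /eqP; rewrite subr_eq0 => /eqP ->.
Qed.

Lemma eigen_chart i x c u (l : R) : msmooth A u ->
  weak_apply A vol 2 (laplacian A G) u (fun p => l%:C * u p) -> chart_image A i x ->
  lap_chart G i (fun y => part c (u (chart_inv A i y))) x = l * part c (u (chart_inv A i x)).
Proof.
move=> su wu Ix; pose D := chart_image A i; have rD : relopen D := chart_image_relopen A i.
have [xb|nb] := pselect (half_space_boundary x); last exact: eigen_interior.
have sf : smooth_on D (fun y => part c (u (chart_inv A i y))) by exact: (msmooth_part c su).
pose g y := lap_chart G i (fun y => part c (u (chart_inv A i y))) y - l * part c (u (chart_inv A i y)).
have sg : smooth_on D g.
  apply: smooth_onB; first exact: (smooth_on_lap_chart mG rD (@subset_refl _ _)).
  exact: (smooth_onM (smooth_on_cst l) sf).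
apply/eqP; rewrite -subr_eq0 -/(g x); apply: contraT => gx.
have gp : 0 < `|g x| by rewrite normr_gt0.
have [s s0 Hs] := smooth_on_near rD Ix sg gp.
have [Hx [k [k0 xk]]] := xb.
pose y := x + s *: basis_vec k.
have Hy : half_space y by apply: half_space_right => //; exact: ltW.
have yk : y ord0 k = s by rewrite !mxE !eqxx mulr1 xk add0r.
have [] : D y /\ `|g y - g x| < `|g x|.
  apply: Hs; apply/hboxP; split=> // m; rewrite !mxE eqxx /= addrAC subrr add0r normrM (gtr0_norm s0).
  by rewrite ler_piMr ?(ltW s0)//; case: (_ == _); rewrite ?normr1 ?normr0.
move=> Dy; rewrite {1}/g (eigen_interior c su wu Dy) ?subrr ?sub0r ?normrN ?ltxx//.
move=> [_ [m [m0 ym]]]; have mk : m = k by apply: val_inj; rewrite /= m0 k0.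
by move: s0; rewrite -yk -mk ym ltxx.
Qed.

End EigenEquation.

Section StripPoincare.
Context {R : realType} {n : nat}.
Local Notation V := 'rV[R]_n.

Lemma strip_poincare (D : set V) (a b : V) (k : 'I_n) (v : V -> R) (d : R) : relopen D ->
  box a b `<=` D -> 0 <= a ord0 k -> a ord0 k < b ord0 k -> b ord0 k - a ord0 k <= d ->
  smooth_on D v -> (forall y, box a b y -> y ord0 k = a ord0 k -> v y = 0) ->
  bint a b (fun y => v y * v y) <= 4 * d ^+ 2 * bint a b (fun y => rpartial k v y * rpartial k v y).
Proof.
move=> rD sD a0 ab bd sv v0.
pose g (y : V) := (y ord0 k - b ord0 k) * (v y * v y).
have sc : smooth_on D (fun y : V => y ord0 k - b ord0 k).
  exact: (smooth_onB (smooth_on_coord _) (smooth_on_cst _)).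
have sg : smooth_on D g by exact: (smooth_onM sc (smooth_onM sv sv)).
have sdv := smooth_on_rpartial k rD sv.
have sg' := smooth_on_rpartial k rD sg.
have I0 : bint a b (rpartial k g) = 0.
  rewrite -[LHS]/(fine (_)%:E) bintE; last exact: smooth_on_box sg'.
  rewrite -[RHS]/(fine 0%E); congr fine; apply: (@box_ibp _ _ _ _ k g) => //.
  - exact: smooth_on_box sg.
  - exact: smooth_on_box sg'.
  - move=> y By /andP[h1 h2]; apply: (is_derive_rpartial rD (sD y By) sg).
    by right; exact: le_lt_trans h1.
  - by move=> y By [yk|yk]; rewrite /g; [rewrite (v0 y By yk) !mulr0|rewrite yk subrr mul0r].
pose q (y : V) := (y ord0 k - b ord0 k) * (v y * rpartial k v y).
have sq : smooth_on D q by exact: (smooth_onM sc (smooth_onM sv sdv)).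
have gE y : D y -> rpartial k g y = v y * v y + 2 * q y.
  move=> Dy; rewrite /g (rpartialM k rD Dy sc (smooth_onM sv sv)) (rpartialM k rD Dy sv sv).
  rewrite (rpartialD k rD Dy (smooth_on_coord _) (smooth_on_cst _)) (rpartial_coord k k rD Dy).
  by rewrite (rpartial_cst _ k rD Dy) eqxx /= mulr1n /q; ring.
have cvv := smooth_on_box sD (smooth_onM sv sv).
have cdd := smooth_on_box sD (smooth_onM sdv sdv).
have cq := smooth_on_box sD sq.
have E : bint a b (fun y => v y * v y) + 2 * bint a b q = 0.
  rewrite -I0 -(bintZ 2 cq) -bintD //; last exact: (smooth_on_box sD (smooth_onM (smooth_on_cst 2) sq)).
  by apply: eq_bint => y By; rewrite gE //; exact: sD.
have : bint a b (fun y => (-2) * q y) <=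
    bint a b (fun y => 2^-1 * (v y * v y) + (2 * d ^+ 2) * (rpartial k v y * rpartial k v y)).
  apply: bint_le.
  - exact: (smooth_on_box sD (smooth_onM (smooth_on_cst _) sq)).
  - exact: (smooth_on_box sD (smooth_onD (smooth_onM (smooth_on_cst _) (smooth_onM sv sv))
      (smooth_onM (smooth_on_cst _) (smooth_onM sdv sdv)))).
  - move=> y By; rewrite /q; set t := _ - _; set v' := v y; set p := rpartial k v y.
    have td : t ^+ 2 <= d ^+ 2.
      have := By k => /andP[h1 h2]; rewrite -real_normK ?num_real// ler_pXn2r ?nnegrE ?normr_ge0//.
        by rewrite ler_norml /t; apply/andP; split; lra.
      by apply: le_trans bd; rewrite subr_ge0 ltW.
    have : t ^+ 2 * (p * p) <= d ^+ 2 * (p * p) by apply: ler_wpM2r => //; exact: sqr_ge0.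
    have := sqr_ge0 (v' + 2 * t * p); rewrite sqrrD; move: (d ^+ 2) => dd.
    rewrite !exprMn !expr2; set X := t * t * (p * p); move=> h1 h2.
    have -> : -2 * (t * (v' * p)) = - (v' * (2 * t * p)) by ring.
    have {}h1 : 0 <= v' * v' + (v' * (2 * t * p)) *+ 2 + 4 * X.
      by apply: le_trans h1 _; rewrite le_eqVlt; apply/orP; left; apply/eqP; rewrite /X; ring.
    move: h1 h2; rewrite -mulr_natl; move: (v' * (2 * t * p)) (v' * v') (p * p) => z1 z2 z3.
    by lra.
rewrite (bintZ _ cq) bintD; first last.
- exact: (smooth_on_box sD (smooth_onM (smooth_on_cst _) (smooth_onM sdv sdv))).
- exact: (smooth_on_box sD (smooth_onM (smooth_on_cst _) (smooth_onM sv sv))).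
rewrite (bintZ _ cvv) (bintZ _ cdd); move: E.
by move: (bint a b _) (bint a b q) (bint a b _) (d ^+ 2) => z1 z2 z3 z4; lra.
Qed.

End StripPoincare.

Section FieldOperator.
Context {R : realType} {n : nat} {M : ptopologicalType} {I : finType}.
Context (A : atlas R n M I) (G : I -> 'rV[R]_n -> 'M[R]_n).
Context (hM : hausdorff_space M) (mG : riemannian_metric A G).
Local Notation V := 'rV[R]_n.
Implicit Types (i : I) (p : M) (phi u : M -> R[i]) (x y : V) (c : bool).

Lemma lift_notin i (D : set V) (h : V -> R) p : ~ chart_dom A i p -> lift A i D h p = 0.
Proof. by move=> nDp; rewrite /lift; case: pselect => // -[]. Qed.

Lemma cpartials0 (F : V -> R[i]) : cpartials (fun=> 0%N) F = F.
Proof.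
apply/funext => y; rewrite /cpartials; elim: (enum 'I_n) => //= l s IH.
Qed.

Lemma cpartials_unit l (F : V -> R[i]) y :
  cpartials (fun k : 'I_n => (k == l) : nat) F y = cpartial l F y.
Proof.
rewrite /cpartials; have := enum_uniq 'I_n; have : l \in enum 'I_n by rewrite mem_enum.
elim: (enum 'I_n) => //= k s IH; rewrite inE => ls /andP[ks us].
have [kl|kl] := eqVneq k l; last first.
  by rewrite iter0; apply: IH => //; move: ls; rewrite eq_sym (negbTE kl).
rewrite -kl [iter _ _ _]/= (_ : foldr _ F s = F) //.
move: ks; elim: s {IH us ls} => //= m s IH; rewrite inE negb_or eq_sym => /andP[mk ks].
by rewrite kl in mk ks IH *; rewrite (negbTE mk) iter0 IH.
Qed.

Definition unit_index (l : 'I_n) : {ffun 'I_n -> 'I_2} := [ffun k => inord (k == l)].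

Lemma unit_indexE l k : unit_index l k = (k == l) :> nat.
Proof. by rewrite ffunE inordK //; case: (_ == _). Qed.

Lemma sum_unit_index l : (\sum_(k < n) unit_index l k = 1)%N.
Proof.
rewrite (bigD1 l) //= unit_indexE eqxx big1 ?addn0// => k kl.
by rewrite unit_indexE (negbTE kl).
Qed.

Lemma diff_operator_id : diff_operator A 1 (fun u => u).
Proof.
move=> i; exists (fun a _ => if a == [ffun=> ord0] then 1 else 0); split.
  move=> a; case: (a == _); split=> /=; exact: smooth_on_cst.
move=> u su y Iy; rewrite (bigD1 [ffun=> ord0]) /=; last by rewrite big1 // => k _; rewrite ffunE.
rewrite eqxx mul1r big1 ?addr0 => [|a /andP[_ /negbTE ->]]; last by rewrite mul0r.
rewrite (_ : (fun l => _) = fun=> 0%N) ?cpartials0//.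
by apply/funext => l; rewrite ffunE.
Qed.

Definition field_operator i (k : 'I_n) x s phi p : R[i] :=
  if pselect (chart_dom A i p) then
    (plateau x s (chart_map A i p))%:C * cpartial k (phi \o chart_inv A i) (chart_map A i p)
  else 0.

Lemma part_field_operator c i k x s phi p : part c (field_operator i k x s phi p) =
  lift A i (chart_image A i)
    (fun z => plateau x s z * rpartial k (fun y => part c (phi (chart_inv A i y))) z) p.
Proof.
rewrite /field_operator /lift; case: pselect => Dp; case: pselect => [H|H].
- by rewrite part_realM part_cpartial.
- by exfalso; apply: H; split=> //; exists p.
- by case: H.
- exact: part0.
Qed.

Lemma rsmooth_field_operator c i k x s phi : msmooth A phi -> 0 < s ->
  hbox x (2 * s) `<=` chart_image A i ->
  rsmooth A (fun p => part c (field_operator i k x s phi p)).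
Proof.
move=> sphi s0 xs; under eq_fun do rewrite part_field_operator.
apply: (lift_smooth hM (@subset_refl _ _) (chart_image_relopen A i) xs).
  apply: smooth_onM; first exact: smooth_on_plateau.
  by apply: smooth_on_rpartial; [exact: chart_image_relopen|exact: (msmooth_part c sphi)].
by move=> y Iy ny; rewrite plateau_out ?mul0r//; exact: chart_image_half Iy.
Qed.

Lemma diff_operator_field i k x s : 0 < s -> hbox x (2 * s) `<=` chart_image A i ->
  diff_operator A 1 (field_operator i k x s).
Proof.
move=> s0 xs j.
pose kap l y := lift A i (overlap A i j)
  (fun z => plateau x s z * Defs.jacobian A i j z k l) (chart_inv A j y).
have skap l : smooth_on (chart_image A j) (kap l).
  apply: (lift_smooth_at hM _ (overlap_relopen A i j) xs) => [y []//|y _ //||y [Iy _] ny].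
    apply: smooth_onM; first exact: smooth_on_plateau.
    have := smooth_on_rpartial k (overlap_relopen A i j) (@overlap_smooth _ _ _ _ A i j l).
    by apply: eq_smooth_on => z _; rewrite mxE.
  by rewrite plateau_out ?mul0r//; exact: chart_image_half Iy.
exists (fun a y => \sum_l (if a == unit_index l then (kap l y)%:C else 0)); split.
  move=> a; split.
    apply: (@eq_smooth_on _ _ _ (fun y => \sum_l (if a == unit_index l then kap l y else 0))).
      move=> y _; rewrite -[RHS]/(part true _) part_sum; apply: eq_bigr => l _.
      by case: (a == _).
    by apply: smooth_on_bigsum => l _; case: (a == _); [exact: skap|exact: smooth_on_cst].
  apply: (@eq_smooth_on _ _ _ (fun=> 0)); last exact: smooth_on_cst.
  move=> y _; rewrite -[RHS]/(part false _) part_sum big1 // => l _.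
  by case: (a == _).
move=> u su y Iy; set p := chart_inv A j y.
have -> : \sum_(a : {ffun 'I_n -> 'I_2} | (\sum_(l < n) a l <= 1)%N)
     (\sum_l (if a == unit_index l then (kap l y)%:C else 0)) *
     cpartials (fun l => a l : nat) (u \o chart_inv A j) y =
   \sum_l (kap l y)%:C * cpartial l (u \o chart_inv A j) y.
  under eq_bigr do rewrite mulr_suml.
  rewrite exchange_big /=; apply: eq_bigr => l _.
  rewrite (bigD1 (unit_index l)) ?sum_unit_index //= eqxx big1 ?addr0.
    rewrite -cpartials_unit; congr (_ * cpartials _ _ y); apply/funext => m.
    exact: unit_indexE.
  by move=> a /andP[_ /negbTE ->]; rewrite mul0r.
apply: part_ext => c; rewrite part_sum.
have sf := msmooth_part c su.
have [Djp Ey] := chart_invP Iy.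
have [Dp|nDp] := pselect (chart_dom A i p); last first.
  rewrite part_field_operator (lift_notin _ _ nDp).
  by rewrite big1 // => l _; rewrite part_realM /kap (lift_notin _ _ nDp) mul0r.
have Ip : chart_image A i (chart_map A i p) by exists p.
have Op : overlap A i j (chart_map A i p) by exact: overlap_map.
rewrite part_field_operator (lift_in _ Dp Ip).
have := chain_rule k sf Op; rewrite /transition /= (chart_mapK Dp) Ey => E.
rewrite (_ : rpartial k _ _ = \sum_a
  rpartial a ((fun p => part c (u p)) \o chart_inv A j) y * Defs.jacobian A i j (chart_map A i p) k a); last exact: E.
rewrite mulr_sumr; apply: eq_bigr => l _.
by rewrite part_realM part_cpartial /kap (lift_in _ Dp Op) mulrA mulrAC.
Qed.

Lemma test_function_boundary i phi y : test_function A phi -> chart_image A i y ->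
  half_space_boundary y -> phi (chart_inv A i y) = 0.
Proof.
move=> [_ [K [_ Ki K0]]] Iy yb; apply: K0 => /Ki; apply.
by have [Dp E] := chart_invP Iy; exists i => //; rewrite E.
Qed.

End FieldOperator.

Section Dirichlet.
Context {R : realType} {n : nat} {M : ptopologicalType} {I : finType}.
Context (A : atlas R n M I) (G : I -> 'rV[R]_n -> 'M[R]_n).
Context (vol : {measure set (borel M) -> \bar R}).
Context (hM : hausdorff_space M) (mG : riemannian_metric A G) (volG : riemannian_volume A G vol).
Local Notation V := 'rV[R]_n.
Implicit Types (i : I) (p : M) (phi u f : M -> R[i]) (x y : V) (c : bool).

Lemma normc_sqr (z : R[i]) : Normc.normc z ^+ 2 = part true z ^+ 2 + part false z ^+ 2.
Proof. by case: z => a b /=; rewrite sqr_sqrtr // addr_ge0 // sqr_ge0. Qed.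

Lemma part_sqr_le c (z : R[i]) : part c z ^+ 2 <= Normc.normc z ^+ 2.
Proof. by rewrite normc_sqr; case: c; rewrite ?lerDl ?lerDr sqr_ge0. Qed.

Definition mparts f := forall c, measurable_fun [set: borel M] (fun p : borel M => part c (f p)).

Lemma L2_mparts f : L2 vol f -> mparts f.
Proof. by move=> [m1 m2 _] []. Qed.

Lemma msmooth_mparts f : msmooth A f -> mparts f.
Proof. by move=> sf c; exact: (rsmooth_measurable (msmooth_part c sf)). Qed.

Lemma mparts_normc f : mparts f ->
  measurable_fun [set: borel M] (fun p : borel M => (Normc.normc (f p) ^+ 2)%:E).
Proof.
move=> mf; apply/measurable_EFinP; under eq_fun do rewrite normc_sqr.
by apply: measurable_funD; apply: measurable_funX; exact: mf.
Qed.

Lemma mpartsB f g : mparts f -> mparts g -> mparts (fun p => f p - g p).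
Proof.
move=> mf mg c; under eq_fun do rewrite partD partN.
by apply: measurable_funB; [exact: mf|exact: mg].
Qed.

Lemma L2normsq_part c f : mparts f ->
  (\int[vol]_(p in [set: borel M]) (part c (f p) ^+ 2)%:E <= L2normsq vol f)%E.
Proof.
move=> mf; apply: ge0_le_integral => //.
- by move=> p _; rewrite lee_fin sqr_ge0.
- by apply/measurable_EFinP; apply: measurable_funX; exact: mf.
- exact: mparts_normc.
- by move=> p _; rewrite lee_fin part_sqr_le.
Qed.

Lemma L2normsq_triangle f g : mparts f -> mparts g ->
  (L2normsq vol f <= 2%:E * L2normsq vol (fun p => (f p - g p)%R) + 2%:E * L2normsq vol g)%E.
Proof.
move=> mf mg; have mfg := mpartsB mf mg.
have Z h : mparts h -> (2%:E * L2normsq vol h =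
    \int[vol]_(p in [set: borel M]) (2 * Normc.normc (h p) ^+ 2)%:E)%E.
  move=> mh; rewrite /L2normsq -ge0_integralZl_EFin //.
    by move=> p _; rewrite lee_fin sqr_ge0.
  exact: mparts_normc.
have m2 h : mparts h ->
    measurable_fun [set: borel M] (fun p : borel M => (2 * Normc.normc (h p) ^+ 2)%:E).
  by move=> mh; apply/measurable_EFinP; apply: measurable_funM => //; apply/measurable_EFinP; exact: mparts_normc.
have p2 (h : M -> R[i]) p : (0 <= (2 * Normc.normc (h p) ^+ 2)%:E)%E.
  by rewrite lee_fin mulr_ge0 // sqr_ge0.
rewrite (Z _ mfg) (Z _ mg) -ge0_integralD //;
  try exact: (m2 _ mfg); try exact: (m2 _ mg); try by move=> p _; rewrite lee_fin mulr_ge0 // sqr_ge0.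
apply: ge0_le_integral => //.
- by move=> p _; rewrite lee_fin sqr_ge0.
- exact: mparts_normc.
- by apply: emeasurable_funD; exact: m2.
- move=> p _; rewrite -EFinD lee_fin !normc_sqr !partD !partN.
  have H (a b : R) : a ^+ 2 <= 2 * (a - b) ^+ 2 + 2 * b ^+ 2.
    by rewrite -subr_ge0 (_ : _ - _ = (a - 2 * b) ^+ 2); [exact: sqr_ge0|ring].
  have := H (part true (f p)) (part true (g p)); have := H (part false (f p)) (part false (g p)).
  by lra.
Qed.

Lemma L2_weak_id u : L2 vol u -> weak_apply A vol 1 (fun v => v) u u.
Proof.
move=> Lu; split=> //; exists (fun v => v); split=> //; split=> //.
exact: diff_operator_id.
Qed.

Lemma hint_sqr_le_vol i x s (W : R) (g : M -> R) (B : R) :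
  hbox x s `<=` chart_image A i -> 0 < W -> (forall y, hbox x s y -> W <= sqrt_det G i y) ->
  rsmooth A g -> (\int[vol]_(p in [set: borel M]) (g p ^+ 2)%:E <= B%:E)%E ->
  hint x s (fun y => g (chart_inv A i y) * g (chart_inv A i y)) <= W^-1 * B.
Proof.
move=> xs W0 wW sg gB; rewrite ler_pdivlMl //; pose D := chart_image A i.
have sgi : smooth_on D (fun y => g (chart_inv A i y)) := sg i.
have sgg : smooth_on D (fun y => g (chart_inv A i y) * g (chart_inv A i y)).
  exact: (smooth_onM sgi sgi).
rewrite -(hintZ _ xs sgg).
apply: (@le_trans _ _ (hint x s (fun y => (g (chart_inv A i y) * g (chart_inv A i y)) * sqrt_det G i y))).
  apply: (hint_le xs); [exact: (smooth_onM (smooth_on_cst W) sgg)| |].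
    exact: (smooth_onM sgg (smooth_on_sqrt_det mG (i := i))).
  move=> y By; rewrite mulrC; apply: ler_wpM2l; last exact: wW.
  exact: sqr_ge0.
rewrite -lee_fin; apply: le_trans gB.
apply: (@hint_le_vol _ _ _ _ A G vol hM mG volG i x s (fun p => g p ^+ 2) xs).
  by move=> j; exact: (smooth_onM (sg j) (sg j)).
by move=> p; exact: sqr_ge0.
Qed.

(* On thin strips [0 <= y_0 <= d] the approximating test functions satisfy
   [int v^2 <= 4 d^2 int (d_0 v)^2], so [int u^2 = O(d^2)] over sets of measure of order [d]. *)
Lemma dirichlet_boundary u i x c : msmooth A u -> H10 A vol u ->
  chart_image A i x -> half_space_boundary x -> part c (u (chart_inv A i x)) = 0.
Proof.
move=> su [[Lu Hu] [phi [tphi Hphi]]] Ix [Hx [k [k0 xk]]].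
pose D := chart_image A i; have rD : relopen D := chart_image_relopen A i.
have sw : smooth_on D (sqrt_det G i) := smooth_on_sqrt_det mG (i := i).
pose f0 y := part c (u (chart_inv A i y)).
have sf0 : smooth_on D f0 by exact: (msmooth_part c su).
apply/eqP; rewrite -/(f0 x); apply: contraT => fx.
have fp : 0 < `|f0 x| / 2 by rewrite divr_gt0 // normr_gt0.
have wx : 0 < sqrt_det G i x / 2 by rewrite divr_gt0 // (sqrt_det_gt0 mG).
have [s1 s10 Hs1] := smooth_on_near rD Ix sf0 fp.
have [s2 s20 Hs2] := smooth_on_near rD Ix sw wx.
have [s3 s30 Hs3] := relopen_hbox rD Ix.
pose s := Num.min s1 (Num.min s2 (s3 / 2)).
have s0 : 0 < s by rewrite !lt_min s10 s20 divr_gt0.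
have ss1 : s <= s1 by rewrite ge_min lexx.
have ss2 : s <= s2 by rewrite !ge_min lexx orbT.
have ss3 : 2 * s <= s3 by rewrite -ler_pdivlMl // mulrC !ge_min lexx !orbT.
have xs2 : hbox x (2 * s) `<=` D by move=> y /(hbox_subset ss3)/Hs3.
have xs : hbox x s `<=` D by move=> y /(hbox_subset (s' := 2 * s)); rewrite ler_peMl ?ler1n ?(ltW s0)// => /(_ isT)/xs2.
set W := sqrt_det G i x / 2 in wx Hs2.
have wW y : hbox x s y -> W <= sqrt_det G i y.
  by move=> /(hbox_subset ss2)/Hs2 [_]; rewrite ltr_norml /W => /andP[]; lra.
have fW y : hbox x s y -> (`|f0 x| / 2) ^+ 2 <= f0 y * f0 y.
  move=> /(hbox_subset ss1)/Hs1 [_ h]; rewrite -expr2 -[leRHS]real_normK ?num_real//.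
  rewrite ler_pXn2r ?nnegrE ?normr_ge0 ?(ltW fp)//.
  have := ler_normB (f0 x) (f0 y); have := ler_distD (f0 y) (f0 x) 0; rewrite !subr0 distrC.
  by move: h; lra.
pose P := field_operator A i k x s.
have dP : diff_operator A 1 P by exact: diff_operator_field.
have [f wf] := Hu P dP.
have Lf : L2 vol f by case: wf.
have sphi m : msmooth A (phi m) by case: (tphi m).
have mP m : mparts (fun p => P (phi m) p).
  by move=> c'; apply: rsmooth_measurable; exact: rsmooth_field_operator.
have cvP := Hphi P f dP wf.
have cvI := Hphi _ _ (diff_operator_id A) (L2_weak_id Lu).
have [K KE] : exists K : R, L2normsq vol f = K%:E.
  exists (fine (L2normsq vol f)); rewrite fineK // ge0_fin_numE; first by case: Lf.
  by apply: integral_ge0 => p _; rewrite lee_fin sqr_ge0.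
have K0 : 0 <= K.
  by rewrite -lee_fin -KE; apply: integral_ge0 => p _; rewrite lee_fin sqr_ge0.
have near0 (v : nat -> \bar R) (e : R) : v @ \oo --> 0%E -> 0 < e ->
    exists N, forall m, (N <= m)%N -> (v m < e%:E)%E.
  move=> cv e0; have [|N _ HN] := cv [set y | (y < e%:E)%E].
    exact: (@nbhs_open_ereal_lt _ 0 (fun=> e) e0).
  by exists N => m Nm; exact: HN.
have hintW := hint_sqr_le_vol xs wx wW.
pose v m y := part c (phi m (chart_inv A i y)).
have sv m : smooth_on D (v m) by exact: (msmooth_part c (sphi m)).
have [m1 Hm1] := near0 _ 1 cvP ltr01.
pose K' := 2 + 2 * K; have K'0 : 0 < K' by rewrite /K'; lra.
have dvB m : (m1 <= m)%N ->
    hint x s (fun y => rpartial k (v m) y * rpartial k (v m) y) <= W^-1 * K'.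
  move=> /Hm1 lt1.
  have sg : rsmooth A (fun p => part c (P (phi m) p)) by exact: rsmooth_field_operator.
  have := hintW _ K' sg; rewrite (_ : hint x s _ = hint x s (fun y => rpartial k (v m) y * rpartial k (v m) y)).
    apply; apply: le_trans (L2normsq_part c (mP m)) _.
    apply: le_trans (L2normsq_triangle (mP m) (L2_mparts Lf)) _.
    rewrite KE (_ : K'%:E = (2%:E * 1%:E + 2%:E * K%:E)%E); last by rewrite -!EFinM -EFinD mulr1.
    by apply: leeD => //; rewrite lee_pmul2l //; exact: ltW.
  apply: eq_bint => y By; have [Dy Ey] := chart_invP (xs y By).
  rewrite /P part_field_operator (lift_inv _ (xs y By) (xs y By)) plateau1 ?mul1r//.
  by have [] := (hboxP _ _ _).1 By.
have duB e : 0 < e -> exists N, forall m, (N <= m)%N ->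
    hint x s (fun y => (v m y - f0 y) * (v m y - f0 y)) <= W^-1 * e.
  move=> e0; have [N HN] := near0 _ e cvI e0; exists N => m /HN lte.
  have sg : rsmooth A (fun p => part c (phi m p) + part c (- u p)).
    apply: rsmoothD; first exact: (msmooth_part c (sphi m)).
    have : rsmooth A (fun p => -1 * part c (u p)).
      by apply: rsmoothM; [exact: rsmooth_cst|exact: msmooth_part].
    by under [X in rsmooth _ X -> _]eq_fun do rewrite mulN1r -partN.
  have := hintW _ e sg; rewrite (_ : hint x s _ = hint x s (fun y => (v m y - f0 y) * (v m y - f0 y))).
    apply; apply: le_trans (ltW lte).
    have := L2normsq_part c (mpartsB (msmooth_mparts (sphi m)) (msmooth_mparts su)).
    by under eq_integral do rewrite partD.
  by apply: eq_bint => y By; rewrite !partN.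
pose C := W^-1 * (8 * K' + 2).
have C0 : 0 < C by rewrite mulr_gt0 ?invr_gt0//; lra.
pose V' := \prod_(m | m != k) (hbox_hi x s ord0 m - hbox_lo x s ord0 m).
have V'0 : 0 < V'.
  apply: prodr_gt0 => m _; rewrite !mxE subr_gt0; case: eqP => [/Hx xm|_].
    by rewrite gt_max ltr_wpDl //= ltrD2l gtrN.
  by rewrite ltrD2l gtrN.
pose c0 := (`|f0 x| / 2) ^+ 2; have c00 : 0 < c0 by rewrite exprn_gt0.
pose d := Num.min s (c0 * V' / (2 * C)).
have d0 : 0 < d.
  rewrite lt_min s0 /=; apply: divr_gt0; [exact: mulr_gt0|by rewrite mulr_gt0].
have ds : d <= s by rewrite ge_min lexx.
have dC : d * (2 * C) <= c0 * V'.
  have C20 : 0 < 2 * C by rewrite mulr_gt0.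
  rewrite -(ler_pdivlMr _ _ C20); have : d <= c0 * V' / (2 * C) by rewrite ge_min lexx orbT.
  by [].
pose a := hbox_lo x s; pose b : V := \row_m (if m == k then d else x ord0 m + s).
have ak : a ord0 k = 0 by rewrite mxE k0 eqxx xk sub0r max_l // oppr_le0 ltW.
have bk : b ord0 k = d by rewrite mxE eqxx.
have bm m : m != k -> b ord0 m = hbox_hi x s ord0 m by move=> /negbTE mk; rewrite !mxE mk.
have abm m : a ord0 m <= b ord0 m.
  have [->|mk] := eqVneq m k; first by rewrite ak bk ltW.
  rewrite (bm _ mk) !mxE; case: eqP => [/Hx xm|_]; rewrite ?ge_max; lra.
have abs : box a b `<=` hbox x s.
  move=> y By m; have /andP[h1 h2] := By m; rewrite h1 /=.
  have [mk|mk] := eqVneq m k; last by rewrite -(bm _ mk).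
  by apply: le_trans h2 _; rewrite mk bk mxE xk add0r.
have abD : box a b `<=` D by move=> y /abs/xs.
have [N HN] := duB _ (exprn_gt0 2 d0).
pose m := maxn N m1.
have [Hm Hm'] : (N <= m)%N /\ (m1 <= m)%N by rewrite leq_maxl leq_maxr.
have {}dvB := dvB m Hm'; have {}duB := HN m Hm.
have sdv := smooth_on_rpartial k rD (sv m).
have sdf : smooth_on D (fun y => v m y - f0 y) := smooth_onB (sv m) sf0.
have sub (g : V -> R) : smooth_on D g -> bint a b (fun y => g y * g y) <= hint x s (fun y => g y * g y).
  move=> sg; apply: (bint_subset abs).
    exact: (smooth_on_box xs (smooth_onM sg sg)).
  by move=> y _; exact: sqr_ge0.
have B1 : bint a b (fun y => v m y * v m y) <= 4 * d ^+ 2 * (W^-1 * K').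
  have ab0 : 0 <= a ord0 k by rewrite ak.
  have abk : a ord0 k < b ord0 k by rewrite ak bk.
  have abd : b ord0 k - a ord0 k <= d by rewrite ak bk subr0.
  apply: le_trans (strip_poincare rD abD ab0 abk abd (sv m) _) _.
    move=> y By yk; have Dy := abD y By; rewrite /v (test_function_boundary (tphi m) Dy) ?part0//.
    by split; [exact: chart_image_half Dy|exists k; rewrite yk ak].
  apply: ler_wpM2l; first by rewrite mulr_ge0 // sqr_ge0.
  exact: le_trans (sub _ sdv) dvB.
have B2 : bint a b (fun y => (v m y - f0 y) * (v m y - f0 y)) <= W^-1 * d ^+ 2.
  exact: le_trans (sub _ sdf) duB.
have B3 : bint a b (fun y => f0 y * f0 y) <= C * d ^+ 2.
  have s1' := smooth_onM (sv m) (sv m); have s2' := smooth_onM sdf sdf.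
  apply: (@le_trans _ _ (bint a b (fun y => 2 * (v m y * v m y) + 2 * ((v m y - f0 y) * (v m y - f0 y))))).
    apply: bint_le.
    - exact: (smooth_on_box abD (smooth_onM sf0 sf0)).
    - exact: (smooth_on_box abD (smooth_onD (smooth_onM (smooth_on_cst 2) s1') (smooth_onM (smooth_on_cst 2) s2'))).
    - move=> y _; rewrite -subr_ge0 (_ : _ - _ = (2 * v m y - f0 y) ^+ 2); first exact: sqr_ge0.
      by move: (v m y) (f0 y) => z1 z2; ring.
  rewrite bintD; first last.
  - exact: (smooth_on_box abD (smooth_onM (smooth_on_cst 2) s2')).
  - exact: (smooth_on_box abD (smooth_onM (smooth_on_cst 2) s1')).
  rewrite (bintZ _ (smooth_on_box abD s1')) (bintZ _ (smooth_on_box abD s2')).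
  apply: le_trans (lerD (ler_wpM2l (ler0n _ 2) B1) (ler_wpM2l (ler0n _ 2) B2)) _.
  by rewrite le_eqVlt /C; apply/orP; left; apply/eqP; ring.
have B4 : c0 * (d * V') <= bint a b (fun y => f0 y * f0 y).
  have -> : c0 * (d * V') = bint a b (fun=> c0).
    rewrite (bint_cst _ abm) (bigD1 k) //= ak bk subr0; congr (_ * (_ * _)).
    by apply: eq_bigr => m' /bm ->.
  apply: bint_le; first exact: within_continuous_cst.
    exact: (smooth_on_box abD (smooth_onM sf0 sf0)).
  by move=> y /abs/fW.
have : c0 * V' * d <= C * d * d by move: (le_trans B4 B3); rewrite expr2 !mulrA [c0 * d * V']mulrAC.
rewrite ler_pM2r // => H.
have : C * d <= c0 * V' / 2 by rewrite ler_pdivlMr // -mulrA mulrCA [C * _]mulrC.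
have := mulr_gt0 c00 V'0; lra.
Qed.

End Dirichlet.

(** * Local Weyl bound and the spectral function *)

Section Orthonormal.
Context {R : realType} {M : ptopologicalType}.
Context (vol : {measure set (borel M) -> \bar R}).
Implicit Types (u v : M -> R[i]) (c : bool) (f : M -> R).

Lemma part_trueMconj (z z' : R[i]) :
  part true (z * z'^*) = part true z * part true z' + part false z * part false z'.
Proof. by case: z; case: z' => a b a' b' /=; rewrite mulrN opprK. Qed.

Lemma part_falseMconj (z z' : R[i]) :
  part false (z * z'^*) = part false z * part true z' - part true z * part false z'.
Proof. by case: z; case: z' => a b a' b' /=; rewrite mulrN addrC. Qed.

Lemma integrable_normc u : L2 vol u ->
  vol.-integrable [set: borel M] (fun p : borel M => (Normc.normc (u p) ^+ 2)%:E).
Proof.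
move=> Lu; apply/integrableP; split; first exact: (mparts_normc (L2_mparts Lu)).
rewrite (_ : integral _ _ _ = L2normsq vol u); first by case: Lu.
by apply: eq_integral => p _; rewrite gee0_abs // lee_fin sqr_ge0.
Qed.

Lemma integrable_partM u v c c' : L2 vol u -> L2 vol v ->
  vol.-integrable [set: borel M] (fun p : borel M => (part c (u p) * part c' (v p))%:E).
Proof.
move=> Lu Lv; have := integrableD measurableT (integrable_normc Lu) (integrable_normc Lv).
apply: le_integrable => //.
  by apply/measurable_EFinP; apply: measurable_funM; [exact: (L2_mparts Lu c)|exact: (L2_mparts Lv c')].
move=> p _; rewrite -EFinD !abse_EFin lee_fin [leRHS]ger0_norm; last by rewrite addr_ge0 ?sqr_ge0.
apply: (@le_trans _ _ (part c (u p) ^+ 2 + part c' (v p) ^+ 2)).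
  by apply: le_trans (young _ _ ltr01) _; rewrite mul1r lerD2l ler_piMl ?sqr_ge0// invf_le1 // mulr1 ler1n.
by apply: lerD; exact: part_sqr_le.
Qed.

Lemma integrable_inner u v c : L2 vol u -> L2 vol v ->
  vol.-integrable [set: borel M] (fun p : borel M => (part c (u p * (v p)^*))%:E).
Proof.
move=> Lu Lv; case: c.
  under eq_fun do rewrite part_trueMconj EFinD.
  by apply: integrableD => //; exact: integrable_partM.
under eq_fun do rewrite part_falseMconj EFinB.
by apply: integrableB => //; exact: integrable_partM.
Qed.

Lemma orthonormal_bound (u : nat -> M -> R[i]) N (e : nat -> bool -> R) :
  (forall j, L2 vol (u j)) -> (forall i j, cinner vol (u i) (u j) = (i == j)%:R) ->
  (\int[vol]_(p in [set: borel M]) ((\sum_(j < N) \sum_c e j c * part c (u j p)) ^+ 2)%:E <=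
   (\sum_(j < N) \sum_c e j c ^+ 2)%:E)%E.
Proof.
move=> Lu ou.
pose al (i j : 'I_N) := e i true * e j true + e i false * e j false.
pose be (i j : 'I_N) := e i false * e j true - e i true * e j false.
pose h (i j : 'I_N) p := al i j * part true (u i p * (u j p)^*) + be i j * part false (u i p * (u j p)^*).
have ih i j : vol.-integrable [set: borel M] (fun p : borel M => (h i j p)%:E).
  rewrite /h; under eq_fun do rewrite EFinD !EFinM.
  by apply: integrableD => //; apply: integrableZl => //; exact: integrable_inner.
have Ih i j : (\int[vol]_(p in [set: borel M]) (h i j p)%:E = (al i j * (i == j)%:R)%:E)%E.
  have E c : (\int[vol]_(p in [set: borel M]) (part c (u i p * (u j p)^*))%:E)%E =
      (part c ((i == j)%:R : R[i]))%:E.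
    rewrite -(inj_eq val_inj) -ou /cinner part_cintegral /Rintegral fineK //.
    by apply: integrable_fin_num => //; exact: integrable_inner.
  rewrite /h; under eq_integral do rewrite EFinD !EFinM.
  rewrite integralD //; try by apply: integrableZl => //; exact: integrable_inner.
  rewrite !integralZl //; try exact: integrable_inner.
  rewrite !E -!EFinM -EFinD; congr (_%:E).
  by case: (i == j) => /=; rewrite !(mulr0, mulr1, addr0).
have X2 p : (\sum_(j < N) \sum_c e j c * part c (u j p)) ^+ 2 <= \sum_i \sum_j h i j p.
  pose X := \sum_(j < N) (e j true * part true (u j p) + e j false * part false (u j p)).
  pose Y := \sum_(j < N) (e j true * part false (u j p) - e j false * part true (u j p)).
  have -> : \sum_(j < N) \sum_c e j c * part c (u j p) = X.
    by apply: eq_bigr => j _; rewrite big_bool.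
  have -> : \sum_i \sum_j h i j p = X ^+ 2 + Y ^+ 2.
    rewrite !expr2 /X /Y !big_distrlr /= -big_split; apply: eq_bigr => i _ /=.
    rewrite -big_split; apply: eq_bigr => j _ /=.
    rewrite /h /al /be part_trueMconj part_falseMconj /part.
    move: (complex.Re _) (complex.Im _) (complex.Re _) (complex.Im _) => a b a' b'.
    by ring.
  by rewrite lerDl sqr_ge0.
apply: (@le_trans _ _ (\int[vol]_(p in [set: borel M]) (\sum_i \sum_j h i j p)%:E)%E).
  apply: ge0_le_integral => //.
  - by move=> p _; rewrite lee_fin sqr_ge0.
  - apply/measurable_EFinP; apply: measurable_funX; apply: measurable_sum => j.
    by apply: measurable_sum => c; apply: measurable_funM => //; exact: (L2_mparts (Lu j)).
  - apply/measurable_EFinP; apply: measurable_sum => i; apply: measurable_sum => j.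
    by apply/measurable_EFinP; exact: measurable_int (ih i j).
  - by move=> p _; rewrite lee_fin.
under eq_integral do rewrite -sumEFin.
rewrite integral_sum //; last first.
  move=> i; under eq_fun do rewrite -sumEFin; exact: integrable_sum.
have -> : (\sum_(i < N) \int[vol]_(p in [set: borel M]) (\sum_j h i j p)%:E)%E =
    (\sum_(i < N) al i i)%:E.
  rewrite -sumEFin; apply: eq_bigr => i _; under eq_integral do rewrite -sumEFin.
  rewrite integral_sum // (eq_bigr _ (fun j _ => Ih i j)) sumEFin; congr (_%:E).
  rewrite (bigD1 i) //= eqxx mulr1 big1 ?addr0// => j ji.
  by rewrite eq_sym (negbTE ji) mulr0.
rewrite lee_fin le_eqVlt; apply/orP; left; apply/eqP; apply: eq_bigr => j _.
by rewrite big_bool /al !expr2.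
Qed.

End Orthonormal.

Section LocalBound.
Context {R : realType} {n : nat} {M : ptopologicalType} {I : finType}.
Context (A : atlas R n M I) (G : I -> 'rV[R]_n -> 'M[R]_n).
Context (vol : {measure set (borel M) -> \bar R}).
Context (hM : hausdorff_space M) (mG : riemannian_metric A G) (volG : riemannian_volume A G vol).
Local Notation V := 'rV[R]_n.
Implicit Types (i : I) (p : M) (x y : V) (c : bool).

Definition diffusion i (j k : 'I_n) x : R := sqrt_det G i x * invmx (G i x) j k.

Lemma smooth_on_diffusion i j k : smooth_on (chart_image A i) (diffusion i j k).
Proof.
by apply: smooth_onM; [exact: smooth_on_sqrt_det|exact: smooth_on_metric_inv].
Qed.

Lemma metric_inv_sym i x : chart_image A i x -> (invmx (G i x))^T = invmx (G i x).
Proof. by move=> Ix; rewrite trmx_inv (Defs.metric_sym mG Ix). Qed.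

Lemma diffusion_neq0 i k x : chart_image A i x -> diffusion i k k x != 0.
Proof.
move=> Ix; apply: mulf_neq0; first by rewrite gt_eqF // (sqrt_det_gt0 mG).
have uG := metric_unitmx mG Ix.
pose v : V := delta_mx 0 k *m invmx (G i x).
have v0 : v != 0.
  apply/eqP => /(congr1 (fun m => m *m G i x)); rewrite mulmxKV // mul0mx.
  by move=> /matrixP /(_ 0 k) /eqP; rewrite !mxE !eqxx oner_eq0.
have := metric_pos mG Ix v0; rewrite /v mulmxKV // trmx_mul (metric_inv_sym Ix).
rewrite mulmxA trmx_delta -colE -rowE !mxE => /gt_eqF/negbT.
by [].
Qed.

Lemma chart_elliptic i (a b : V) : box a b `<=` chart_image A i ->
  exists th L W : R, [/\ 0 < th, 0 < W,
    forall x j k, box a b x -> `|diffusion i j k x| <= L,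
    forall x (y : 'I_n -> R), box a b x ->
      th * (\sum_k y k ^+ 2) <= \sum_j \sum_k diffusion i j k x * y j * y k &
    forall x, box a b x -> W <= sqrt_det G i x].
Proof.
move=> abD.
have bounded f : smooth_on (chart_image A i) f -> exists B : R, 0 < B /\ forall x, box a b x -> `|f x| <= B.
  by move=> sf; apply: continuous_compact_bounded; [exact: box_compact|exact: smooth_on_box sf].
have [B [B0 HB]] : exists B : R, 0 < B /\ forall x, box a b x -> `|(sqrt_det G i x)^-1| <= B.
  apply: bounded; apply: smooth_onV; last exact: smooth_on_sqrt_det.
  by move=> x Ix; rewrite gt_eqF // (sqrt_det_gt0 mG).
have wB x : box a b x -> B^-1 <= sqrt_det G i x.
  move=> Bx; have w0 := sqrt_det_gt0 mG (abD x Bx).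
  by rewrite invf_ple ?posrE//; apply: le_trans (ler_norm _) (HB x Bx).
have /choice [g Hg] : forall jk : 'I_n * 'I_n, exists K : R, 0 < K /\
    forall x, box a b x -> `|G i x jk.1 jk.2| <= K.
  by move=> [j k]; apply: bounded; exact: (metric_smooth mG).
have /choice [l Hl] : forall jk : 'I_n * 'I_n, exists K : R, 0 < K /\
    forall x, box a b x -> `|diffusion i jk.1 jk.2 x| <= K.
  by move=> [j k]; apply: bounded; exact: smooth_on_diffusion.
pose K := n%:R * (\sum_jk g jk) + 1; pose L := \sum_jk l jk.
have gsum jk : g jk <= \sum_jk g jk.
  by rewrite (bigD1 jk) //= lerDl sumr_ge0 // => q _; exact: ltW (Hg q).1.
have lsum jk : l jk <= L.
  by rewrite /L (bigD1 jk) //= lerDl sumr_ge0 // => q _; exact: ltW (Hl q).1.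
have K0 : 0 < K.
  rewrite /K ltr_wpDl // mulr_ge0 // sumr_ge0 // => q _; exact: ltW (Hg q).1.
exists (B^-1 * K^-1), L, B^-1; split.
- by rewrite mulr_gt0 ?invr_gt0.
- by rewrite invr_gt0.
- by move=> x j k Bx; apply: le_trans ((Hl (j, k)).2 x Bx) (lsum _).
- move=> x y Bx; have Ix := abD x Bx; pose v : V := \row_k y k.
  have qK (v' : V) : qform (G i x) v' <= K * \sum_k v' ord0 k ^+ 2.
    rewrite qformE; set g0 := \sum_jk g jk in K gsum K0 *.
    apply: (@le_trans _ _ (\sum_j \sum_k g0 * (2^-1 * (v' ord0 j ^+ 2 + v' ord0 k ^+ 2)))).
      apply: ler_sum => j _; apply: ler_sum => k _; apply: le_trans (ler_norm _) _.
      rewrite -mulrA normrM; apply: ler_pM => //.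
        exact: le_trans ((Hg (j, k)).2 x Bx) (gsum _).
      rewrite ler_norml; have := sqr_ge0 (v' ord0 j + v' ord0 k); have := sqr_ge0 (v' ord0 j - v' ord0 k).
      by rewrite sqrrB sqrrD => h1 h2; apply/andP; split; lra.
    have -> : \sum_j \sum_k g0 * (2^-1 * (v' ord0 j ^+ 2 + v' ord0 k ^+ 2)) = n%:R * g0 * \sum_k v' ord0 k ^+ 2.
      transitivity (\sum_(j < n) (g0 * 2^-1) * (n%:R * v' ord0 j ^+ 2 + \sum_k v' ord0 k ^+ 2)).
        apply: eq_bigr => j _; rewrite -mulr_sumr -mulr_sumr big_split /= sumr_const card_ord.
        by rewrite -[_ *+ n]mulr_natl mulrA.
      rewrite -mulr_sumr big_split /= -mulr_sumr sumr_const card_ord -[_ *+ n]mulr_natl.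
      by field.
    apply: ler_wpM2r; last by rewrite /K -/g0 lerDl.
    by rewrite sumr_ge0 // => k _; exact: sqr_ge0.
  have := qform_inv_ge v (Defs.metric_sym mG Ix) (metric_pos mG Ix) K0 qK.
  rewrite qformE (eq_bigr (fun k => y k ^+ 2)) => [E|k _]; last by rewrite mxE.
  have -> : \sum_j \sum_k diffusion i j k x * y j * y k =
      sqrt_det G i x * \sum_j \sum_k invmx (G i x) j k * v ord0 j * v ord0 k.
    rewrite mulr_sumr; apply: eq_bigr => j _; rewrite mulr_sumr; apply: eq_bigr => k _.
    by rewrite !mxE /diffusion !mulrA.
  rewrite -mulrA; apply: ler_pM => //.
  + by rewrite invr_ge0 ltW.
  + apply: mulr_ge0; first by rewrite invr_ge0 ltW.
    by rewrite sumr_ge0 // => k _; exact: sqr_ge0.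
  + exact: wB.
- exact: wB.
Qed.

Lemma div_linear i (J : finType) (e : J -> R) (F : J -> V -> R) y :
  chart_image A i y -> (forall q, smooth_on (chart_image A i) (F q)) ->
  \sum_j rpartial j (fun z => \sum_l diffusion i j l z * rpartial l (fun t => \sum_q e q * F q t) z) y =
  \sum_q e q * \sum_j rpartial j (fun z => \sum_l diffusion i j l z * rpartial l (F q) z) y.
Proof.
move=> Iy sF; have rD := chart_image_relopen A i.
have sA j l := @smooth_on_diffusion i j l.
have seF q : smooth_on (chart_image A i) (fun t => e q * F q t).
  exact: (smooth_onM (smooth_on_cst _) (sF q)).
have sfl q j : smooth_on (chart_image A i) (fun z => \sum_l diffusion i j l z * rpartial l (F q) z).
  apply: smooth_on_bigsum => l _; exact: (smooth_onM (sA j l) (smooth_on_rpartial l rD (sF q))).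
have sefl q j : smooth_on (chart_image A i) (fun z => e q * \sum_l diffusion i j l z * rpartial l (F q) z).
  exact: (smooth_onM (smooth_on_cst _) (sfl q j)).
transitivity (\sum_j \sum_q e q * rpartial j (fun z => \sum_l diffusion i j l z * rpartial l (F q) z) y).
  apply: eq_bigr => j _.
  transitivity (rpartial j (fun z => \sum_q e q * \sum_l diffusion i j l z * rpartial l (F q) z) y).
    apply/esym/(rpartial_eq j rD _ Iy); last by apply: smooth_on_bigsum => q _; exact: sefl.
    move=> z Iz; under eq_bigr do rewrite mulr_sumr.
    rewrite exchange_big; apply: eq_bigr => l _.
    rewrite (rpartial_sum _ _ rD Iz) //= mulr_sumr; apply: eq_bigr => q _.
    by rewrite (rpartialZ _ l rD Iz (sF q)) mulrCA.
  rewrite (rpartial_sum _ _ rD Iy) => [|q _]; last exact: sefl.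
  by apply: eq_bigr => q _; rewrite (rpartialZ _ j rD Iy (sfl q j)).
by rewrite exchange_big; apply: eq_bigr => q _; rewrite mulr_sumr.
Qed.

Context (u : nat -> M -> R[i]) (lam : nat -> R).
Context (eig : dirichlet_eigenbasis A G vol u lam).

Let component j c p : R := part c (u j p).

Lemma component_smooth j c : rsmooth A (component j c).
Proof. exact: (msmooth_part c (eigen_smooth eig j)). Qed.

Lemma component_eq i j c y : chart_image A i y ->
  \sum_k rpartial k (fun z => \sum_l diffusion i k l z *
     rpartial l (component j c \o chart_inv A i) z) y =
  - (sqrt_det G i y * (lam j * component j c (chart_inv A i y))).
Proof.
move=> Iy; have [_ _ wu] := eigen_eq eig j.
rewrite -(eigen_chart hM mG volG c (eigen_smooth eig j) wu Iy) /lap_chart mulrN opprK.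
by rewrite mulrA mulfV ?mul1r// gt_eqF // (sqrt_det_gt0 mG).
Qed.

Lemma component_dirichlet i j c y : chart_image A i y -> half_space_boundary y ->
  component j c (chart_inv A i y) = 0.
Proof.
move=> Iy yb; have [Hu _ _] := eigen_eq eig j.
exact: (dirichlet_boundary hM mG volG c (eigen_smooth eig j) Hu Iy yb).
Qed.

Lemma eigenfunction_L2 j : L2 vol (u j).
Proof. by have [[[]]] := eigen_eq eig j. Qed.

Lemma eigenvalue_gt0 j : 0 < lam j.
Proof. exact: lt_le_trans (eigen_pos eig) (eigen_mono eig (leq0n j)). Qed.

Lemma local_bound i z (s : seq 'I_n) : chart_image A i z -> exists rho C : R,
  [/\ 0 < rho, 0 <= C & forall x L N, hbox z rho x -> 0 < L ->
    (forall j, (j < N)%N -> lam j <= L) ->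
    \sum_(j < N) \sum_c rpartials s (component j c \o chart_inv A i) x ^+ 2 <=
      C * Num.sqrt L ^+ (n + 2 * size s)].
Proof.
move=> Iz; pose D := chart_image A i; have rD : relopen D := chart_image_relopen A i.
have [rho2 rho20 Hz] := relopen_hbox rD Iz.
pose rho := rho2 / 2; have rho0 : 0 < rho by rewrite divr_gt0.
have rhoE : rho + rho = rho2 by rewrite /rho -splitr.
have [th [Lb [W [th0 W0 HL Hell HW]]]] := chart_elliptic Hz.
have sA j k : smooth_on D (diffusion i j k) by exact: smooth_on_diffusion.
have sw : smooth_on D (sqrt_det G i) := smooth_on_sqrt_det mG (i := i).
have nA x (k : 'I_n) : D x -> k = 0%N :> nat -> diffusion i k k x != 0.
  by move=> Ix _; exact: diffusion_neq0.
have [C0 C00 HC] := pointwise_bound rD Hz (@box_compact _ _ _ _) sA sw th0 HL Hell nA s.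
pose l0 := Num.sqrt (lam 0%N); have l00 : 0 < l0 by rewrite sqrtr_gt0 eigenvalue_gt0.
pose m := Num.min 1 (rho / 2); have m0 : 0 < m by rewrite lt_min ltr01 divr_gt0.
pose ka := Num.min 1 (l0 * m); have ka0 : 0 < ka by rewrite lt_min ltr01 mulr_gt0.
have ka1 : ka <= 1 by rewrite ge_min lexx.
exists rho, (W^-1 * (C0 * ka^-1 ^+ (n + 2 * size s))); split=> //.
  apply: mulr_ge0; first by rewrite invr_ge0 ltW.
  by apply: mulr_ge0 => //; rewrite exprn_ge0 // invr_ge0 ltW.
move=> x L N Bx L0 lamL.
have sL0 : 0 < Num.sqrt L by rewrite sqrtr_gt0.
have pos : 0 <= W^-1 * (C0 * ka^-1 ^+ (n + 2 * size s)) * Num.sqrt L ^+ (n + 2 * size s).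
  apply: mulr_ge0; last by rewrite exprn_ge0 // ltW.
  apply: mulr_ge0; first by rewrite invr_ge0 ltW.
  by apply: mulr_ge0 => //; rewrite exprn_ge0 // invr_ge0 ltW.
case: N lamL => [|N] lamL; first by rewrite big_ord0.
pose d j c := rpartials s (component j c \o chart_inv A i) x.
pose SS := \sum_(j < N.+1) \sum_c d j c ^+ 2; rewrite -[leLHS]/SS.
have S0 : 0 <= SS by apply: sumr_ge0 => j _; apply: sumr_ge0 => c _; exact: sqr_ge0.
have [->//|Sn] := eqVneq SS 0.
have {S0 Sn}S0 : 0 < SS by rewrite lt_def Sn.
have Hx : half_space x by have [] := (hboxP _ _ _).1 Bx.
pose r := ka / Num.sqrt L; have r0 : 0 < r by rewrite divr_gt0.
have rm : r <= m.
  rewrite ler_pdivrMr // mulrC; apply: (@le_trans _ _ (l0 * m)); first by rewrite ge_min lexx orbT.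
  by apply: ler_wpM2r; [exact: ltW|apply: ler_wsqrtr; exact: lamL].
have r1 : r <= 1 by apply: le_trans rm _; rewrite ge_min lexx.
have r2 : 2 * r <= rho.
  by rewrite -ler_pdivlMl // mulrC; apply: le_trans rm _; rewrite ge_min lexx orbT.
have xZ : hbox x (2 * r) `<=` hbox z rho2.
  move=> y /hboxP [Hy yx]; apply/hboxP; split=> // k.
  have [_ /(_ k) xz] := (hboxP _ _ _).1 Bx.
  rewrite -(subrK (x ord0 k) (y ord0 k)) -addrA -rhoE; apply: le_trans (ler_normD _ _) _.
  by apply: lerD => //; exact: le_trans (yx k) r2.
have xD : hbox x (2 * r) `<=` D by move=> y /xZ/Hz.
have Dx : D x.
  apply: Hz; have [_ xz] := (hboxP _ _ _).1 Bx; apply/hboxP; split=> // k.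
  by apply: le_trans (xz k) _; rewrite -rhoE lerDl ltW.
pose e j c := Num.sqrt W * d j c / Num.sqrt SS.
pose Um k p := \sum_(j < N.+1) \sum_c (e j c * lam j ^+ k) * component j c p.
pose F (q : 'I_N.+1 * bool) := component q.1 q.2 \o chart_inv A i.
have sF q : smooth_on D (F q) by exact: (component_smooth q.1 q.2).
pose U (k : nat) y := \sum_(q : 'I_N.+1 * bool) (e q.1 q.2 * lam q.1 ^+ k) * F q y.
have UE k y : U k y = Um k (chart_inv A i y).
  by rewrite /Um (pair_bigA _ (fun (j : 'I_N.+1) c => e j c * lam j ^+ k * component j c (chart_inv A i y))).
have sUm k : rsmooth A (Um k).
  apply: rsmooth_sum => j; apply: rsmooth_sum => c; apply: rsmoothM; first exact: rsmooth_cst.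
  exact: component_smooth.
have sU k : smooth_on D (U k).
  by apply: smooth_on_bigsum => q _; exact: (smooth_onM (smooth_on_cst _) (sF q)).
have e2 : \sum_(j < N.+1) \sum_c e j c ^+ 2 = W.
  transitivity (\sum_(j < N.+1) \sum_c (W / SS) * d j c ^+ 2).
    apply: eq_bigr => j _; apply: eq_bigr => c _; rewrite /e !exprMn exprVn.
    by rewrite (sqr_sqrtr (ltW W0)) (sqr_sqrtr (ltW S0)) mulrAC.
  under eq_bigr do rewrite -mulr_sumr.
  by rewrite -mulr_sumr -/SS divfK // gt_eqF.
have ad : admissible D (hbox z rho2) (diffusion i) (sqrt_det G i) x r U.
  split=> //.
  - move=> k y Dy yb; apply: big1 => q _.
    by rewrite /F /= (component_dirichlet q.1 q.2 Dy yb) mulr0.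
  - move=> k y Dy; rewrite (div_linear _ Dy sF) /U mulr_sumr -sumrN; apply: eq_bigr => q _.
    rewrite (component_eq q.1 q.2 Dy) exprSr /F /=.
    move: (component _ _ _) (sqrt_det _ _ _) (e _ _) (lam _) => z1 z2 z3 z4.
    by ring.
  - move=> k; rewrite (_ : hint x (2 * r) _ =
        hint x (2 * r) (fun y => Um k (chart_inv A i y) * Um k (chart_inv A i y))); last first.
      by apply: eq_bint => y _; rewrite UE.
    apply: (@le_trans _ _ (W^-1 * (L ^+ k ^+ 2 * W))).
      apply: (hint_sqr_le_vol hM mG volG xD W0 (fun y By => HW y (xZ y By)) (sUm k)).
      apply: le_trans (orthonormal_bound N.+1 (fun j c => e j c * lam j ^+ k) eigenfunction_L2 (eigen_orthonormal eig)) _.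
      rewrite lee_fin -e2 mulr_sumr; apply: ler_sum => j _; rewrite mulr_sumr; apply: ler_sum => c _.
      rewrite exprMn mulrC; apply: ler_wpM2r; first exact: sqr_ge0.
      have lj := ltW (eigenvalue_gt0 j).
      apply: lerXn2r; rewrite ?nnegrE ?exprn_ge0 ?(ltW L0)//.
      by apply: lerXn2r; rewrite ?nnegrE ?(ltW L0)//; exact: lamL.
    rewrite mulrC mulfK ?gt_eqF// (_ : 4 * k = (2 * (k * 2)))%N; last by rewrite (mulnC k) mulnA.
    rewrite -exprM (exprM r^-1 2); apply: lerXn2r; rewrite ?nnegrE ?sqr_ge0 ?(ltW L0)//.
    rewrite -[leLHS](sqr_sqrtr (ltW L0)); apply: lerXn2r; rewrite ?nnegrE ?invr_ge0 ?(ltW r0) ?(ltW sL0)//.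
    by rewrite /r invf_div ler_peMr ?(ltW sL0)// invf_ge1.
have := HC x r U ad.
have -> : rpartials s (U 0%N) x = Num.sqrt W * Num.sqrt SS.
  rewrite (rpartials_sum _ _ rD) => [|q _|//]; last exact: (smooth_onM (smooth_on_cst _) (sF q)).
  transitivity (\sum_(q : 'I_N.+1 * bool) e q.1 q.2 * d q.1 q.2).
    by apply: eq_bigr => q _; rewrite (rpartialsZ _ _ rD (sF q) Dx) expr0 mulr1.
  rewrite -(pair_bigA _ (fun (j : 'I_N.+1) c => e j c * d j c)) /=.
  transitivity (\sum_(j < N.+1) \sum_c (Num.sqrt W / Num.sqrt SS) * d j c ^+ 2).
    by apply: eq_bigr => j _; apply: eq_bigr => c _; rewrite /e expr2; ring.
  under eq_bigr do rewrite -mulr_sumr.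
  rewrite -mulr_sumr -/SS -{2}(sqr_sqrtr (ltW S0)).
  by field; rewrite gt_eqF // sqrtr_gt0.
rewrite exprMn (sqr_sqrtr (ltW W0)) (sqr_sqrtr (ltW S0)) => H.
rewrite -mulrA ler_pdivlMl //; apply: le_trans H _.
by rewrite /r invf_div exprMn mulrAC -mulrA le_refl.
Qed.

Lemma uniform_bound i (K : set M) (s : seq 'I_n) : compact K -> K `<=` chart_dom A i ->
  exists C : R, 0 <= C /\ forall p L N, K p -> 0 < L -> (forall j, (j < N)%N -> lam j <= L) ->
    \sum_(j < N) \sum_c rpartials s (component j c \o chart_inv A i) (chart_map A i p) ^+ 2 <=
      C * Num.sqrt L ^+ (n + 2 * size s).
Proof.
move=> cK Ki.
pose P (C : R) p := forall L N, 0 < L -> (forall j, (j < N)%N -> lam j <= L) ->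
    \sum_(j < N) \sum_c rpartials s (component j c \o chart_inv A i) (chart_map A i p) ^+ 2 <=
      C * Num.sqrt L ^+ (n + 2 * size s).
have [|B [_ HB]] := (compact_near_coveringP K).1 cK _ +oo%R P _.
  move=> q Kq; have Dq := Ki q Kq.
  have [rho [C [rho0 C0 HC]]] := @local_bound i (chart_map A i q) s (ex_intro2 _ _ q Dq erefl).
  have Dn : nbhs q (chart_dom A i) by apply: open_nbhs_nbhs; split=> //; exact: chart_dom_open.
  exists (chart_dom A i `&` chart_map A i @^-1` ball (chart_map A i q) rho, [set C' | C <= C']).
    split=> /=; last by apply: nbhs_pinfty_ge; rewrite num_real.
    by apply: filterI => //; apply: chart_map_nbhs => //; exact: nbhsx_ballx.
  move=> [p C'] [[Dp Bp] CC'] L N L0 lamL /=; apply: le_trans (HC _ _ _ _ L0 lamL) _.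
    apply/hboxP; split; first by apply: (@chart_image_half _ _ _ _ A i); exists p.
    move=> k; move: Bp; rewrite /= -ball_normE /= => /mx_norm_ltP -/(_ rho0 k).
    by rewrite !mxE distrC => /ltW.
  by apply: ler_wpM2r => //; rewrite exprn_ge0 // sqrtr_ge0.
exists (Num.max B 0 + 1); split; first by rewrite addr_ge0 // le_max lexx orbT.
move=> p L N Kp L0 lamL; apply: (HB (Num.max B 0 + 1)) => //.
by apply: le_lt_trans (ltr_pwDr ltr01 (lexx _)); rewrite le_max lexx.
Qed.

End LocalBound.

Section KernelDerivative.
Context {R : realType}.

Lemma partM c (k z : R[i]) : part c (k * z) =
  part true k * part c z + (if c then -1 else 1) * part false k * part (~~ c) z.
Proof. by case: c; case: k => a b; case: z => a' b' /=; rewrite ?mulN1r ?mul1r ?mulNr. Qed.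

Lemma part_conj c (z : R[i]) : part c (z^*) = (if c then 1 else -1) * part c z.
Proof. by case: c; case: z => a b /=; rewrite ?mulN1r ?mul1r. Qed.

Lemma cpartials_lincomb n (D : set 'rV[R]_n) N a (k : nat -> R[i]) (v : nat -> 'rV[R]_n -> R[i]) y :
  relopen D -> D y -> (forall m, csmooth_on D (v m)) ->
  cpartials a (fun y' => \sum_(m < N) k m * v m y') y = \sum_(m < N) k m * cpartials a (v m) y.
Proof.
move=> rD Dy sv; have sp m c : smooth_on D (fun y => part c (v m y)).
  by have [s1 s2] := sv m; case: c.
apply: part_ext => c; rewrite part_cpartials part_sum.
have st m : smooth_on D (fun y => part true (k m) * part c (v m y)).
  exact: (smooth_onM (smooth_on_cst _) (sp m c)).
have sf m : smooth_on D (fun y => (if c then -1 else 1) * part false (k m) * part (~~ c) (v m y)).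
  exact: (smooth_onM (smooth_on_cst _) (sp m (~~ c))).
transitivity (rpartials (multi_seq a) (fun y => \sum_(m < N) (part true (k m) * part c (v m y) +
    (if c then -1 else 1) * part false (k m) * part (~~ c) (v m y))) y).
  congr (rpartials _ _ y); apply/funext => z; rewrite part_sum; apply: eq_bigr => m _.
  exact: partM.
rewrite (rpartials_sum _ _ rD) => [|m _|//]; last exact: (smooth_onD (st m) (sf m)).
apply: eq_bigr => m _; rewrite (rpartialsD _ rD (st m) (sf m) Dy).
by rewrite (rpartialsZ _ _ rD (sp m c) Dy) (rpartialsZ _ _ rD (sp m (~~ c)) Dy) partM !part_cpartials.
Qed.

Lemma cpartials_conj n (D : set 'rV[R]_n) a (v : 'rV[R]_n -> R[i]) y :
  relopen D -> D y -> csmooth_on D v ->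
  cpartials a (fun y' => (v y')^*) y = (cpartials a v y)^*.
Proof.
move=> rD Dy [s1 s2]; apply: part_ext => c; rewrite part_conj !part_cpartials.
have sp : smooth_on D (fun y => part c (v y)) by case: c.
rewrite -(rpartialsZ _ _ rD sp Dy); congr (rpartials _ _ y); apply/funext => z.
exact: part_conj.
Qed.

Lemma csmooth_conj n (D : set 'rV[R]_n) (v : 'rV[R]_n -> R[i]) :
  csmooth_on D v -> csmooth_on D (fun y => (v y)^*).
Proof.
move=> [s1 s2]; split.
  by apply: eq_smooth_on s1 => y _; rewrite -[RHS]/(part true _) part_conj mul1r.
by apply: eq_smooth_on (smooth_onN s2) => y _; rewrite -[RHS]/(part false _) part_conj mulN1r.
Qed.

Lemma normc_conj (z : R[i]) : Normc.normc (z^*) = Normc.normc z.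
Proof. by case: z => a b /=; rewrite sqrrN. Qed.

Lemma normc_sum_le N (F : 'I_N -> R[i]) :
  Normc.normc (\sum_m F m) <= \sum_m Normc.normc (F m).
Proof.
apply: (big_ind2 (fun (z : R[i]) r => Normc.normc z <= r)) => [|z r z' r' h h'|//].
  by rewrite Normc.normc0.
by apply: le_trans (lerD h h'); exact: le_normcD.
Qed.

Lemma spectral_cutoff (lam : nat -> R) L : (forall i j, (i <= j)%N -> lam i <= lam j) ->
  finite_set [set j | lam j <= L] -> exists N, [set j | lam j <= L] = `I_N.
Proof.
move=> mono fin; have exN : exists m, ~~ (lam m <= L).
  apply: contrapT => H; apply: infinite_nat.
  rewrite (_ : setT = [set j | lam j <= L]) //; apply/seteqP; split=> // j _ /=.
  by apply: contrapT => /negP jL; apply: H; exists j.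
exists (ex_minn exN); case: ex_minnP => N HN minN; apply/seteqP; split=> j /= jL.
  rewrite ltnNge; apply: contra HN => Nj; exact: le_trans (mono _ _ Nj) jL.
by apply: contraLR jL => /minN; rewrite -leqNgt.
Qed.

End KernelDerivative.

Theorem theorem3 (R : realType) (n : nat) (M : ptopologicalType) (I : finType)
    (A : atlas R n M I) (G : I -> 'rV[R]_n -> 'M[R]_n)
    (vol : {measure set (borel M) -> \bar R})
    (u : nat -> M -> R[i]) (lam : nat -> R) (K : I -> set M) :
  hausdorff_space M -> compact [set: M] -> connected [set: M] ->
  mboundary A !=set0 ->
  riemannian_metric A G ->
  riemannian_volume A G vol ->
  dirichlet_eigenbasis A G vol u lam ->
  (forall i, compact (K i)) -> (forall i, K i `<=` chart_dom A i) ->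
  (forall p, exists i, K i p) ->
  forall a : 'I_(n + n) -> nat,
  exists C : R, 0 < C /\
    forall (L : R), 0 < L ->
    forall (i j : I) (p q : M), K i p -> K j q ->
      Normc.normc
        (kernel_derivative A (fun x y => spectral_function u lam x y L)
           a i j (chart_map A i p) (chart_map A j q))
      <= C * L `^ ((n + \sum_(k < n + n) a k)%:R / 2).
Proof.
move=> hM _ _ _ mG volG eig cK Kdom _ a.
pose al (k : 'I_n) := a (lshift n k); pose be (k : 'I_n) := a (rshift n k).
pose P (s : seq 'I_n) i (C : R) := 0 <= C /\ forall p L N, K i p -> 0 < L ->
    (forall j, (j < N)%N -> lam j <= L) ->
    \sum_(j < N) \sum_c rpartials s (fun y => part c (u j (chart_inv A i y))) (chart_map A i p) ^+ 2 <=
      C * Num.sqrt L ^+ (n + 2 * size s).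
have ub s i : exists C, P s i C by exact: (uniform_bound hM mG volG eig s (cK i) (Kdom i)).
have /choice [Ca HCa] := ub (multi_seq al); have /choice [Cb HCb] := ub (multi_seq be).
pose C := \sum_i Ca i + \sum_i Cb i.
have C0 : 0 <= C by rewrite addr_ge0 // sumr_ge0 // => i _; [case: (HCa i)|case: (HCb i)].
have leC i j : Ca i + Cb j <= C.
  apply: lerD; [rewrite (bigD1 i)|rewrite (bigD1 j)] => //=; rewrite lerDl sumr_ge0 // => l _.
    by case: (HCa l).
  by case: (HCb l).
exists (C + 1); split; first by rewrite ltr_wpDl.
move=> L L0 i j p q Kp Kq.
have [N NE] := spectral_cutoff (eigen_mono eig) (eigen_discrete eig L).
have lamL m : (m < N)%N -> lam m <= L.
  by move=> mN; have : `I_N m by []; rewrite -NE.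
set x := chart_map A i p; set y := chart_map A j q.
have Ix : chart_image A i x by exists p => //; exact: Kdom.
have Iy : chart_image A j y by exists q => //; exact: Kdom.
have rDi := chart_image_relopen A i; have rDj := chart_image_relopen A j.
pose ax m := cpartials al (u m \o chart_inv A i) x.
pose bx m := cpartials be (u m \o chart_inv A j) y.
have su k m : csmooth_on (chart_image A k) (u m \o chart_inv A k) := eigen_smooth eig m k.
have -> : kernel_derivative A (fun x y => spectral_function u lam x y L) a i j x y =
    \sum_(m < N) bx m * (ax m)^*.
  rewrite /kernel_derivative.
  transitivity (cpartials al (fun x' => \sum_(m < N) bx m * (u m (chart_inv A i x'))^*) x).
    congr (cpartials _ _ x); apply/funext => x'.
    rewrite (_ : (fun y' => _) = fun y' =>
        \sum_(m < N) (u m (chart_inv A i x'))^* * (u m \o chart_inv A j) y').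
      rewrite (cpartials_lincomb _ _ (fun m => (u m (chart_inv A i x'))^*) rDj Iy (su j)).
      by apply: eq_bigr => m _; rewrite mulrC.
    apply/funext => y'; rewrite /spectral_function NE.
    by rewrite (fsbig_ord _ N (fun m => (u m (chart_inv A i x'))^* * u m (chart_inv A j y'))).
  rewrite (cpartials_lincomb _ _ bx rDi Ix (fun m => csmooth_conj (su i m))).
  by apply: eq_bigr => m _; rewrite (cpartials_conj _ rDi Ix (su i m)).
pose X := Num.sqrt L; have X0 : 0 < X by rewrite sqrtr_gt0.
pose da := (\sum_k al k)%N; pose db := (\sum_k be k)%N.
have Ba : \sum_(m < N) Normc.normc (ax m) ^+ 2 <= Ca i * X ^+ (n + 2 * da).
  rewrite /da -size_multi_seq; apply: le_trans ((HCa i).2 p L N Kp L0 lamL).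
  apply: ler_sum => m _; rewrite normc_sqr big_bool !part_cpartials.
  by [].
have Bb : \sum_(m < N) Normc.normc (bx m) ^+ 2 <= Cb j * X ^+ (n + 2 * db).
  rewrite /db -size_multi_seq; apply: le_trans ((HCb j).2 q L N Kq L0 lamL).
  apply: ler_sum => m _; rewrite normc_sqr big_bool !part_cpartials.
  by [].
have powE : L `^ ((n + \sum_(k < n + n) a k)%:R / 2) = X ^+ (n + (da + db)).
  rewrite big_split_ord /= -/da -/db [_ / 2]mulrC powRrM (powR12_sqrt (ltW L0)).
  by rewrite (powR_mulrn _ (ltW X0)).
rewrite powE.
pose t := X ^+ db / X ^+ da; have t0 : 0 < t by rewrite divr_gt0 // exprn_gt0.
have ab (z w : R) : z * w <= 2^-1 * (t * w ^+ 2 + t^-1 * z ^+ 2).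
  have : 0 <= t^-1 * (t * w - z) ^+ 2 by rewrite mulr_ge0 ?sqr_ge0// invr_ge0 ltW.
  have -> : t^-1 * (t * w - z) ^+ 2 = t * w ^+ 2 + t^-1 * z ^+ 2 - 2 * (z * w).
    by field; rewrite gt_eqF.
  by move: (z * w) (t * w ^+ 2) (t^-1 * z ^+ 2) => z1 z2 z3; lra.
apply: le_trans (normc_sum_le _) _.
apply: (@le_trans _ _ (\sum_(m < N) 2^-1 * (t * Normc.normc (ax m) ^+ 2 + t^-1 * Normc.normc (bx m) ^+ 2))).
  by apply: ler_sum => m _; rewrite Normc.normcM normc_conj; exact: ab.
rewrite -mulr_sumr big_split /= -!mulr_sumr.
have Ea : t * (Ca i * X ^+ (n + 2 * da)) = Ca i * X ^+ (n + (da + db)).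
  rewrite /t mul2n -addnn !exprD; field; by rewrite gt_eqF // exprn_gt0.
have Eb : t^-1 * (Cb j * X ^+ (n + 2 * db)) = Cb j * X ^+ (n + (da + db)).
  rewrite /t mul2n -addnn !exprD; field; by rewrite !gt_eqF // exprn_gt0.
have := ler_wpM2l (ltW t0) Ba; rewrite Ea => {}Ba.
have ti0 : 0 <= t^-1 by rewrite invr_ge0 ltW.
have := ler_wpM2l ti0 Bb; rewrite Eb => {}Bb.
apply: (@le_trans _ _ (C * X ^+ (n + (da + db)))); last first.
  by apply: ler_wpM2r; [rewrite exprn_ge0 // ltW|rewrite lerDl].
have Xp : 0 <= X ^+ (n + (da + db)) by rewrite exprn_ge0 // ltW.
apply: le_trans (ler_wpM2r Xp (leC i j)); rewrite mulrDl.
have := mulr_ge0 (HCa i).1 Xp; have := mulr_ge0 (HCb j).1 Xp.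
move: Ba Bb; move: (t * _) (t^-1 * _) (Ca i * _) (Cb j * _) => z1 z2 z3 z4; lra.
Qed.
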